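(* Let $p\in(1,\infty)$, let $X,U,Z$ be Banach spaces, $A_m:Z\to X$, $G,M:Z\to U$ linear operators, and let $A$ (generator of the strongly continuous semigroup $\mathbb{T}=(T(t))_{t\ge0}$ on $X$), $B\in\mathcal{L}(U,X_{-1})$ and $C\in\mathcal{L}(D(A),U)$ be the associated operators, all as in the context. Assume that $(A,B,C)$ is a regular system on $X,U,U$, that the identity $I_U$ is an admissible feedback for it, and that $C$ is zero-class admissible for $A$. Let $\mathbb{T}^{cl}=(T^{cl}(t))_{t\ge0}$ be the strongly continuous semigroup on $X$ generated by $$A^{cl}=A_{-1}+BC_\Lambda,\qquad D(A^{cl})=\{x\in D(C_\Lambda):(A_{-1}+BC_\Lambda)x\in X\}.$$ If $\mathbb{T}$ is immediately compact on $X$ (i.e. $T(t)$ is a compact operator for every $t>0$), then $\mathbb{T}^{cl}$ is immediately compact on $X$ as well.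
   Context: Setting. $p\in(1,\infty)$ is fixed; $X,U,Z$ are Banach spaces with $Z\subset X$ continuously and densely. $A_m:Z\to X$ is a linear closed operator, $G:Z\to U$ is linear and surjective, $M:Z\to U$ is linear. The operator $A:=A_m$ with $D(A)=\{x\in Z: Gx=0\}$ generates a strongly continuous semigroup $\mathbb{T}=(T(t))_{t\ge0}$ on $X$, of type $\omega_0(A)$; $D(A)$ carries the graph norm. $R(\lambda,A)=(\lambda I-A)^{-1}$. $X_{-1}$ is the completion of $X$ for the norm $\|R(\beta,A)x\|$ ($\beta\in\rho(A)$); $\mathbb{T}$ extends to a strongly continuous semigroup $(T_{-1}(t))_{t\ge0}$ on $X_{-1}$ with generator $A_{-1}:X\to X_{-1}$ extending $A$. For $\lambda\in\rho(A)$, $G|_{\ker(\lambda-A_m)}$ is invertible and its inverse, the Dirichlet operator $D_\lambda$, lies in $\mathcal{L}(U,Z)$. Put $B:=(\lambda-A_{-1})D_\lambda\in\mathcal{L}(U,X_{-1})$ (independent of $\lambda\in\rho(A)$) and $C:=M|_{D(A)}\in\mathcal{L}(D(A),U)$. Control admissibility. Let $\Phi_tu=\int_0^tT_{-1}(t-s)Bu(s)\,ds$, $u\in L^p([0,t],U)$. $(A,B)$ is well-posed ($B$ is an admissible control operator for $A$) if $\mathrm{Range}(\Phi_{t_0})\subset X$ for some $t_0>0$. Observation admissibility. $(C,A)$ is well-posed ($C$ is an admissible observation operator for $A$) if for some $\tau>0$ there is $\gamma(\tau)>0$ with $\int_0^\tau\|CT(s)x\|^p\,ds\le\gamma(\tau)^p\|x\|^p$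 for all $x\in D(A)$. (Such an estimate then holds for every $\tau>0$.) $C$ is zero-class admissible if the best constant $\gamma(\tau)$ satisfies $\gamma(\tau)\to0$ as $\tau\to0$. Yosida extension. $C_\Lambda x=\lim_{\lambda\to+\infty}C\lambda R(\lambda,A)x$, with $D(C_\Lambda)$ the set of $x\in X$ for which this limit exists in $U$. Well-posed and regular systems. For $u\in W^{2,p}_{0,loc}([0,\infty),U):=\{v\in W^{2,p}_{loc}([0,\infty),U): v(0)=v'(0)=0\}$ one has $\Phi_tu\in Z$; put $(\mathbb{F}_\infty u)(t)=M\Phi_tu$. $(A,B,C)$ is well-posed on $X,U,U$ if $(A,B)$ and $(C,A)$ are well-posed and there are $\tau,\kappa_\tau>0$ with $\|\mathbb{F}_\infty u\|_{L^p([0,\tau],U)}\le\kappa_\tau\|u\|_{L^p([0,\tau],U)}$ for all $u\in W^{2,p}_{0,loc}([0,\infty),U)$; then $\mathbb{F}_\infty$ extends to a bounded operator on $L^p_{loc}([0,\infty),U)$. A well-posed system is regular (with feedthrough $0$) if $\lim_{t\to0^+}\frac1t\int_0^t(\mathbb{F}_\infty u_0)(\sigma)\,d\sigma=0$ in $U$ for each constant control $u_0(t)=v$, $v\in U$. Admissible feedback. For a regular system $(A,B,C)$, $I_U$ is an admissible feedback if $I-\mathbb{F}_\infty$ has uniformly bounded inverse, i.e. for some $\tau>0$ the restriction of $I-\mathbb{F}_\infty$ to $L^p([0,\tau],U)$ is boundedly invertible. Known fact fixing notation: if $(A,B,C)$ is regular and $I_U$ is an admissible feedback, then $A^{cl}$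 as defined in the claim generates a strongly continuous semigroup on $X$ (Staffans–Weiss perturbation theorem). *)

(* Defs.v *)
From HB Require Import structures.
From mathcomp Require Import all_boot all_order all_algebra.
From mathcomp Require Import complex.
From mathcomp Require Import all_classical all_reals all_analysis.

Set Implicit Arguments.
Unset Strict Implicit.
Unset Printing Implicit Defensive.
Import Order.TTheory GRing.Theory Num.Theory.
Import numFieldNormedType.Exports.

Local Open Scope classical_set_scope.
Local Open Scope ring_scope.

(** Banach spaces are [completeNormedModType (scalars k R)], so that real and
    complex spaces are both covered.  In MathComp-Analysis the norm takes its
    values in the scalar field; [rnorm] is the same norm with values in [R]. *)
Variant scalar_kind := RealScalars | ComplexScalars.

Definition scalars (k : scalar_kind) (R : realType) : numFieldType :=
  match k with
  | RealScalars => R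
  | ComplexScalars => R[i]
  end.

Definition of_real (k : scalar_kind) (R : realType) : R -> scalars k R :=
  match k return R -> scalars k R with
  | RealScalars => fun x => x
  | ComplexScalars => fun x => Complex x 0
  end.

Definition real_part (k : scalar_kind) (R : realType) : scalars k R -> R :=
  match k return scalars k R -> R with
  | RealScalars => fun x => x
  | ComplexScalars => fun x => complex.Re x
  end.

Definition rnorm (k : scalar_kind) (R : realType)
    (V : normedModType (scalars k R)) (x : V) : R := real_part `|x|.

Section Bochner.
Context (k : scalar_kind) (R : realType).
Local Notation K := (scalars k R).
Local Notation mu := (@lebesgue_measure R).
Implicit Types V : completeNormedModType K.

Definition simple_function V (s : R -> V) : Prop :=
  finite_set (range s) /\ forall v, measurable (s @^-1` [set v]).

Definition simple_integral V (D : set R) (s : R -> V) : V :=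
  \sum_(v \in range s) (of_real k (fine (mu (D `&` s @^-1` [set v])))) *: v.

(** Pointwise limits on [D] of Borel simple functions: every class of
    almost-everywhere equal Bochner measurable functions has such a
    representative. *)
Definition strongly_measurable V (D : set R) (f : R -> V) : Prop :=
  exists s : nat -> R -> V, (forall n, simple_function (s n)) /\
    forall t, D t -> s n t @[n --> \oo] --> f t.

Definition is_bochner V (a b : R) (f : R -> V) (v : V) : Prop :=
  strongly_measurable `[a, b] f /\
  exists s : nat -> R -> V,
    [/\ forall n, simple_function (s n),
        (\int[mu]_(t in `[a, b]) (rnorm (f t - s n t))%:E)%E
          @[n --> \oo] --> 0%E
      & simple_integral `[a, b] (s n) @[n --> \oo] --> v].

Definition bochner V (a b : R) (f : R -> V) : V := xget 0 (is_bochner a b f).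

Variable p : R.

Definition Lpnorm V (tau : R) (u : R -> V) : \bar R :=
  ((\int[mu]_(t in `[0%R, tau]) (rnorm (u t) `^ p)%:E) `^ p^-1)%E.

Definition Lp V (tau : R) (u : R -> V) : Prop :=
  strongly_measurable `[0, tau] u /\ (Lpnorm tau u < +oo)%E.

(** Functions on [0, +oo[ are represented by functions on [R], whose values at
    negative times are ignored. *)
Definition Lp_loc V (u : R -> V) : Prop := forall tau, 0 < tau -> Lp tau u.

(** [du] is the weak derivative of [u], and [u] is its absolutely continuous
    representative. *)
Definition W1p_loc V (u du : R -> V) : Prop :=
  [/\ Lp_loc u, Lp_loc du & forall t, 0 <= t -> u t = u 0 + bochner 0 t du].

Definition W2p0_loc V (u : R -> V) : Prop :=
  exists du ddu : R -> V,
    [/\ W1p_loc u du, W1p_loc du ddu, u 0 = 0 & du 0 = 0].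

End Bochner.

(** Unbounded operators are represented by their graphs. *)
Section Semigroups.
Context (k : scalar_kind) (R : realType).
Local Notation K := (scalars k R).
Implicit Types V : completeNormedModType K.

Record c0_semigroup V (T : R -> {linear V -> V}) : Prop := {
  c0_bounded : forall t, 0 <= t -> continuous (T t) ;
  c0_id : forall x, T 0 x = x ;
  c0_add : forall s t, 0 <= s -> 0 <= t -> forall x, T (s + t) x = T s (T t x) ;
  c0_strong : forall x, T t x @[t --> 0^'+] --> x }.

Definition generator V (T : R -> {linear V -> V}) : set (V * V) :=
  [set xy | of_real k h^-1 *: (T h xy.1 - xy.1) @[h --> 0^'+] --> xy.2].

Definition resolvent V (A : set (V * V)) (lam : K) (x : V) : V :=
  xget 0 [set y | A (y, lam *: y - x)].

Definition resolvent_set V (A : set (V * V)) : set K :=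
  [set lam | (forall x, exists! y, A (y, lam *: y - x)) /\
             continuous (resolvent A lam)].

Definition compact_operator V (L : V -> V) : Prop :=
  precompact (L @` [set x | rnorm x <= 1]).

Definition immediately_compact V (T : R -> {linear V -> V}) : Prop :=
  forall t, 0 < t -> compact_operator (T t).

End Semigroups.

Section BoundarySystem.
Context (k : scalar_kind) (R : realType).
Local Notation K := (scalars k R).
Local Notation mu := (@lebesgue_measure R).
Variables (p : R) (X U Z : completeNormedModType K).
(** The inclusion [Z] into [X] is the map [iZ]. *)
Variables (iZ Am : {linear Z -> X}) (G M : {linear Z -> U}).
Variable T : R -> {linear X -> X}.

Definition main_operator : set (X * X) :=
  [set (iZ z, Am z) | z in [set z | G z = 0]].
Local Notation A := main_operator.

Definition dirichlet (lam : K) (u : U) : Z :=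
  xget 0 [set z | Am z = lam *: iZ z /\ G z = u].

(** Values outside the range of [iZ] are irrelevant; [C] is the restriction of
    this map to the domain of [A]. *)
Definition observe (x : X) : U := M ('pinv_(fun=> 0) setT iZ x).

Record boundary_setting : Prop := {
  iZ_injective : injective iZ ;
  iZ_continuous : continuous iZ ;
  iZ_dense : dense (range iZ) ;
  Am_closed : closed (range (fun z : Z => (z, Am z))) ;
  G_surjective : set_surj setT setT G ;
  T_semigroup : c0_semigroup T ;
  T_generator : generator T = A ;
  dirichlet_bounded : forall lam, resolvent_set A lam ->
    continuous (dirichlet lam) ;
  C_bounded : exists c : R, forall z, G z = 0 ->
    rnorm (M z) <= c * (rnorm (iZ z) + rnorm (Am z)) }.

(** [Xm1], with the embedding [j], is the completion of [X] for the norm of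
    [R(beta, A) x], and [Tm1] and [Am1] are the extensions of the semigroup and
    of its generator; they are determined by [A] up to isomorphism. *)
Variables (Xm1 : completeNormedModType K) (j : {linear X -> Xm1}).
Variables (Tm1 : R -> {linear Xm1 -> Xm1}) (Am1 : {linear X -> Xm1}).

Record extrapolation_setting : Prop := {
  j_dense : dense (range j) ;
  j_norm : exists2 beta, resolvent_set A beta &
    forall x, rnorm (j x) = rnorm (resolvent A beta x) ;
  Tm1_semigroup : c0_semigroup Tm1 ;
  Tm1_extends : forall t, 0 <= t -> forall x, Tm1 t (j x) = j (T t x) ;
  Tm1_generator : generator Tm1 = range (fun x => (j x, Am1 x)) ;
  Am1_extends : forall x y, A (x, y) -> Am1 x = j y }.

Variable B : {linear U -> Xm1}.

Definition is_control_operator : Prop :=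
  continuous B /\
  forall lam, resolvent_set A lam -> forall u,
    B u = lam *: j (iZ (dirichlet lam u)) - Am1 (iZ (dirichlet lam u)).

Definition input_map (t : R) (u : R -> U) : Xm1 :=
  bochner 0 t (fun s => Tm1 (t - s) (B (u s))).

Definition control_admissible : Prop :=
  exists2 t0, 0 < t0 & forall u, Lp p t0 u -> range j (input_map t0 u).

Definition observation_estimate (tau gamma : R) : Prop :=
  forall z, G z = 0 ->
    (\int[mu]_(s in `[0%R, tau]) (rnorm (observe (T s (iZ z))) `^ p)%:E
       <= (gamma `^ p * rnorm (iZ z) `^ p)%:E)%E.

Definition observation_admissible : Prop :=
  exists tau gamma, [/\ 0 < tau, 0 < gamma & observation_estimate tau gamma].

Definition observation_constant (tau : R) : \bar R :=
  ereal_inf [set gamma%:E |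
    gamma in [set g | 0 < g /\ observation_estimate tau g]].

Definition zero_class_admissible : Prop :=
  observation_constant tau @[tau --> 0^'+] --> 0%E.

Definition yosida_extension : set (X * U) :=
  [set xy | observe (of_real k lam *: resolvent A (of_real k lam) xy.1)
              @[lam --> +oo] --> xy.2].

Definition io_map (u : R -> U) (t : R) : U :=
  M ('pinv_(fun=> 0) setT (j \o iZ) (input_map t u)).

Definition well_posed : Prop :=
  [/\ control_admissible, observation_admissible &
    exists tau kappa, [/\ 0 < tau, 0 < kappa & forall u : R -> U, W2p0_loc p u ->
      (Lpnorm p tau (io_map u) <= kappa%:E * Lpnorm p tau u)%E]].

(** The extension of [io_map] to a bounded operator on L^p_loc, which is
    unique up to almost-everywhere equality since [W2p0_loc] is dense. *)
Record is_extended_io (F : (R -> U) -> R -> U) : Prop := {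
  io_Lp_loc : forall u, Lp_loc p u -> Lp_loc p (F u) ;
  io_linear : forall (a : K) u v, Lp_loc p u -> Lp_loc p v ->
    {ae mu, forall t, 0 <= t ->
      F (fun s => a *: u s + v s) t = a *: F u t + F v t} ;
  io_bounded : forall tau, 0 < tau -> exists kappa : R,
    forall u, Lp_loc p u -> (Lpnorm p tau (F u) <= kappa%:E * Lpnorm p tau u)%E ;
  io_extends : forall u, W2p0_loc p u ->
    {ae mu, forall t, 0 <= t -> F u t = io_map u t} }.

Variable F : (R -> U) -> R -> U.

Definition regular : Prop :=
  [/\ well_posed, is_extended_io F & forall v : U,
    of_real k t^-1 *: bochner 0 t (F (fun=> v)) @[t --> 0^'+] --> (0 : U)].

(** The restriction of [I - F] to L^p([0, tau]) is bijective with bounded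
    inverse; on [0, tau] the function [F u] only depends on [u] on [0, tau], by
    [io_bounded]. *)
Definition identity_feedback_admissible : Prop :=
  exists2 tau, 0 < tau &
    (forall f : R -> U, Lp_loc p f -> exists2 u : R -> U, Lp_loc p u &
       {ae mu, forall t, 0 <= t <= tau -> u t - F u t = f t}) /\
    (exists c : R, forall u : R -> U, Lp_loc p u ->
       (Lpnorm p tau u <= c%:E * Lpnorm p tau (fun t => u t - F u t)%R)%E).

Definition closed_loop_operator : set (X * X) :=
  [set xy | exists2 y, yosida_extension (xy.1, y) & Am1 xy.1 + B y = j xy.2].

End BoundarySystem.

(* Main.v *)
(** Write [J] for smoothing along [0, +oo[ by the density [n exp (- n s)].  For
    [x] in the domain of [A], the difference of the orbits [Tcl x] and [T x],
    smoothed by [J^3], is the state reached under the control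
    [v = C_Lambda J^3 (Tcl x)], and [v - F v = J^3 (C T x)].  Admissibility of the
    feedback bounds [v], and admissibility of [B] then bounds the state; when [n]
    tends to infinity this gives [|Tcl t x - T t x| <= K |C T x|_{L^p(0, tau)}] for
    small [t].  Since [C] is zero-class admissible, cutting the last integral at a
    small [d] bounds it by [e |x| + D |T d x|] with [e] arbitrarily small, so that
    [Tcl t] is compact because [T t] and [T d] are.  Regularity enters only through
    the identity [C_Lambda z = M z] on [Z]: the response to a smoothed constant
    control is explicit, hence the integrated orbit [c t] of a boundary state [d]
    satisfies [c t = t M d + o(t)], and an Abelian argument passes from [c] to
    the resolvent. *)

(* An orbit of [Tcl] that starts in the domain of [A] need not meet the domain of the closed-loop
   generator, so [C_Lambda] cannot be applied to it directly. One smoothing puts it there, because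
   it turns the orbit into a combination of integrated orbits; two more put the control in
   [W2p0_loc], where [io_map] describes the output. The exponential density is chosen because J f
   solves y' = n (f - y), y(0) = 0: J is causal, commutes with closed operators, and its algebra
   follows from uniqueness for this equation. Smoothing an orbit leaves a defect n (x - J x) due to
   its initial value; the defect is common to both semigroups and cancels in the difference, which
   starts from rest. Two bounds have to be extracted from qualitative facts by uniform boundedness:
   the control constant, as admissibility only asserts an inclusion of ranges, and the relative
   boundedness of [C_Lambda] with respect to the closed-loop generator, by which observation is
   moved through the smoothing. *)
Require Import Defs.
From mathcomp Require Import all_boot all_order all_algebra.
From mathcomp Require Import complex lra ring.
From mathcomp Require Import all_classical all_reals all_analysis.
From mathcomp Require Import measurable_realfun.

Set Implicit Arguments.
Unset Strict Implicit.
Unset Printing Implicit Defensive.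
Import Order.TTheory GRing.Theory Num.Theory.
Import numFieldNormedType.Exports.
Local Open Scope classical_set_scope.
Local Open Scope ring_scope.

(** * Equalities in abelian groups *)

(** Reflected terms of abelian groups: an equality is decided by computing and comparing the integer
    coefficients of its atoms. *)
Inductive zexp := ZVar of nat | ZAdd of zexp & zexp | ZOpp of zexp | ZZero.

Fixpoint zeval (V : zmodType) (env : seq V) (e : zexp) : V :=
  match e with
  | ZVar n => env`_n
  | ZAdd a b => zeval env a + zeval env b
  | ZOpp a => - zeval env a
  | ZZero => 0
  end.

Fixpoint zcoef (e : zexp) (i : nat) : int :=
  match e with
  | ZVar n => if n == i then 1 else 0
  | ZAdd a b => zcoef a i + zcoef b i
  | ZOpp a => - zcoef a i
  | ZZero => 0
  end.

Lemma zevalE (V : zmodType) (env : seq V) e :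
  zeval env e = \sum_(i < size env) env`_i *~ zcoef e i.
Proof.
elim: e => [n|a IHa b IHb|a IHa|] /=.
- have [ns|ns] := ltnP n (size env).
    rewrite (bigD1 (Ordinal ns))//= eqxx mulr1z big1 ?addr0// => i.
    by rewrite -val_eqE /= eq_sym => /negPf ->; rewrite mulr0z.
  rewrite nth_default// big1// => i _; case: eqP => [ni|]; last by rewrite mulr0z.
  by have := ltn_ord i; rewrite -ni ltnNge ns.
- by rewrite IHa IHb -big_split; apply: eq_bigr => i _; rewrite mulrzDr.
- by rewrite IHa -sumrN; apply: eq_bigr => i _; rewrite mulrNz.
- by rewrite big1// => i _; rewrite mulr0z.
Qed.

Lemma zevalP (V : zmodType) (env : seq V) e1 e2 n : size env = n ->
  all (fun i => zcoef e1 i == zcoef e2 i) (iota 0 n) ->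
  zeval env e1 = zeval env e2.
Proof.
move=> <- /allP h; rewrite !zevalE; apply: eq_bigr => i _.
by rewrite (eqP (h i _))// mem_iota /=.
Qed.

(* The two sides of an equality may mention different instances of the same
   operation: atoms are compared up to conversion. *)
Ltac zsame t y :=
  match goal with
  | _ => constr_eq t y
  | _ => lazymatch t with (?a *: ?b)%R =>
           lazymatch y with (?c *: ?d)%R => unify a c; unify b d end end
  | _ => lazymatch t with (_ *: _)%R => fail | _ =>
           lazymatch y with (_ *: _)%R => fail | _ => unify t y end end
  end.

Ltac zenv env t :=
  lazymatch t with
  | (?a + ?b)%R => let env' := zenv env a in zenv env' b
  | (- ?a)%R => zenv env a
  | 0%R => env
  | _ => let rec add l := match l with
           | nil => constr:(t :: nil)
           | ?y :: _ => let _ := match goal with _ => zsame t y end in l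
           | ?y :: ?r => let r' := add r in constr:(y :: r')
           end in add env
  end.

Ltac zreify env t :=
  lazymatch t with
  | (?a + ?b)%R => let a' := zreify env a in let b' := zreify env b in constr:(ZAdd a' b')
  | (- ?a)%R => let a' := zreify env a in constr:(ZOpp a')
  | 0%R => constr:(ZZero)
  | _ => let rec look l := match l with
           | ?y :: _ => let _ := match goal with _ => zsame t y end in constr:(0%N)
           | _ :: ?r => let n := look r in constr:(S n)
           end in let n := look env in constr:(ZVar n)
  end.

(* Decides an equality in a module, the scaled vectors being atoms once the
   scalings have been distributed. *)
Ltac zmod :=
  rewrite ?(scalerDr, scalerBr, scalerDl, scalerBl, scalerN, scaleNr, scalerA, scale0r, scaler0, scale1r);
  lazymatch goal with
  | |- @eq ?T ?a ?b =>
      let env := zenv (@nil T) a in let env := zenv env b in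
      let a' := zreify env a in let b' := zreify env b in
      let n := eval cbv [size] in (size env) in
      apply: (@zevalP _ env a' b' n (erefl n)); vm_compute; reflexivity
  end.

(** * Real-valued norms *)

Section RealNorm.
Context (k : scalar_kind) (R : realType).
Local Notation K := (scalars k R).
Implicit Types V W : completeNormedModType K.
Local Notation r2K := (@of_real k R).
Local Notation N := rnorm.

Lemma of_realD (a b : R) : r2K (a + b) = r2K a + r2K b.
Proof. by case: k => //=; rewrite /GRing.add /= addr0. Qed.

Lemma of_realN (a : R) : r2K (- a) = - r2K a.
Proof. by case: k => //=; rewrite /GRing.opp /= oppr0. Qed.

Lemma of_realB (a b : R) : r2K (a - b) = r2K a - r2K b.
Proof. by rewrite of_realD of_realN. Qed.

Lemma of_realM (a b : R) : r2K (a * b) = r2K a * r2K b.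
Proof. by case: k => //=; exact: (rmorphM (real_complex R)). Qed.

Lemma of_real0 : r2K 0 = 0.
Proof. by case: k. Qed.

Lemma of_real1 : r2K 1 = 1.
Proof. by case: k. Qed.

Lemma ler_of_real (a b : R) : (r2K a <= r2K b) = (a <= b).
Proof. by case: k => //=; exact: lecR. Qed.

Lemma ltr_of_real (a b : R) : (r2K a < r2K b) = (a < b).
Proof. by case: k => //=; exact: ltcR. Qed.

Lemma real_part_of_real (a : R) : real_part (r2K a) = a.
Proof. by case: k. Qed.

Lemma of_real_part (x : K) : 0 <= x -> r2K (real_part x) = x.
Proof.
case: k x => //= x; case: x => a b /=.
by rewrite lecE /= => /andP[/eqP -> _].
Qed.

Lemma normr_of_real (a : R) : `|r2K a| = r2K `|a|.
Proof.
have [a0|a0] := leP 0 a.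
  by rewrite !ger0_norm// -of_real0 ler_of_real.
by rewrite !ltr0_norm ?of_realN// -of_real0 ltr_of_real.
Qed.

Definition absK (c : K) : R := real_part `|c|.

Lemma normr_absK (c : K) : `|c| = r2K (absK c).
Proof. by rewrite of_real_part. Qed.

Lemma absK_ge0 c : 0 <= absK c.
Proof. by rewrite -(ler_of_real) -normr_absK of_real0. Qed.

Lemma absK_of_real (a : R) : absK (r2K a) = `|a|.
Proof. by rewrite /absK normr_of_real real_part_of_real. Qed.

Lemma normr_rnorm V (x : V) : `|x| = r2K (N x).
Proof. by rewrite of_real_part. Qed.

Lemma rnorm_ge0 V (x : V) : 0 <= N x.
Proof. by rewrite -ler_of_real -normr_rnorm of_real0. Qed.
Hint Extern 0 (is_true (0 <= rnorm _)) => exact: rnorm_ge0 : core.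

Lemma rnorm0 V : N (0 : V) = 0.
Proof. by rewrite /rnorm normr0 -of_real0 real_part_of_real. Qed.

Lemma rnorm0_eq0 V (x : V) : N x = 0 -> x = 0.
Proof. by move=> x0; apply/eqP; rewrite -normr_eq0 normr_rnorm x0 of_real0. Qed.

Lemma rnormN V (x : V) : N (- x) = N x.
Proof. by rewrite /rnorm normrN. Qed.

Lemma rnormD V (x y : V) : N (x + y) <= N x + N y.
Proof. by rewrite -ler_of_real of_realD -!normr_rnorm ler_normD. Qed.

Lemma rnormB V (x y : V) : N (x - y) <= N x + N y.
Proof. by rewrite -(rnormN y) rnormD. Qed.

Lemma rdistC V (x y : V) : N (x - y) = N (y - x).
Proof. by rewrite -rnormN opprB. Qed.

Lemma rdistD V (y x z : V) : N (x - z) <= N (x - y) + N (y - z).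
Proof. by rewrite (le_trans _ (rnormD _ _))// addrA subrK. Qed.

Lemma rnorm_split V (y x : V) : N x <= N (x - y) + N y.
Proof. by rewrite (le_trans _ (rnormD _ _))// subrK. Qed.

Lemma rnormZ V (c : K) (x : V) : N (c *: x) = absK c * N x.
Proof.
by rewrite /rnorm normrZ normr_absK normr_rnorm -of_realM !real_part_of_real.
Qed.

Lemma rnormZr V (a : R) (x : V) : N (r2K a *: x) = `|a| * N x.
Proof. by rewrite rnormZ absK_of_real. Qed.

Lemma rnorm_sum V (I : Type) (s : seq I) (P : pred I) (f : I -> V) :
  N (\sum_(i <- s | P i) f i) <= \sum_(i <- s | P i) N (f i).
Proof.
elim/big_ind2 : _ => [|x a y b xa yb|//]; first by rewrite rnorm0.
by rewrite (le_trans (rnormD _ _))// lerD.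
Qed.

Lemma le_epsilon (a b : R) : (forall e : R, 0 < e -> a <= b + e) -> a <= b.
Proof. by move=> h; apply/ler_addgt0Pr. Qed.

Lemma rnorm_small V (x : V) : (forall e : R, 0 < e -> N x <= e) -> x = 0.
Proof.
move=> h; apply: rnorm0_eq0; apply/eqP; rewrite eq_le rnorm_ge0 andbT.
by apply: le_epsilon => e e0; rewrite add0r h.
Qed.

Lemma cvg_rnormP (T : Type) (F : set_system T) (FF : Filter F) V (f : T -> V) (l : V) :
  (f @ F --> l) <-> (forall e : R, 0 < e -> \forall t \near F, N (f t - l) < e).
Proof.
split=> [/cvgrPdist_lt h e e0|h].
  have := h (r2K e); rewrite -of_real0 ltr_of_real => /(_ e0).
  by apply: filterS => t; rewrite normr_rnorm ltr_of_real rdistC.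
apply/cvgrPdist_lt => e e0.
have eE : r2K (real_part e) = e by rewrite of_real_part// ltW.
have := h (real_part e); rewrite -ltr_of_real eE of_real0 => /(_ e0).
by apply: filterS => t; rewrite -ltr_of_real eE -normr_rnorm distrC.
Qed.

Lemma cvgn_rnormP V (f : nat -> V) (l : V) :
  (f @ \oo --> l) <->
  (forall e : R, 0 < e -> exists n0, forall n, (n0 <= n)%N -> N (f n - l) < e).
Proof.
rewrite cvg_rnormP; split=> h e /h; first by case=> n0 _ hn; exists n0.
by case=> n0 hn; exists n0.
Qed.

Lemma cvg_at_right0_rnormP V (f : R -> V) (l : V) :
  (f h @[h --> 0^'+] --> l) <->
  (forall e : R, 0 < e -> exists2 d, 0 < d & forall h, 0 < h < d -> N (f h - l) < e).
Proof.
rewrite cvg_rnormP; split=> h e /h.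
  case=> d /= d0 hd; exists d => // t /andP[t0 td]; apply: hd => //=.
  by rewrite sub0r normrN gtr0_norm.
case=> d d0 hd; exists d => //= t /=.
by rewrite sub0r normrN => td t0; apply: hd; rewrite t0 (le_lt_trans (ler_norm _)).
Qed.

Lemma cvg_pinfty_rnormP V (f : R -> V) (l : V) :
  (f h @[h --> +oo] --> l) <->
  (forall e : R, 0 < e -> exists L, forall h, L < h -> N (f h - l) < e).
Proof.
rewrite cvg_rnormP; split=> h e /h; first by case=> L [_ hL]; exists L.
by case=> L hL; exists L; split => //; exact: num_real.
Qed.

Lemma cvg_rnorm_unique V (f : nat -> V) (l l' : V) :
  f @ \oo --> l -> f @ \oo --> l' -> l = l'.
Proof. by move=> h h'; exact: (cvg_unique _ h h'). Qed.

Lemma rnorm_cauchy_cvg V (f : nat -> V) :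
  (forall e : R, 0 < e -> exists n0, forall n m, (n0 <= n)%N -> (n0 <= m)%N ->
     N (f n - f m) < e) -> exists l : V, f @ \oo --> l.
Proof.
move=> h; suff : cvg (f @ \oo) by move=> ?; exists (lim (f @ \oo)).
apply/cauchy_cvgP; apply/cauchy_ballP => e e0.
have eE : r2K (real_part e) = e by rewrite of_real_part// ltW.
have := h (real_part e); rewrite -ltr_of_real eE of_real0 => /(_ e0)[n0 hn].
rewrite near_simpl; exists ([set n | (n0 <= n)%N], [set n | (n0 <= n)%N]) => /=.
  by split; exists n0.
case=> n m [/= nn nm]; rewrite -ball_normE /ball_/=.
by rewrite normr_rnorm -eE ltr_of_real hn.
Qed.

Lemma continuous_boundedP V W (L : V -> W) : (forall x y, L (x - y) = L x - L y) ->
  (forall a x, L (r2K a *: x) = r2K a *: L x) ->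
  continuous L <-> exists2 c : R, 0 <= c & forall x, N (L x) <= c * N x.
Proof.
move=> LB LZ; have L0 : L 0 = 0 by rewrite -(subrr 0) LB subrr.
split=> [cL|[c c0 hc] x].
  have /cvg_rnormP/(_ 1 ltr01) := cL 0.
  move=> /nbhs_ballP[d /= d0 hd].
  have dE : r2K (real_part d) = d by rewrite of_real_part// ltW.
  set d' := real_part d in dE.
  have d'0 : 0 < d' by rewrite -ltr_of_real dE of_real0.
  exists (2 / d'); first by rewrite divr_ge0// ltW.
  move=> x; have [x0|x0] := eqVneq (N x) 0.
    by rewrite (rnorm0_eq0 x0) L0 !rnorm0 mulr0.
  have Nx : 0 < N x by rewrite lt_neqAle eq_sym x0 rnorm_ge0.
  set a := d' / (2 * N x).
  have a0 : 0 < a by rewrite divr_gt0// mulr_gt0.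
  have := hd (r2K a *: x); rewrite -ball_normE /ball_/= sub0r normrN normr_rnorm.
  rewrite rnormZr gtr0_norm// -dE ltr_of_real.
  have -> : a * N x = d' / 2 by rewrite /a; field.
  rewrite ltr_pdivrMr// ltr_pMr// ltr1n => /(_ isT).
  rewrite L0 subr0 LZ rnormZr gtr0_norm// => /ltW.
  rewrite -ler_pdivlMl// mulr1 => /le_trans; apply.
  by rewrite /a invf_div mulrAC.
apply/cvg_rnormP => e e0.
have c1 : 0 < c + 1 by rewrite ltr_wpDl.
apply/nbhs_ballP; exists (r2K (e / (c + 1))) => /=.
  by rewrite -of_real0 ltr_of_real divr_gt0.
move=> y; rewrite -ball_normE /ball_/= normr_rnorm ltr_of_real => h.
rewrite -LB (le_lt_trans (hc _))// rdistC.
rewrite (@le_lt_trans _ _ ((c + 1) * N (x - y)))//.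
  by rewrite ler_wpM2r// lerDl.
by rewrite -ltr_pdivlMl// mulrC.
Qed.

Lemma continuous_linearP V W (L : {linear V -> W}) :
  continuous L <-> exists2 c : R, 0 <= c & forall x, N (L x) <= c * N x.
Proof. by apply: continuous_boundedP => [x y|a x]; rewrite ?linearB ?linearZ. Qed.

End RealNorm.
#[export] Hint Extern 0 (is_true (0 <= rnorm _)) => exact: rnorm_ge0 : core.

(** * Calculus on intervals *)

Section Calculus.
Context (R : realType).
Implicit Types (a b s t : R) (D : set R).

(** Continuous induction: the supremum of the points reachable from [a] is itself reachable and
    cannot lie below [b]. This is the compactness argument behind bounds, uniform continuity,
    Riemann sums and the mean value inequality. *)
Lemma local_to_global a b (Q : R -> R -> Prop) : a <= b ->
  (forall r s t, a <= r <= s -> s <= t <= b -> Q r s -> Q s t -> Q r t) ->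
  (forall t, a <= t <= b -> exists2 d : R, 0 < d & forall s, a <= s <= b ->
     (t - d < s <= t -> Q s t) /\ (t <= s < t + d -> Q t s)) ->
  Q a b.
Proof.
move=> ab Qtr Qloc; pose S := [set t | a <= t <= b /\ Q a t].
have Sa : S a.
  split; rewrite ?lexx ?ab//; have [|d d0 /(_ a)] := Qloc a; rewrite ?lexx ?ab//.
  by move=> /(_ isT)[_]; apply; rewrite ltrDl.
have Sb t : S t -> t <= b by case=> /andP[].
have hS : has_sup S by split; [exists a|exists b].
have [c0 cb] : a <= sup S /\ sup S <= b.
  by split; [apply: ub_le_sup => //; case: hS|apply: ge_sup => //; exists a].
have [|d d0 hd] := Qloc (sup S); first by rewrite c0 cb.
have Qc : Q a (sup S).
  have [s Ss sc] := sup_adherent d0 hS.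
  have sS : s <= sup S by apply: ub_le_sup => //; case: hS.
  have [/andP[as_ sb] Qas] := Ss.
  apply: (Qtr a s) => //; rewrite ?lexx ?as_ ?sS//.
  by apply: (hd s _).1; rewrite ?as_ ?sb ?sc.
suff <- : sup S = b by [].
apply/eqP; rewrite eq_le cb /= leNgt; apply/negP => cltb.
pose s := Num.min b (sup S + d / 2).
have ss : sup S < s by rewrite lt_min cltb ltrDl divr_gt0.
suff : S s by move/(ub_le_sup hS.2); rewrite leNgt ss.
have as_ : a <= s by rewrite (le_trans c0)// ltW.
have sb : s <= b by rewrite ge_min lexx.
split; first by rewrite as_ sb.
apply: (Qtr a (sup S)) => //; rewrite ?c0 ?lexx ?(ltW ss)//.
apply: (hd s _).2; first by rewrite as_ sb.
rewrite (ltW ss)/= gt_min; apply/orP; right.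
by rewrite ltrD2l ltr_pdivrMr// ltr_pMr// ltr1n.
Qed.

(** Derivatives are relative to a set [D], hence one-sided at endpoints, and increments are compared
    without dividing by [s - t]. *)
Definition rder D (g g' : R -> R) := forall t, D t -> forall e : R, 0 < e ->
  exists2 d : R, 0 < d & forall s, D s -> `|s - t| < d ->
    `|g s - g t - (s - t) * g' t| <= e * `|s - t|.

Definition half : set R := [set t | 0 <= t].
Definition seg a b : set R := [set t | a <= t <= b].

Context (k : scalar_kind).
Local Notation K := (scalars k R).
Local Notation r2K := (@of_real k R).
Local Notation N := rnorm.
Implicit Types V W : completeNormedModType K.

Definition cnt_at D V (f : R -> V) t := forall e : R, 0 < e ->
  exists2 d : R, 0 < d & forall s, D s -> `|s - t| < d -> N (f s - f t) <= e.

Definition cnt D V (f : R -> V) := forall t, D t -> cnt_at D f t.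

Definition der_at D V (f : R -> V) t (v : V) := forall e : R, 0 < e ->
  exists2 d : R, 0 < d & forall s, D s -> `|s - t| < d ->
    N (f s - f t - r2K (s - t) *: v) <= e * `|s - t|.

Definition der D V (f f' : R -> V) := forall t, D t -> der_at D f t (f' t).

Lemma der_cnt D V (f f' : R -> V) : der D f f' -> cnt D f.
Proof.
move=> h t Dt e e0; have [d d0 hd] := h t Dt 1 ltr01.
have c1 : 0 < 1 + N (f' t) by rewrite ltr_pwDl.
exists (Num.min d (e / (1 + N (f' t)))); first by rewrite lt_min d0 divr_gt0.
move=> s Ds; rewrite lt_min => /andP[sd se].
rewrite (le_trans (rnorm_split (r2K (s - t) *: f' t) _))//.
apply: (le_trans (lerD (hd s Ds sd) (lexx _))).
rewrite rnormZr mul1r -{1}[`|s - t|]mulr1 -mulrDr.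
by rewrite ltW// -ltr_pdivlMr.
Qed.

Lemma cnt_sub D D' V (f : R -> V) : D' `<=` D -> cnt D f -> cnt D' f.
Proof.
move=> DD h t /DD Dt e /(h _ Dt)[d d0 hd]; exists d => // s /DD; exact: hd.
Qed.

Lemma der_sub D D' V (f f' : R -> V) : D' `<=` D -> der D f f' -> der D' f f'.
Proof.
move=> DD h t /DD Dt e /(h _ Dt)[d d0 hd]; exists d => // s /DD; exact: hd.
Qed.

Lemma cnt_ext D V (f g : R -> V) : (forall t, D t -> f t = g t) ->
  cnt D f -> cnt D g.
Proof.
move=> fg h t Dt e /(h _ Dt)[d d0 hd]; exists d => // s Ds.
by rewrite -!fg//; exact: hd.
Qed.

Lemma der_ext D V (f f' g g' : R -> V) : (forall t, D t -> f t = g t) ->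
  (forall t, D t -> f' t = g' t) -> der D f f' -> der D g g'.
Proof.
move=> fg fg' h t Dt e /(h _ Dt)[d d0 hd]; exists d => // s Ds.
by rewrite -!fg// -fg'//; exact: hd.
Qed.

Lemma cnt_cst D V (x : V) : cnt D (fun=> x).
Proof. by move=> t Dt e e0; exists 1 => // s _ _; rewrite subrr rnorm0 ltW. Qed.

Lemma der_cst D V (x : V) : der D (fun=> x) (fun=> 0).
Proof.
move=> t Dt e e0; exists 1 => // s _ _.
by rewrite subrr scaler0 subr0 rnorm0 mulr_ge0// ltW.
Qed.

Lemma cntD D V (f g : R -> V) : cnt D f -> cnt D g -> cnt D (fun t => f t + g t).
Proof.
move=> hf hg t Dt e e0; have e20 : 0 < e / 2 by rewrite divr_gt0.
have [d d0 hd] := hf t Dt _ e20; have [d' d'0 hd'] := hg t Dt _ e20.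
exists (Num.min d d'); first by rewrite lt_min d0.
move=> s Ds; rewrite lt_min => /andP[sd sd'].
rewrite opprD addrACA (splitr e) (le_trans (rnormD _ _))// lerD//.
  exact: hd.
exact: hd'.
Qed.

Lemma derD D V (f f' g g' : R -> V) : der D f f' -> der D g g' ->
  der D (fun t => f t + g t) (fun t => f' t + g' t).
Proof.
move=> hf hg t Dt e e0; have e20 : 0 < e / 2 by rewrite divr_gt0.
have [d d0 hd] := hf t Dt _ e20; have [d' d'0 hd'] := hg t Dt _ e20.
exists (Num.min d d'); first by rewrite lt_min d0.
move=> s Ds; rewrite lt_min => /andP[sd sd'].
have -> : f s + g s - (f t + g t) - r2K (s - t) *: (f' t + g' t) =
  (f s - f t - r2K (s - t) *: f' t) + (g s - g t - r2K (s - t) *: g' t) by zmod.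
rewrite (splitr e) mulrDl (le_trans (rnormD _ _))// lerD//.
  exact: hd.
exact: hd'.
Qed.

Section Linear.
Variables (V W : completeNormedModType K) (L : V -> W) (c : R).
Hypotheses (LB : {morph L : x y / x - y}) (LZ : forall a x, L (r2K a *: x) = r2K a *: L x).
Hypothesis (Lc : forall x, N (L x) <= c * N x).

Lemma cnt_lin D (f : R -> V) : cnt D f -> cnt D (L \o f).
Proof.
move=> hf t Dt e e0.
have c1 : 0 < 1 + `|c| by rewrite ltr_pwDl.
have [|d d0 hd] := hf t Dt (e / (1 + `|c|)); first by rewrite divr_gt0.
exists d => // s Ds sd /=; rewrite -LB (le_trans (Lc _))//.
rewrite (@le_trans _ _ ((1 + `|c|) * N (f s - f t)))//.
  by rewrite ler_wpM2r// (le_trans (ler_norm _))// lerDr.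
by rewrite mulrC -ler_pdivlMr//; exact: hd.
Qed.

Lemma der_lin D (f f' : R -> V) : der D f f' -> der D (L \o f) (L \o f').
Proof.
move=> hf t Dt e e0.
have c1 : 0 < 1 + `|c| by rewrite ltr_pwDl.
have [|d d0 hd] := hf t Dt (e / (1 + `|c|)); first by rewrite divr_gt0.
exists d => // s Ds sd /=; rewrite -LZ -!LB (le_trans (Lc _))//.
rewrite (@le_trans _ _ ((1 + `|c|) * N (f s - f t - r2K (s - t) *: f' t)))//.
  by rewrite ler_wpM2r// (le_trans (ler_norm _))// lerDr.
rewrite mulrC -ler_pdivlMr// mulrAC; exact: hd.
Qed.
End Linear.

Lemma cntZ D V (c : K) (f : R -> V) : cnt D f -> cnt D (fun t => c *: f t).
Proof.
move=> h; have := @cnt_lin V V (fun x => c *: x) (absK c) _ _ D f h.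
by apply=> [x y|x]; rewrite ?scalerBr ?rnormZ.
Qed.

Lemma derZ D V (c : K) (f f' : R -> V) : der D f f' ->
  der D (fun t => c *: f t) (fun t => c *: f' t).
Proof.
move=> h; have := @der_lin V V (fun x => c *: x) (absK c) _ _ _ D f f' h.
by apply=> [x y|a x|x]; rewrite ?scalerBr ?rnormZ// !scalerA mulrC.
Qed.

Lemma cntN D V (f : R -> V) : cnt D f -> cnt D (fun t => - f t).
Proof.
by move=> /(cntZ (-1)); apply: cnt_ext => t _; rewrite scaleN1r.
Qed.

Lemma derN D V (f f' : R -> V) : der D f f' -> der D (fun t => - f t) (fun t => - f' t).
Proof.
by move=> /(derZ (-1)); apply: der_ext => t _; rewrite scaleN1r.
Qed.

Lemma cntB D V (f g : R -> V) : cnt D f -> cnt D g -> cnt D (fun t => f t - g t).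
Proof. by move=> hf /cntN; exact: cntD. Qed.

Lemma derB D V (f f' g g' : R -> V) : der D f f' -> der D g g' ->
  der D (fun t => f t - g t) (fun t => f' t - g' t).
Proof. by move=> hf /derN; exact: derD. Qed.

Section Operator.
Variables (V W : completeNormedModType K) (L : R -> V -> W) (c : R) (D : set R).
Hypotheses (LB : forall s, D s -> {morph L s : x y / x - y})
  (LZ : forall s a x, D s -> L s (r2K a *: x) = r2K a *: L s x).
Hypothesis (Lc : forall s x, D s -> N (L s x) <= c * N x).

Lemma cnt_op (f : R -> V) : (forall t, D t -> cnt_at D (L^~ (f t)) t) ->
  cnt D f -> cnt D (fun t => L t (f t)).
Proof.
move=> hL hf t Dt e e0; have e20 : 0 < e / 2 by rewrite divr_gt0.
have c1 : 0 < 1 + `|c| by rewrite ltr_pwDl.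
have [|d d0 hd] := hf t Dt (e / 2 / (1 + `|c|)); first by rewrite divr_gt0.
have [d' d'0 hd'] := hL t Dt _ e20.
exists (Num.min d d'); first by rewrite lt_min d0.
move=> s Ds; rewrite lt_min => /andP[sd sd'].
rewrite (le_trans (rdistD (L s (f t)) _ _))// (splitr e) lerD//; last exact: hd'.
rewrite -LB// (le_trans (Lc _ Ds))//.
rewrite (@le_trans _ _ ((1 + `|c|) * N (f s - f t)))//.
  by rewrite ler_wpM2r// (le_trans (ler_norm _))// lerDr.
by rewrite mulrC -ler_pdivlMr//; exact: hd.
Qed.

(** Product rule for a strongly differentiable family, with no continuity in operator norm: the
    remainder of [f] is carried by the uniform bound [c], and [L s - L t] is applied only to the
    fixed vectors [f t] and [f' t]. *)
Lemma der_op (f f' : R -> V) (Lf' : R -> W) : (forall x t, D t -> cnt_at D (L^~ x) t) ->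
  (forall t, D t -> der_at D (L^~ (f t)) t (Lf' t)) ->
  der D f f' -> der D (fun t => L t (f t)) (fun t => Lf' t + L t (f' t)).
Proof.
move=> hL hL' hf t Dt e e0; have e30 : 0 < e / 3 by rewrite divr_gt0.
have c1 : 0 < 1 + `|c| by rewrite ltr_pwDl.
have [|d d0 hd] := hf t Dt (e / 3 / (1 + `|c|)); first by rewrite divr_gt0.
have [d' d'0 hd'] := hL (f' t) t Dt _ e30.
have [d2 d20 hd2] := hL' t Dt _ e30.
exists (Num.min d (Num.min d' d2)); first by rewrite !lt_min d0 d'0.
move=> s Ds; rewrite !lt_min => /and3P[sd sd' sd2].
have -> : L s (f s) - L t (f t) - r2K (s - t) *: (Lf' t + L t (f' t)) =
  L s (f s - f t - r2K (s - t) *: f' t) + r2K (s - t) *: (L s (f' t) - L t (f' t))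
  + (L s (f t) - L t (f t) - r2K (s - t) *: Lf' t).
  rewrite 2?LB// LZ//; zmod.
have eE : e * `|s - t| = e / 3 * `|s - t| + `|s - t| * (e / 3) + e / 3 * `|s - t|.
  by field.
rewrite eE (le_trans (rnormD _ _))// lerD//; last exact: hd2.
rewrite (le_trans (rnormD _ _))// lerD//; last first.
  by rewrite rnormZr ler_wpM2l//; exact: hd'.
rewrite (le_trans (Lc _ Ds))//.
rewrite (@le_trans _ _ ((1 + `|c|) * N (f s - f t - r2K (s - t) *: f' t)))//.
  by rewrite ler_wpM2r// (le_trans (ler_norm _))// lerDr.
by rewrite mulrC -ler_pdivlMr// mulrAC; exact: hd.
Qed.
End Operator.

(** With a slack proportional to the length, the inequality is additive over adjacent intervals and
    holds near each point by differentiability, so [local_to_global] applies without integrating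
    [f']. *)
Lemma mean_value V (f f' : R -> V) (g g' : R -> R) a b : a <= b ->
  der (seg a b) f f' -> rder (seg a b) g g' ->
  (forall t, a <= t <= b -> N (f' t) <= g' t) -> N (f b - f a) <= g b - g a.
Proof.
move=> ab df dg fg; apply: le_epsilon => e0 e00.
have e1 : 0 < 1 + (b - a) by rewrite ltr_pwDl// subr_ge0.
(* The slack over the whole interval is then at most [e0]; the summand 1 covers [a = b]. *)
pose e := e0 / (1 + (b - a)); have e_gt0 : 0 < e by rewrite divr_gt0.
suff h : N (f b - f a) <= g b - g a + e * (b - a).
  apply: (le_trans h); rewrite lerD2l /e mulrAC ler_pdivrMr// ler_wpM2l ?(ltW e00)//.
  by rewrite lerDr.
apply: (@local_to_global a b (fun s t => N (f t - f s) <= g t - g s + e * (t - s))) => //.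
  move=> r s t _ _ h1 h2; rewrite (le_trans (rdistD (f s) _ _))//.
  have := lerD h1 h2; rewrite addrC => /le_trans; apply.
  by rewrite le_eqVlt; apply/orP; left; apply/eqP; ring.
move=> t tab; have e20 : 0 < e / 2 by rewrite divr_gt0.
have [d d0 hd] := df t tab _ e20; have [d' d'0 hd'] := dg t tab _ e20.
exists (Num.min d d'); first by rewrite lt_min d0.
move=> s sab.
have key : `|s - t| < Num.min d d' ->
    N (f s - f t) <= `|s - t| * g' t + e / 2 * `|s - t| /\
    `|g s - g t - (s - t) * g' t| <= e / 2 * `|s - t|.
  rewrite lt_min => /andP[sd sd']; split; last exact: hd'.
  have := hd s sab sd; have := fg t tab => h1 h2.
  rewrite (le_trans (rnorm_split (r2K (s - t) *: f' t) _))// addrC lerD//.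
  by rewrite rnormZr ler_wpM2l.
split=> /andP[st1 st2].
  have [] := key; first by rewrite ler0_norm ?subr_le0// opprB ltrBlDr -ltrBlDl.
  rewrite ler0_norm ?subr_le0// opprB rdistC ler_norml => h1 /andP[h2 h3].
  apply: (le_trans h1); lra.
have [] := key; first by rewrite ger0_norm ?subr_ge0// ltrBlDl.
rewrite ger0_norm ?subr_ge0// ler_norml => h1 /andP[h2 h3].
apply: (le_trans h1); lra.
Qed.

End Calculus.
Arguments half {R}.

(** * Riemann sums and primitives of continuous functions *)

Section Primitive.
Context (R : realType) (k : scalar_kind).
Local Notation K := (scalars k R).
Local Notation r2K := (@of_real k R).
Local Notation N := rnorm.
Implicit Types V W : completeNormedModType K.

Lemma seg_half (a b : R) : 0 <= a -> seg a b `<=` half.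
Proof. by move=> a0 t /andP[at_ _]; exact: le_trans at_. Qed.

Lemma rder_lin (D : set R) (c : R) : rder D (fun t => c * t) (fun=> c).
Proof.
move=> t Dt e e0; exists 1 => // s _ _.
have -> : c * s - c * t - (s - t) * c = 0 by ring.
by rewrite normr0 mulr_ge0// ltW.
Qed.

Lemma lip_of_der V (f f' : R -> V) (C a b : R) : a <= b -> der (seg a b) f f' ->
  (forall t, a <= t <= b -> N (f' t) <= C) -> N (f b - f a) <= C * (b - a).
Proof.
move=> ab df h; have := mean_value ab df (@rder_lin _ C) h.
by rewrite mulrBr.
Qed.

Lemma der0_cst V (f : R -> V) (a b : R) : a <= b -> der (seg a b) f (fun=> 0) -> f b = f a.
Proof.
move=> ab df; have := @lip_of_der _ _ _ 0 _ _ ab df.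
rewrite rnorm0 mul0r => h; apply/eqP; rewrite -subr_eq0; apply/eqP/rnorm0_eq0.
by apply/eqP; rewrite eq_le rnorm_ge0 andbT h.
Qed.

Lemma cnt_bounded V (f : R -> V) (a b : R) : a <= b -> cnt (seg a b) f ->
  exists2 C : R, 0 <= C & forall t, a <= t <= b -> N (f t) <= C.
Proof.
move=> ab cf.
suff [C hC] : exists C : R, forall t, a <= t <= b -> N (f t) <= C.
  by exists C => //; rewrite (le_trans _ (hC a _))// lexx ab.
apply: (@local_to_global _ a b
  (fun s t => exists C : R, forall u, s <= u <= t -> N (f u) <= C)) => //.
  move=> r s t _ _ [C hC] [C' hC']; exists (Num.max C C') => u /andP[ru ut].
  rewrite le_max; have [us|su] := leP u s; first by rewrite hC// ru us.
  by rewrite hC' ?orbT// ut ltW.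
move=> t tab; have [d d0 hd] := cf t tab 1 ltr01; exists d => // s sab.
have key u : a <= u <= b -> `|u - t| < d -> N (f u) <= 1 + N (f t).
  by move=> uab ud; rewrite (le_trans (rnorm_split (f t) _))// lerD2r; exact: hd.
by split=> /andP[h1 h2]; exists (1 + N (f t)) => u /andP[h3 h4]; apply: key;
   rewrite ?ltr_norml; lra.
Qed.

Lemma cnt_unif V (f : R -> V) (a b : R) : a <= b -> cnt (seg a b) f ->
  forall e : R, 0 < e -> exists2 d : R, 0 < d & forall s t, a <= s <= b -> a <= t <= b ->
    `|s - t| < d -> N (f s - f t) <= e.
Proof.
move=> ab cf e e0.
(* Only [u] is confined to the subinterval, while [v] ranges over all of [[a, b]]; this is what lets
   the property pass to the union of adjacent intervals. *)
apply: (@local_to_global _ a b (fun s t => exists2 d : R, 0 < d &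
  forall u v, s <= u <= t -> a <= v <= b -> `|u - v| < d -> N (f u - f v) <= e)) => //.
  move=> r s t _ _ [d d0 hd] [d' d'0 hd']; exists (Num.min d d'); first by rewrite lt_min d0.
  move=> u v /andP[ru ut] vab; rewrite lt_min => /andP[ud ud'].
  have [us|su] := leP u s; first by apply: hd => //; rewrite ru us.
  by apply: hd' => //; rewrite ut ltW.
move=> t tab; have e20 : 0 < e / 2 by rewrite divr_gt0.
have [d d0 hd] := cf t tab _ e20; have d20 : 0 < d / 2 by rewrite divr_gt0.
exists (d / 2) => // s sab.
have key u v : a <= u <= b -> a <= v <= b -> `|u - t| < d / 2 -> `|u - v| < d / 2 ->
    N (f u - f v) <= e.
  move=> uab vab ut uv; rewrite (le_trans (rdistD (f t) _ _))// (splitr e) lerD//.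
    by apply: hd => //; move: ut; rewrite !ltr_norml; lra.
  by rewrite rdistC; apply: hd => //; move: ut uv; rewrite !ltr_norml; lra.
by split=> /andP[h1 h2]; exists (d / 2) => // u v /andP[h3 h4] vab uv; apply: key => //;
   rewrite ?ltr_norml; lra.
Qed.

Definition mesh n : R := n.+1%:R^-1.

Lemma mesh_gt0 n : 0 < mesh n.
Proof. by rewrite invr_gt0. Qed.

Lemma mesh_small (e : R) : 0 < e -> exists n0, forall n, (n0 <= n)%N -> mesh n < e.
Proof.
move=> e0; exists (Num.truncn e^-1) => n hn.
rewrite /mesh invf_plt ?posrE//.
by rewrite (lt_le_trans (truncnS_gt _))// ler_nat.
Qed.

(** The length of the part of the [i]-th grid cell lying left of [t >= 0]. There are [n.+1 ^ 2]
    cells of length [mesh n], so the grid covers [[0, n.+1]] and one sequence of sums serves the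
    whole half-line. *)
Definition cell n i (t : R) : R :=
  Num.min t (i.+1%:R * mesh n) - Num.min t (i%:R * mesh n).

Definition riemann V (f : R -> V) n (t : R) : V :=
  \sum_(i < n.+1 ^ 2) r2K (cell n i t) *: f (i%:R * mesh n).

Lemma cell_ge0 n i (s t : R) : s <= t -> 0 <= cell n i t - cell n i s.
Proof.
move=> st; rewrite /cell -natr1 mulrDl mul1r.
have := mesh_gt0 n; set x := i%:R * _; set d := mesh n => d0.
by rewrite /Num.min /Order.min; do 4 case: ifP; lra.
Qed.

Lemma cell_out n i (s t : R) : s <= t ->
  (t <= i%:R * mesh n) || (i.+1%:R * mesh n <= s) -> cell n i t - cell n i s = 0.
Proof.
move=> st; rewrite /cell -natr1 mulrDl mul1r.
have := mesh_gt0 n; set x := i%:R * _; set d := mesh n => d0.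
by move=> /orP[] h; rewrite /Num.min /Order.min; do 4 case: ifP; lra.
Qed.

Lemma cell_sum n (t : R) : 0 <= t <= n.+1%:R ->
  \sum_(i < n.+1 ^ 2) cell n i t = t.
Proof.
move=> /andP[t0 tn]; rewrite -(big_mkord xpredT (fun i => cell n i t)).
rewrite telescope_sumr// mul0r (min_r t0) subr0; apply/min_l.
by rewrite natrX /mesh expr2 mulfK.
Qed.

Lemma riemann0 V (f : R -> V) n : riemann f n 0 = 0.
Proof.
rewrite /riemann big1// => i _.
rewrite /cell !min_l ?mulr_ge0// ?invr_ge0//.
by rewrite subrr of_real0 scale0r.
Qed.

Lemma riemann_diff V (f : R -> V) n (s t e : R) : 0 <= s -> s <= t -> t <= n.+1%:R ->
  (forall r, 0 <= r -> s - mesh n <= r <= t -> N (f r - f s) <= e) ->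
  N (riemann f n t - riemann f n s - r2K (t - s) *: f s) <= e * (t - s).
Proof.
move=> s0 st tn h.
have cs : \sum_(i < n.+1 ^ 2) (cell n i t - cell n i s) = t - s.
  by rewrite sumrB !cell_sum ?s0 ?tn ?(le_trans st)//= (le_trans s0).
have -> : r2K (t - s) *: f s = \sum_(i < n.+1 ^ 2) r2K (cell n i t - cell n i s) *: f s.
  rewrite -scaler_suml -cs; congr (_ *: _).
  by elim/big_ind2 : _ => [|x x' y y' <- <-|//]; rewrite ?of_real0 ?of_realD.
rewrite /riemann -!sumrB (le_trans (rnorm_sum _ _ _))// -cs mulr_sumr ler_sum// => i _.
have -> : r2K (cell n i t) *: f (i%:R * mesh n) - r2K (cell n i s) *: f (i%:R * mesh n) -
   r2K (cell n i t - cell n i s) *: f s =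
   r2K (cell n i t - cell n i s) *: (f (i%:R * mesh n) - f s).
  by rewrite of_realB; zmod.
rewrite rnormZr ger0_norm ?cell_ge0// mulrC.
(* A cell that does not meet the open interval from [s] to [t] has no increment; for any other, the
   left node lies in [[s - mesh n, t]]. *)
have [out|] := boolP ((t <= i%:R * mesh n) || (i.+1%:R * mesh n <= s)).
  by rewrite cell_out// !mulr0.
rewrite negb_or -!ltNge => /andP[h1 h2]; rewrite ler_wpM2r ?cell_ge0//.
apply: h; first by rewrite mulr_ge0// ltW// mesh_gt0.
by rewrite (ltW h1) andbT lerBlDr; move: h2; rewrite -natr1 mulrDl mul1r => /ltW.
Qed.

(** Continuous functions are integrated by Riemann sums, and [is_bochner_prim] gives the agreement
    with the Bochner integral. Identities between such integrals are then proved by [prim_unique],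
    that is, by differentiating both sides. *)
Definition prim V (f : R -> V) (t : R) : V := lim (riemann f n t @[n --> \oo]).

(* Riemann sums satisfy the estimate that characterizes the derivative of a
   primitive, uniformly in the mesh; it passes to the limit. *)
Lemma riemann_local V (f : R -> V) (b e : R) : 0 <= b -> cnt half f -> 0 < e ->
  exists n0 d, 0 < d /\ forall n s t, (n0 <= n)%N -> 0 <= s -> s <= t -> t <= b ->
    t < s + d -> N (riemann f n t - riemann f n s - r2K (t - s) *: f s) <= e * (t - s).
Proof.
move=> b0 cf e0.
have [d d0 hd] := cnt_unif b0 (cnt_sub (seg_half (lexx 0)) cf) e0.
have [n1 hn1] := mesh_small d0; exists (maxn n1 (Num.truncn b)), d; split=> // n s t.
rewrite geq_max => /andP[n1n bn] s0 st tb tsd; apply: riemann_diff => //.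
  by rewrite (le_trans tb)// ltW// (lt_le_trans (truncnS_gt _))// ler_nat.
move=> r r0 /andP[h1 h2]; have := hn1 n n1n => h3; apply: hd.
- by rewrite r0; lra.
- by rewrite s0; lra.
- by rewrite ltr_norml; lra.
Qed.

Lemma riemann_cvg V (f : R -> V) (t : R) : cnt half f -> 0 <= t ->
  riemann f n t @[n --> \oo] --> prim f t.
Proof.
move=> cf t0; suff [l hl] : exists l : V, riemann f n t @[n --> \oo] --> l.
  by rewrite /prim; apply: cvgP hl.
apply: rnorm_cauchy_cvg => e e0.
have t1 : 0 < 1 + t by rewrite ltr_pwDl.
pose e' := e / (2 * (1 + t)); have e'0 : 0 < e' by rewrite divr_gt0// mulr_gt0.
have [n0 [d [d0 hd]]] := riemann_local t0 cf e'0.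
exists n0 => n m hn hm.
suff h : N ((riemann f n t - riemann f m t) - (riemann f n 0 - riemann f m 0)) <= 2 * e' * (t - 0).
  move: h; rewrite !riemann0 !subr0 => /le_lt_trans; apply.
  rewrite /e' invfM !mulrA (mulrAC 2) divff// mul1r mulrAC ltr_pdivrMr//.
  by rewrite ltr_pM2l// ltrDr.
apply: (@local_to_global _ 0 t (fun s u => N ((riemann f n u - riemann f m u) -
   (riemann f n s - riemann f m s)) <= 2 * e' * (u - s))) => //.
  move=> r s u _ _ h1 h2.
  rewrite (le_trans (rdistD (riemann f n s - riemann f m s) _ _))//.
  by apply: (le_trans (lerD h2 h1)); rewrite -mulrDr addrA subrK.
have key s u : 0 <= s -> s <= u -> u <= t -> u < s + d ->
    N ((riemann f n u - riemann f m u) - (riemann f n s - riemann f m s)) <= 2 * e' * (u - s).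
  move=> s0 su ut usd.
  have -> : (riemann f n u - riemann f m u) - (riemann f n s - riemann f m s) =
    (riemann f n u - riemann f n s - r2K (u - s) *: f s) -
    (riemann f m u - riemann f m s - r2K (u - s) *: f s) by zmod.
  have -> : 2 * e' * (u - s) = e' * (u - s) + e' * (u - s) by ring.
  by rewrite (le_trans (rnormB _ _))// lerD// hd.
move=> u /andP[u0 ut]; exists d => // s /andP[s0 s_t]; split=> /andP[h1 h2]; apply: key => //; lra.
Qed.

Lemma prim0 V (f : R -> V) : cnt half f -> prim f 0 = 0.
Proof.
move=> cf; apply: (cvg_rnorm_unique (riemann_cvg cf (lexx 0))).
by under eq_fun do rewrite riemann0; exact: cvg_cst.
Qed.

Lemma rnorm_lim_le V (u : nat -> V) (l : V) (c : R) :
  u @ \oo --> l -> (exists n0, forall n, (n0 <= n)%N -> N (u n) <= c) -> N l <= c.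
Proof.
move=> /cvgn_rnormP hu [n0 hn0]; apply: le_epsilon => e /hu[n1 hn1].
rewrite (le_trans (rnorm_split (u (maxn n0 n1)) _))// addrC lerD//.
  by rewrite hn0// leq_maxl.
by rewrite rdistC ltW// hn1// leq_maxr.
Qed.

Lemma der_prim V (f : R -> V) : cnt half f -> der half (prim f) f.
Proof.
move=> cf t t0 e e0; have e20 : 0 < e / 2 by rewrite divr_gt0.
have t10 : 0 <= t + 1 by rewrite (le_trans t0)// lerDl.
have [n0 [d [d0 hd]]] := riemann_local t10 cf e20.
have [d' d'0 hd'] := cf t t0 _ e20.
have key s u : 0 <= s -> s <= u -> u <= t + 1 -> u < s + d ->
    N (prim f u - prim f s - r2K (u - s) *: f s) <= e / 2 * (u - s).
  move=> s0 su ut usd.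
  apply: (@rnorm_lim_le _ (fun n => riemann f n u - riemann f n s - r2K (u - s) *: f s)).
    apply: cvgB; last exact: cvg_cst.
    by apply: cvgB; apply: riemann_cvg => //; exact: le_trans su.
  by exists n0 => n hn; exact: hd.
exists (Num.min 1 (Num.min d d')); first by rewrite !lt_min ltr01 d0.
move=> s s0; rewrite !lt_min => /and3P[s1 sd sd'].
have [st|ts] := leP t s.
  rewrite ger0_norm ?subr_ge0//; rewrite ger0_norm ?subr_ge0// in s1 sd.
  apply: (le_trans (key t s t0 st _ _)); first by lra.
    by lra.
  by rewrite ler_wpM2r ?subr_ge0// ler_pdivrMr// ler_peMr ?ler1n// ltW.
(* The estimate [key] is anchored at the left endpoint; for [s < t] it is moved from [s] to [t] by
   the continuity of [f]. *)
have st := ltW ts; rewrite ler0_norm ?subr_le0// opprB.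
have := hd' s s0 sd'; rewrite ler0_norm ?subr_le0// in s1 sd => h.
have -> : prim f s - prim f t - r2K (s - t) *: f t =
   - (prim f t - prim f s - r2K (t - s) *: f s) - r2K (t - s) *: (f s - f t).
  by rewrite !of_realB; zmod.
rewrite (le_trans (rnormB _ _))// rnormN rnormZr ger0_norm ?subr_ge0//.
rewrite [leRHS](_ : _ = e / 2 * (t - s) + e / 2 * (t - s)); last by field.
rewrite lerD//.
  by apply: key => //; lra.
by rewrite mulrC ler_wpM2r// subr_ge0.
Qed.

Lemma prim_unique V (f h : R -> V) (t : R) : cnt half f -> der half h f -> 0 <= t ->
  h t = h 0 + prim f t.
Proof.
move=> cf dh t0.
have d := derB dh (der_prim cf).
have := @der0_cst _ (fun t => h t - prim f t) 0 t t0.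
rewrite prim0// subr0 => <-; first by rewrite subrK.
apply: (der_sub (seg_half (lexx 0))); apply: der_ext d => // s _.
by rewrite subrr.
Qed.

Lemma cnt_prim V (f : R -> V) : cnt half f -> cnt half (prim f).
Proof. by move=> /der_prim /der_cnt. Qed.

End Primitive.

(** * The Bochner integral *)

Section SimpleFunctions.
Context (R : realType).
Local Notation mu := (@lebesgue_measure R).
Implicit Types (T : choiceType) (b : R).

(** Simple functions with values in any choice type, so that pairs and grid indices are covered too;
    pairing provides common refinements. *)
Definition finitely_valued T (h : R -> T) : Prop :=
  finite_set (range h) /\ forall x, measurable (h @^-1` [set x]).

Lemma finitely_valued_fiber T (h : R -> T) (P : set T) : finitely_valued h ->
  measurable (h @^-1` P).
Proof.
move=> [fh mh].
have -> : h @^-1` P = \bigcup_(x in range h `&` P) h @^-1` [set x].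
  apply/seteqP; split=> [t Pt|t [x [_ Px] hx]]; last by rewrite /preimage/= hx.
  by exists (h t) => //; split=> //; exists t.
by apply: fin_bigcup_measurable => [|i _//]; exact: finite_setIl.
Qed.

Lemma finitely_valued_comp T T' (h : R -> T) (g : T -> T') :
  finitely_valued h -> finitely_valued (g \o h).
Proof.
move=> fh; split; last by move=> x; exact: (@finitely_valued_fiber _ _ (g @^-1` [set x])).
have -> : range (g \o h) = g @` (range h).
  by apply/seteqP; split=> [_ [t _ <-]|_ [_ [t _ <-] <-]]; [exists (h t) => //; exists t|exists t].
by apply: finite_image; exact: fh.1.
Qed.

Lemma finitely_valued_pair T T' (h : R -> T) (h' : R -> T') :
  finitely_valued h -> finitely_valued h' -> finitely_valued (fun t => (h t, h' t)).
Proof.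
move=> fh fh'; split.
  apply: (@sub_finite_set _ _ (range h `*` range h')).
    by move=> _ [t _ <-]; split; exists t.
  by apply: finite_setX; [exact: fh.1|exact: fh'.1].
move=> [x x'].
have -> : (fun t => (h t, h' t)) @^-1` [set (x, x')] = h @^-1` [set x] `&` h' @^-1` [set x'].
  by apply/seteqP; split=> t /= [-> ->].
by apply: measurableI; [exact: fh.2|exact: fh'.2].
Qed.

Lemma measurable_seg b : measurable (`[0, b]%classic : set R).
Proof. exact: measurable_itv. Qed.

Lemma mu_seg_fin b (A : set R) : measurable A -> mu (`[0, b] `&` A) \is a fin_num.
Proof.
move=> mA; rewrite ge0_fin_numE//; apply: (@le_lt_trans _ _ (mu `[0, b]%classic)).
  by apply: le_measure; rewrite ?inE//; apply: measurableI.
by rewrite lebesgue_measure_itv/=; case: ifP => _; rewrite ltey// -EFinD ltry.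
Qed.

Definition mass b T (h : R -> T) (x : T) : R := fine (mu (`[0, b] `&` h @^-1` [set x])).

Lemma mass_ge0 b T (h : R -> T) x : 0 <= mass b h x.
Proof. by rewrite /mass fine_ge0. Qed.

Definition vals T (h : R -> T) : seq T := finmap.enum_fset (fset_set (range h)).

Lemma uniq_vals T (h : R -> T) : uniq (vals h).
Proof. exact: finmap.fset_uniq. Qed.

Lemma mem_vals T (h : R -> T) t : finitely_valued h -> h t \in vals h.
Proof. by move=> [fh _]; rewrite /vals in_fset_set// inE; exists t. Qed.

Lemma valsP T (h : R -> T) x : finitely_valued h -> x \in vals h -> range h x.
Proof. by move=> [fh _]; rewrite /vals in_fset_set// inE. Qed.

Lemma mass_comp b T T' (h : R -> T) (g : T -> T') y : finitely_valued h ->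
  mass b (g \o h) y = \sum_(x <- vals h | g x == y) mass b h x.
Proof.
move=> fh; rewrite /mass.
pose D := [set x | x \in vals h /\ g x = y].
have -> : `[0, b] `&` (g \o h) @^-1` [set y] =
    \bigcup_(x in D) (`[0, b] `&` h @^-1` [set x]).
  apply/seteqP; split=> [t [tb /= ghy]|t [x [_ gx] [tb /= hx]]].
    by exists (h t) => //; split=> //; exact: mem_vals.
  by split=> //=; rewrite hx.
have fD : finite_set D.
  apply: (@sub_finite_set _ _ (range h)); last exact: fh.1.
  by move=> x [/(valsP fh)].
rewrite measure_fin_bigcup//; last 2 first.
- by move=> x x' _ _ [t [[_ /= <-] [_ /= <-]]].
- by move=> x _; apply: measurableI => //; exact: fh.2.
rewrite (@fsbigE _ _ _ _ _ [seq x <- vals h | g x == y]); last 3 first.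
- by rewrite filter_uniq// uniq_vals.
- by move=> x /=; rewrite mem_filter => /andP[/eqP].
- by move=> x [xv gx]; rewrite mem_filter xv gx eqxx.
rewrite big_filter_cond -sum_fine; last first.
  by move=> x _; apply: mu_seg_fin; exact: fh.2.
rewrite big_seq_cond [RHS]big_seq_cond; apply: eq_bigl => x.
case: (boolP (x \in vals h)) => //= xv; case: eqP => //= gx.
exact: mem_set.
Qed.

Lemma mass_out b T (h : R -> T) x : finitely_valued h -> x \notin vals h -> mass b h x = 0.
Proof.
move=> fh xv; rewrite /mass (_ : _ `&` _ = set0) ?measure0//.
by apply/seteqP; split=> t //= [_ hx]; move: xv; rewrite -hx mem_vals.
Qed.

Context (k : scalar_kind).
Local Notation K := (scalars k R).
Local Notation r2K := (@of_real k R).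
Local Notation N := rnorm.
Implicit Types V W : completeNormedModType K.

Lemma simple_fv V (s : R -> V) : simple_function s = finitely_valued s.
Proof. by []. Qed.

(** The integral may be computed over the fibres of any finitely valued map through which the
    function factors. Additivity follows by factoring both summands through the pair. *)
Lemma simple_integralE b T (h : R -> T) V (g : T -> V) : finitely_valued h ->
  simple_integral `[0, b] (g \o h) = \sum_(x <- vals h) r2K (mass b h x) *: g x.
Proof.
move=> fh; have fgh := finitely_valued_comp g fh.
rewrite /simple_integral fsbig_finite; last exact: fgh.1.
rewrite -/(vals (g \o h)) -/(mass _ _ _).
under eq_bigr => y _ do rewrite -/(mass b (g \o h) y) (mass_comp b g y fh).
transitivity (\sum_(y <- vals (g \o h)) \sum_(x <- vals h | g x == y) r2K (mass b h x) *: g x).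
  apply: eq_bigr => y _; rewrite (big_morph r2K (@of_realD k R) (of_real0 k R)).
  by rewrite scaler_suml; apply: eq_bigr => x /eqP ->.
rewrite (exchange_big_dep predT)//= big_seq [RHS]big_seq; apply: eq_bigr => x xv.
have gxv : g x \in vals (g \o h).
  by have [t _ <-] := valsP fh xv; exact: (mem_vals t fgh).
rewrite big_mkcond (bigD1_seq (g x))//= ?uniq_vals// eqxx big1 ?addr0// => y.
by rewrite eq_sym => /negPf ->.
Qed.

Definition L1 b V (f : R -> V) : \bar R := (\int[mu]_(t in `[0%R, b]) (N (f t))%:E)%E.

Lemma L1_ge0 b V (f : R -> V) : (0 <= L1 b f)%E.
Proof. by apply: integral_ge0 => t _; rewrite lee_fin. Qed.

Lemma integral_fv b T (h : R -> T) (g : T -> R) : finitely_valued h -> (forall x, 0 <= g x) ->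
  (\int[mu]_(t in `[0%R, b]) (g (h t))%:E)%E = (\sum_(x <- vals h) mass b h x * g x)%:E.
Proof.
move=> fh g0.
have -> : (fun t => (g (h t))%:E) =
    (fun t => \sum_(x <- vals h) ((g x)%:E * (\1_(h @^-1` [set x]) t)%:E)%E).
  apply/funext => t; rewrite (bigD1_seq (h t))/= ?mem_vals ?uniq_vals//.
  rewrite indicE mem_set//= mule1 big1 ?adde0// => x xh.
  by rewrite indicE memNset ?mule0//= => hx; rewrite hx eqxx in xh.
rewrite ge0_integral_sum//; last 2 first.
- move=> x; apply/measurable_EFinP.
  apply: measurable_funM => //; apply: measurable_indic; exact: fh.2.
- by move=> x t _; rewrite -EFinM lee_fin mulr_ge0.
rewrite -sumEFin; apply: eq_bigr => x _.
rewrite ge0_integralZl_EFin//; last first.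
- by apply/measurable_EFinP; apply: measurable_indic; exact: fh.2.
rewrite integral_indic//; last exact: fh.2.
rewrite setIC EFinM muleC fineK//; apply: mu_seg_fin; exact: fh.2.
Qed.

Lemma simple_integral_le b V (s : R -> V) : simple_function s ->
  ((N (simple_integral `[0, b] s))%:E <= L1 b s)%E.
Proof.
move=> fs; have := @simple_integralE b _ s V id fs; rewrite /comp => ->.
rewrite /L1 (integral_fv b fs)//= lee_fin (le_trans (rnorm_sum _ _ _))//.
by apply: ler_sum => x _; rewrite rnormZr ger0_norm// mass_ge0.
Qed.

Lemma simple_function2 V V' W (s : R -> V) (s' : R -> V') (g : V -> V' -> W) :
  simple_function s -> simple_function s' -> simple_function (fun t => g (s t) (s' t)).
Proof.
move=> fs fs'; have := finitely_valued_comp (fun x => g x.1 x.2) (finitely_valued_pair fs fs').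
by [].
Qed.

Lemma simple_integralD b V (s s' : R -> V) (c : K) :
  simple_function s -> simple_function s' ->
  simple_integral `[0, b] (fun t => c *: s t + s' t) =
  c *: simple_integral `[0, b] s + simple_integral `[0, b] s'.
Proof.
move=> fs fs'; have fp := finitely_valued_pair fs fs'.
have := @simple_integralE b _ _ V (fun x => c *: x.1 + x.2) fp; rewrite /comp/= => ->.
have := @simple_integralE b _ _ V fst fp; rewrite /comp/= => ->.
have := @simple_integralE b _ _ V snd fp; rewrite /comp/= => ->.
rewrite scaler_sumr -big_split; apply: eq_bigr => x _ /=.
by rewrite scalerDr; congr (_ + _); rewrite !scalerA mulrC.
Qed.

End SimpleFunctions.

Section Bochner.
Context (R : realType) (k : scalar_kind).
Local Notation mu := (@lebesgue_measure R).
Local Notation K := (scalars k R).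
Local Notation N := rnorm.
Implicit Types V W : completeNormedModType K.

Lemma ereal_cvg0P (u : nat -> \bar R) : (forall n, 0 <= u n)%E ->
  (u @ \oo --> 0%E) <->
  (forall e : R, 0 < e -> exists n0, forall n, (n0 <= n)%N -> (u n <= e%:E)%E).
Proof.
move=> u0; split=> [/fine_cvgP[[n1 _ h1] /cvgrPdist_le h2] e e0|h].
  have [n2 _ h3] := h2 e e0.
  exists (maxn n1 n2) => n; rewrite geq_max => /andP[nn1 nn2].
  have := h3 n nn2; rewrite sub0r normrN ger0_norm ?fine_ge0// => ?.
  by rewrite -(fineK (h1 n nn1)) lee_fin.
apply/fine_cvgP; split.
  have [n1 h1] := h 1 ltr01; exists n1 => // n /= nn1.
  by rewrite ge0_fin_numE// (le_lt_trans (h1 n nn1))// ltry.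
apply/cvgrPdist_le => e e0; have [n0 h0] := h e e0; exists n0 => // n /= nn0.
rewrite sub0r normrN ger0_norm ?fine_ge0//.
by rewrite -lee_fin fineK ?h0// ge0_fin_numE// (le_lt_trans (h0 n nn0))// ltry.
Qed.

Lemma rnorm_cvg V (u : nat -> V) (l : V) : u @ \oo --> l -> N (u n) @[n --> \oo] --> N l.
Proof.
move=> /cvgn_rnormP h; apply/cvgrPdist_lt => e /h[n0 hn]; exists n0 => // n /= nn.
rewrite (le_lt_trans _ (hn n nn))//.
have := rnorm_split (u n) l; have := rnorm_split l (u n).
by rewrite [N (l - u n)]rdistC ler_norml => ? ?; lra.
Qed.

Lemma fv_measurable (D : set R) (s : R -> R) : finitely_valued s -> measurable_fun D s.
Proof.
move=> fs mD Y mY; apply: measurableI => //; exact: finitely_valued_fiber.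
Qed.

Lemma sm_norm_measurable (D : set R) V (f : R -> V) :
  strongly_measurable D f -> measurable_fun D (fun t => N (f t)).
Proof.
move=> [s [fs hs]]; apply: (@measurable_fun_cvg _ _ _ _ (fun n t => N (s n t))).
  move=> n; apply: fv_measurable.
  exact: (@finitely_valued_comp R V R (s n) (fun x => N x) (fs n)).
by move=> t /hs; exact: rnorm_cvg.
Qed.

Lemma sm_norm_emeasurable (D : set R) V (f : R -> V) :
  strongly_measurable D f -> measurable_fun D (fun t => (N (f t))%:E).
Proof. by move=> /sm_norm_measurable ?; apply/measurable_EFinP. Qed.

Lemma sm_simple (D : set R) V (s : R -> V) : simple_function s -> strongly_measurable D s.
Proof. by move=> fs; exists (fun=> s); split=> // t _; exact: cvg_cst. Qed.

Lemma sm_comb (D : set R) V (c : K) (f g : R -> V) : strongly_measurable D f ->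
  strongly_measurable D g -> strongly_measurable D (fun t => c *: f t + g t).
Proof.
move=> [s [fs hs]] [s' [fs' hs']]; exists (fun n t => c *: s n t + s' n t); split.
  by move=> n; exact: (simple_function2 (fun x y => c *: x + y) (fs n) (fs' n)).
by move=> t Dt; apply: cvgD; [apply: cvgZr; exact: hs|exact: hs'].
Qed.

Lemma sm_sub (D : set R) V (f g : R -> V) : strongly_measurable D f ->
  strongly_measurable D g -> strongly_measurable D (fun t => f t - g t).
Proof.
move=> hf hg; have := sm_comb (-1) hg hf; congr strongly_measurable.
by apply/funext => t; rewrite scaleN1r addrC.
Qed.

Section Segment.
Variable b : R.
Local Notation I := (`[0, b]%classic : set R).
Local Notation sm := (strongly_measurable I).

Lemma L1_dist_tri V (f g h : R -> V) : sm f -> sm g -> sm h ->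
  (L1 b (fun t => (f t - h t)%R) <= L1 b (fun t => (f t - g t)%R) + L1 b (fun t => (g t - h t)%R))%E.
Proof.
move=> mf mg mh; rewrite /L1 -ge0_integralD//; last 4 first.
- by move=> t _; rewrite lee_fin.
- exact: sm_norm_emeasurable (sm_sub mf mg).
- by move=> t _; rewrite lee_fin.
- exact: sm_norm_emeasurable (sm_sub mg mh).
apply: ge0_le_integral => //.
- by move=> t _; rewrite lee_fin.
- exact: sm_norm_emeasurable (sm_sub mf mh).
- by apply: emeasurable_funD; apply: sm_norm_emeasurable; exact: sm_sub.
- by move=> t _; rewrite -EFinD lee_fin rdistD.
Qed.

Lemma L1_distC V (f g : R -> V) : L1 b (fun t => (f t - g t)%R) = L1 b (fun t => (g t - f t)%R).
Proof. by apply: eq_integral => t _; rewrite rdistC. Qed.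

Lemma L1_le V W (f : R -> V) (g : R -> W) (c : R) : 0 <= c -> sm f -> sm g ->
  (forall t, 0 <= t <= b -> N (f t) <= c * N (g t)) -> (L1 b f <= c%:E * L1 b g)%E.
Proof.
move=> c0 mf mg h; rewrite /L1 -ge0_integralZl_EFin//; last 2 first.
- by move=> t _; rewrite lee_fin.
- exact: sm_norm_emeasurable.
apply: ge0_le_integral => //.
- by move=> t _; rewrite lee_fin.
- exact: sm_norm_emeasurable.
- by apply: measurable_funeM; exact: sm_norm_emeasurable.

Qed.

Lemma L1_bound V (f : R -> V) (c : R) : 0 <= b -> 0 <= c -> sm f ->
  (forall t, 0 <= t <= b -> N (f t) <= c) -> (L1 b f <= (c * b)%:E)%E.
Proof.
move=> b0 c0 mf h; apply: (@le_trans _ _ (\int[mu]_(t in I) (cst c%:E) t)%E).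
  apply: ge0_le_integral => //.
  - by move=> t _; rewrite lee_fin.
  - exact: sm_norm_emeasurable.

rewrite integral_cst//= lebesgue_measure_itv/=.
by case: ifP => _; rewrite -?EFinD ?subr0 -EFinM// lee_fin mulr0 mulr_ge0.
Qed.

Lemma simple_dist V (s s' : R -> V) : simple_function s -> simple_function s' ->
  ((N (simple_integral I s - simple_integral I s'))%:E <= L1 b (fun t => (s t - s' t)%R))%E.
Proof.
move=> fs fs'; have := simple_integralD b (-1) fs' fs.
rewrite scaleN1r addrC => <-.
rewrite (_ : (fun t => -1 *: s' t + s t) = (fun t => s t - s' t)); last first.
  by apply/funext => t; rewrite scaleN1r addrC.
apply: simple_integral_le.
exact: (simple_function2 (fun x y => x - y) fs fs').
Qed.

Lemma bochner_of_simple V (f : R -> V) (s : nat -> R -> V) : sm f ->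
  (forall n, simple_function (s n)) ->
  (forall e : R, 0 < e -> exists n0, forall n, (n0 <= n)%N ->
     (L1 b (fun t => (f t - s n t)%R) <= e%:E)%E) ->
  exists2 v, is_bochner 0 b f v & simple_integral I (s n) @[n --> \oo] --> v.
Proof.
move=> mf fs hs.
have [v hv] : exists v : V, simple_integral I (s n) @[n --> \oo] --> v.
  apply: rnorm_cauchy_cvg => e e0; have e30 : 0 < e / 3 by rewrite divr_gt0.
  have [n0 h0] := hs _ e30; exists n0 => n m /h0 hn /h0 hm.
  rewrite -lte_fin; apply: (le_lt_trans (simple_dist (fs n) (fs m))).
  apply: (@le_lt_trans _ _ ((e / 3)%:E + (e / 3)%:E)%E); last first.
    rewrite -EFinD lte_fin; lra.
  apply: le_trans (L1_dist_tri (sm_simple _ (fs n)) mf (sm_simple _ (fs m))) _.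
  by apply: leeD => //; rewrite L1_distC.
exists v => //; split=> //; exists s; split=> //.
by apply/ereal_cvg0P => // n; exact: L1_ge0.
Qed.

Lemma is_bochner_norm V (f : R -> V) v : is_bochner 0 b f v -> ((N v)%:E <= L1 b f)%E.
Proof.
move=> [mf [s [fs /ereal_cvg0P hs hv]]]; apply/lee_addgt0Pr => e e0.
have e20 : 0 < e / 2 by rewrite divr_gt0.
have [|n0 h0] := hs _ _ e20; first by move=> n; exact: L1_ge0.
move/cvgn_rnormP : hv => /(_ _ e20)[n1 h1].
pose n := maxn n0 n1; have := h0 n (leq_maxl _ _); have := h1 n (leq_maxr _ _) => hn1 hn0.
have m0 : sm (fun=> 0 : V).
  by apply: sm_simple; apply: (@finitely_valued_comp _ _ _ (s n) (fun=> 0)); exact: fs.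
have L1s : (L1 b (s n) <= (e / 2)%:E + L1 b f)%E.
  have := L1_dist_tri (sm_simple _ (fs n)) mf m0.
  have -> : (fun t => s n t - 0) = s n by apply/funext => t; rewrite subr0.
  have -> : (fun t => f t - 0) = f by apply/funext => t; rewrite subr0.
  move/le_trans; apply; apply: leeD => //; rewrite L1_distC; exact: hn0.
apply: (@le_trans _ _ ((e / 2)%:E + L1 b (s n))%E).
  apply: (@le_trans _ _ ((e / 2)%:E + (N (simple_integral I (s n)))%:E)%E).
    rewrite -EFinD lee_fin (le_trans (rnorm_split (simple_integral I (s n)) _))// lerD2r.
    by rewrite rdistC ltW.
  by apply: leeD => //; exact: simple_integral_le.
apply: (@le_trans _ _ ((e / 2)%:E + ((e / 2)%:E + L1 b f))%E); first by apply: leeD.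
by rewrite addeA -EFinD -splitr addeC.
Qed.

Lemma is_bochner_comb V (f g : R -> V) v w (c : K) : is_bochner 0 b f v -> is_bochner 0 b g w ->
  is_bochner 0 b (fun t => c *: f t + g t) (c *: v + w).
Proof.
move=> [mf [s [fs hs hv]]] [mg [s' [fs' hs' hw]]]; split; first exact: sm_comb.
exists (fun n t => c *: s n t + s' n t); split.
- by move=> n; exact: (simple_function2 (fun x y => c *: x + y) (fs n) (fs' n)).
- apply/ereal_cvg0P => [n|e e0]; first exact: L1_ge0.
  have c1 : 0 < 1 + absK c by rewrite ltr_pwDl// absK_ge0.
  have e20 : 0 < e / 2 by rewrite divr_gt0.
  have e2c : 0 < e / 2 / (1 + absK c) by rewrite divr_gt0.
  move/ereal_cvg0P : hs => /(_ (fun n => L1_ge0 b _))/(_ _ e2c)[n1 h1].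
  move/ereal_cvg0P : hs' => /(_ (fun n => L1_ge0 b _))/(_ _ e20)[n2 h2].
  exists (maxn n1 n2) => n; rewrite geq_max => /andP[/h1 hn1 /h2 hn2].
  have mfs := sm_sub mf (sm_simple I (fs n)); have mgs := sm_sub mg (sm_simple I (fs' n)).
  apply: (@le_trans _ _ ((1 + absK c)%:E * L1 b (fun t => (f t - s n t)%R) +
     L1 b (fun t => (g t - s' n t)%R))%E); last first.
    rewrite [e%:E](_ : _ = (e / 2)%:E + (e / 2)%:E)%E; last by rewrite -EFinD -splitr.
    apply: leeD => //.
    rewrite (_ : (e / 2)%:E = (1 + absK c)%:E * (e / 2 / (1 + absK c))%:E)%E; last first.
      by rewrite -EFinM; congr EFin; field; rewrite gt_eqF.
    by apply: lee_pmul => //; rewrite ?lee_fin ?(ltW c1)//; exact: L1_ge0.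
  rewrite /L1 -ge0_integralZl_EFin ?(ltW c1)//; last 2 first.
  - by move=> t _; rewrite lee_fin.
  - exact: sm_norm_emeasurable.
  rewrite -ge0_integralD//; last 4 first.
  - by move=> t _; rewrite -EFinM lee_fin mulr_ge0// ltW.
  - by apply: measurable_funeM; exact: sm_norm_emeasurable.
  - by move=> t _; rewrite lee_fin.
  - exact: sm_norm_emeasurable.
  apply: ge0_le_integral => //.
  - by move=> t _; rewrite lee_fin.
  - apply: sm_norm_emeasurable; apply: sm_sub; apply: sm_comb => //; exact: sm_simple.
  - apply: emeasurable_funD; last exact: sm_norm_emeasurable.
    by apply: measurable_funeM; exact: sm_norm_emeasurable.
  - move=> t _; rewrite -EFinM -EFinD lee_fin.
    have -> : c *: f t + g t - (c *: s n t + s' n t) = c *: (f t - s n t) + (g t - s' n t) by zmod.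
    rewrite (le_trans (rnormD _ _))// lerD2r rnormZ ler_wpM2r//.
    by rewrite lerDr.
- under eq_fun do rewrite simple_integralD//.
  by apply: cvgD => //; exact: cvgZr.
Qed.

(** The difference of the two values is an integral of the zero function, which [is_bochner_norm]
    bounds by 0. Hence any value found determines the chosen one, [bochner]. *)
Lemma is_bochner_unique V (f : R -> V) v w : is_bochner 0 b f v -> is_bochner 0 b f w -> v = w.
Proof.
move=> hv hw; have := is_bochner_norm (is_bochner_comb (-1) hv hw).
have -> : (fun t => -1 *: f t + f t) = (fun=> 0) by apply/funext => t; rewrite scaleN1r addNr.
rewrite /L1; under eq_integral do rewrite rnorm0.
rewrite integral0 lee_fin => h; apply/esym/eqP; rewrite -subr_eq0; apply/eqP/rnorm0_eq0.
by apply/eqP; rewrite eq_le rnorm_ge0 andbT addrC -scaleN1r.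
Qed.

Lemma bochnerE V (f : R -> V) v : is_bochner 0 b f v -> bochner 0 b f = v.
Proof.
move=> hv; have : is_bochner 0 b f (bochner 0 b f) by rewrite /bochner; apply: (xgetI 0 hv).
by move=> h; exact: (is_bochner_unique h hv).
Qed.

(** A diagonal choice of simple functions, close to [g n] both in L1 and in integral. It serves to
    integrate an output of [F] that is known only as a limit. *)
Lemma is_bochner_lim V (f : R -> V) (g : nat -> R -> V) (w : nat -> V) (v : V) : sm f ->
  (forall n, is_bochner 0 b (g n) (w n)) ->
  (forall e : R, 0 < e -> exists n0, forall n, (n0 <= n)%N ->
     (L1 b (fun t => (f t - g n t)%R) <= e%:E)%E) ->
  w n @[n --> \oo] --> v -> is_bochner 0 b f v.
Proof.
move=> mf hg hfg hw.
have h n : exists s : R -> V, simple_function s /\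
   (L1 b (fun t => (g n t - s t)%R) <= (mesh R n)%:E)%E /\
   N (simple_integral I s - w n) < mesh R n.
  have [mg [s [fs hs hv]]] := hg n.
  move/ereal_cvg0P : hs => /(_ (fun n => L1_ge0 b _))/(_ _ (mesh_gt0 R n))[n1 h1].
  move/cvgn_rnormP : hv => /(_ _ (mesh_gt0 R n))[n2 h2].
  by exists (s (maxn n1 n2)); split=> //; split; [apply: h1; rewrite leq_maxl|apply: h2; rewrite leq_maxr].
have [s hs] := choice h.
have [||v' bv' hv'] := @bochner_of_simple V f s mf.
- by move=> n; have [] := hs n.
- move=> e e0; have e20 : 0 < e / 2 by rewrite divr_gt0.
  have [n1 h1] := hfg _ e20; have [n2 h2] := mesh_small e20.
  exists (maxn n1 n2) => n; rewrite geq_max => /andP[/h1 hn1 /h2 hn2].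
  have [fs [hs1 hs2]] := hs n.
  have [mg _] := hg n.
  apply: (le_trans (L1_dist_tri mf mg (sm_simple _ fs))).
  rewrite (splitr e) EFinD; apply: leeD => //.
  by apply: (le_trans hs1); rewrite lee_fin ltW.
suff -> : v = v' by [].
apply: (cvg_rnorm_unique _ hv'); apply/cvgn_rnormP => e e0.
have e20 : 0 < e / 2 by rewrite divr_gt0.
move/cvgn_rnormP : hw => /(_ _ e20)[n1 h1]; have [n2 h2] := mesh_small e20.
exists (maxn n1 n2) => n; rewrite geq_max => /andP[/h1 hn1 /h2 hn2].
have [fs [hs1 hs2]] := hs n.
rewrite (le_lt_trans (rdistD (w n) _ _))// (splitr e) ltrD//.
exact: lt_trans hn2.
Qed.

End Segment.
End Bochner.

(** * Bochner integrals of continuous functions and of operator kernels *)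

Section StepFunctions.
Context (R : realType).
Local Notation mu := (@lebesgue_measure R).
Implicit Types b : R.

Definition grid n i : R := i%:R * mesh R n.

(** The index of the grid cell containing [t]. Points outside [[0, n.+1[] receive the spare index
    [n.+1 ^ 2], which keeps the function total and finitely valued. *)
Definition idx n (t : R) : nat :=
  if 0 <= t < n.+1%:R then Num.truncn (t * n.+1%:R) else (n.+1 ^ 2)%N.

Lemma gridS n i : grid n i.+1 = grid n i + mesh R n.
Proof. by rewrite /grid -natr1 mulrDl mul1r. Qed.

Lemma grid_ge0 n i : 0 <= grid n i.
Proof. by rewrite mulr_ge0// ltW// mesh_gt0. Qed.

Lemma grid_idx n (t : R) : 0 <= t < n.+1%:R -> grid n (idx n t) <= t < grid n (idx n t) + mesh R n.
Proof.
move=> h; rewrite -gridS /grid /idx h /mesh ler_pdivrMr// ltr_pdivlMr//.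
by case/andP: h => t0 _; apply: truncn_itv; rewrite mulr_ge0.
Qed.

Lemma idx_ltn n (t : R) : 0 <= t < n.+1%:R -> (idx n t < n.+1 ^ 2)%N.
Proof.
move=> h; have /andP[+ _] := grid_idx h; case/andP: h => _ tn; rewrite -(ltr_nat R) => h.
have := le_lt_trans h tn; rewrite /grid /mesh ltr_pdivrMr// => /lt_le_trans; apply.
by rewrite natrX expr2.
Qed.

Lemma idx_le n (t : R) : (idx n t <= n.+1 ^ 2)%N.
Proof.
by have [h|h] := boolP (0 <= t < n.+1%:R); [exact/ltnW/idx_ltn|rewrite /idx (negPf h)].
Qed.

Lemma idx_fiber n i : (i < n.+1 ^ 2)%N ->
  idx n @^-1` [set i] = `[grid n i, grid n i.+1[%classic.
Proof.
move=> iN; apply/seteqP; split=> t /=; rewrite in_itv/=.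
  rewrite /idx; case: ifP => [h|_ Ni]; last by rewrite Ni ltnn in iN.
  by move=> ti; have := grid_idx h; rewrite /idx h ti gridS.
move=> /andP[h1 h2].
have t0 : 0 <= t := le_trans (grid_ge0 n i) h1.
have tn : t < n.+1%:R.
  by rewrite (lt_le_trans h2)// /grid /mesh ler_pdivrMr// -natrM ler_nat mulnn.
rewrite /idx t0 tn/=; apply: truncn_def.
by move: h1 h2; rewrite /grid /mesh ler_pdivrMr// ltr_pdivlMr// => -> ->.
Qed.

Lemma finitely_valued_idx n : finitely_valued (idx n).
Proof.
split.
  apply: (@sub_finite_set _ _ `I_(n.+1 ^ 2).+1); last exact: finite_II.
  by move=> _ [t _ <-]; rewrite /= ltnS idx_le.
move=> i; have [iN|] := ltnP i (n.+1 ^ 2); first by rewrite idx_fiber//; exact: measurable_itv.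
rewrite leq_eqVlt => /orP[/eqP <-|iN].
  have -> : idx n @^-1` [set (n.+1 ^ 2)%N] = ~` `[0, n.+1%:R[%classic.
    apply/seteqP; split=> t /=; rewrite in_itv/=.
      by move=> h h'; have := idx_ltn h'; rewrite h ltnn.
    by move=> /negP h; rewrite /idx (negPf h).
  by apply: measurableC; exact: measurable_itv.
rewrite (_ : _ @^-1` _ = set0)//; apply/seteqP; split=> t //= h.
by have := idx_le n t; rewrite h leqNgt iN.
Qed.

Lemma mass_idx n i b : 0 <= b -> (i < n.+1 ^ 2)%N -> mass b (idx n) i = cell n i b.
Proof.
move=> b0 iN; rewrite /mass idx_fiber// /cell -/(grid n i) -/(grid n i.+1).
have g0 := grid_ge0 n i; have := gridS n i; have := mesh_gt0 R n => d0 gS.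
have [b1|b1] := ltP b (grid n i).
  rewrite (_ : _ `&` _ = set0) ?measure0//=.
    by rewrite !min_l ?subrr//; lra.
  by apply/seteqP; split=> t //= [] /=; rewrite !in_itv/=; lra.
have [b2|b2] := ltP b (grid n i.+1).
  rewrite (_ : _ `&` _ = `[grid n i, b]%classic).
    rewrite lebesgue_measure_itv/= lte_fin; case: ltP => h; rewrite ?EFinN //=.
    lra.
  by apply/seteqP; split=> t /=; rewrite !in_itv/=; [case=> ? ?; lra|move=> ?; split; lra].
rewrite (_ : _ `&` _ = `[grid n i, grid n i.+1[%classic).
  by rewrite lebesgue_measure_itv/= lte_fin gS ltrDl d0/=.
by apply/seteqP; split=> t /=; rewrite !in_itv/=; [case=> ? ?; lra|move=> ?; split; lra].
Qed.

Lemma mass_idx_last n b : 0 <= b < n.+1%:R -> mass b (idx n) (n.+1 ^ 2)%N = 0.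
Proof.
move=> /andP[b0 bn]; rewrite /mass (_ : _ `&` _ = set0) ?measure0//.
apply/seteqP; split=> t //= [] /=; rewrite in_itv/= => /andP[t0 tb] h.
by have := @idx_ltn n t; rewrite t0 (le_lt_trans tb bn) h ltnn => /(_ isT).
Qed.

Context (k : scalar_kind).
Local Notation K := (scalars k R).
Local Notation r2K := (@of_real k R).
Local Notation N := rnorm.
Implicit Types V W : completeNormedModType K.

Lemma simple_integral_seq b (T : choiceType) (h : R -> T) V (g : T -> V) (r : seq T) :
  finitely_valued h -> uniq r -> (forall t, h t \in r) ->
  simple_integral `[0, b] (g \o h) = \sum_(x <- r) r2K (mass b h x) *: g x.
Proof.
move=> fh ur hr; rewrite simple_integralE// [RHS](bigID (mem (vals h)))/=.
rewrite [X in _ + X]big1 ?addr0; last first.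
  by move=> x xv; rewrite mass_out// of_real0 scale0r.
rewrite -[in RHS]big_filter; apply: perm_big; apply: uniq_perm.
- exact: uniq_vals.
- exact: filter_uniq.
- move=> x; rewrite mem_filter; case: (boolP (x \in vals h)) => //= xv.
  by have [t _ <-] := valsP fh xv; rewrite hr.
Qed.

Definition step V n (f : R -> V) (t : R) : V := f (grid n (idx n t)).

Lemma simple_step V n (f : R -> V) : simple_function (step n f).
Proof. exact: (finitely_valued_comp (f \o grid n) (finitely_valued_idx n)). Qed.

(** The fibres of [idx n] are half-open grid cells whose trace on [[0, b]] has measure [cell n i b];
    the spare index has no mass as [b < n.+1]. *)
Lemma simple_integral_step V n (f : R -> V) b : 0 <= b < n.+1%:R ->
  simple_integral `[0, b] (step n f) = riemann f n b.
Proof.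
move=> bn; have := @simple_integral_seq b _ (idx n) V (f \o grid n) (iota 0 (n.+1 ^ 2).+1).
rewrite /comp -/(step n f) => ->; last 3 first.
- exact: finitely_valued_idx.
- exact: iota_uniq.
- by move=> t; rewrite mem_iota /= add0n ltnS idx_le.
have -> : iota 0 (n.+1 ^ 2).+1 = index_iota 0 (n.+1 ^ 2).+1 by rewrite /index_iota subn0.
rewrite big_nat_recr//= mass_idx_last// of_real0 scale0r addr0 big_mkord.
by apply: eq_bigr => i _; rewrite mass_idx//; case/andP: bn.
Qed.

Lemma step_close V (f : R -> V) b : 0 <= b -> cnt (seg 0 b) f ->
  forall e : R, 0 < e -> exists n0, forall n t, (n0 <= n)%N -> 0 <= t <= b ->
    N (f t - step n f t) <= e.
Proof.
move=> b0 cf e e0; have [d d0 hd] := cnt_unif b0 cf e0.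
have [n1 h1] := mesh_small d0; exists (maxn n1 (Num.truncn b)) => n t.
rewrite geq_max => /andP[/h1 hn bn] /andP[t0 tb].
have tn : 0 <= t < n.+1%:R.
  by rewrite t0 (le_lt_trans tb)// (lt_le_trans (truncnS_gt _))// ler_nat.
have /andP[g1 g2] := grid_idx tn; have := grid_ge0 n (idx n t) => g0.
by apply: hd; rewrite ?t0 ?tb ?g0 ?ltr_norml//=; lra.
Qed.

Lemma truncn_large b n : (Num.truncn b <= n)%N -> b < n.+1%:R.
Proof. by move=> h; rewrite (lt_le_trans (truncnS_gt _))// ler_nat. Qed.

Lemma cnt_seg_half V (f : R -> V) b : 0 <= b -> cnt half f -> cnt (seg 0 b) f.
Proof. by move=> b0; apply: cnt_sub; exact: seg_half. Qed.

Lemma sm_cnt V (f : R -> V) b : 0 <= b -> cnt (seg 0 b) f -> strongly_measurable `[0, b] f.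
Proof.
move=> b0 cf; exists (fun n => step n f); split=> [n|t]; first exact: simple_step.
rewrite /= in_itv/= => tb; apply/cvgn_rnormP => e e0.
have e20 : 0 < e / 2 by rewrite divr_gt0.
have [n0 h0] := step_close b0 cf e20; exists n0 => n nn.
rewrite rdistC (le_lt_trans (h0 n t nn tb))// ltr_pdivrMr// ltr_pMr// ltr1n //.
Qed.

Lemma L1_step V (f : R -> V) b : 0 <= b -> cnt (seg 0 b) f ->
  forall e : R, 0 < e -> exists n0, forall n, (n0 <= n)%N ->
    (L1 b (fun t => (f t - step n f t)%R) <= e%:E)%E.
Proof.
move=> b0 cf e e0; have b1 : 0 < b + 1 by rewrite ltr_wpDl.
have [|n0 h0] := step_close b0 cf (e := e / (b + 1)); first by rewrite divr_gt0.
exists n0 => n nn; have mf := sm_cnt b0 cf.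
apply: (@le_trans _ _ (e / (b + 1) * b)%:E).
  apply: L1_bound => //; first by rewrite divr_ge0// ltW.
    by apply: sm_sub => //; exact/sm_simple/simple_step.
  by move=> t tb; exact: h0.
rewrite lee_fin mulrAC ler_pdivrMr// ler_wpM2l ?(ltW e0)//; lra.
Qed.

Lemma is_bochner_prim V (f : R -> V) b : 0 <= b -> cnt half f -> is_bochner 0 b f (prim f b).
Proof.
move=> b0 cf; have cf' := cnt_seg_half b0 cf.
have [v bv hv] := bochner_of_simple (sm_cnt b0 cf') (fun n => simple_step n f) (L1_step b0 cf').
suff -> : prim f b = v by [].
apply: (cvg_rnorm_unique (riemann_cvg cf b0)); apply: cvg_trans hv.
apply: near_eq_cvg; exists (Num.truncn b) => // n /= bn.
by rewrite simple_integral_step// b0 truncn_large.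
Qed.

Lemma sm_ext V (f g : R -> V) b : (forall t, 0 <= t <= b -> f t = g t) ->
  strongly_measurable `[0, b] f -> strongly_measurable `[0, b] g.
Proof.
move=> fg [s [fs hs]]; exists s; split=> // t tb; rewrite -fg; first exact: hs.
by move: tb; rewrite /= in_itv.
Qed.

Lemma is_bochner_ext V (f g : R -> V) b v : (forall t, 0 <= t <= b -> f t = g t) ->
  is_bochner 0 b f v -> is_bochner 0 b g v.
Proof.
move=> fg [mf [s [fs hs hv]]]; split; first exact: sm_ext mf.
exists s; split=> //.
suff -> : (fun n => \int[mu]_(t in `[0%R, b]) (N (g t - s n t))%:E)%E =
          (fun n => \int[mu]_(t in `[0%R, b]) (N (f t - s n t))%:E)%E by [].
apply/funext => n; apply: eq_integral => t.
by rewrite inE/= in_itv/= => tb; rewrite fg.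
Qed.

(** Freezing [f] beyond [b] extends it to the half-line, where [prim] and its derivative are
    available. *)
Lemma cnt_clamp V (f : R -> V) b : 0 <= b -> cnt (seg 0 b) f -> cnt half (fun t => f (Num.min t b)).
Proof.
move=> b0 cf t t0 e e0.
have mb (s : R) : 0 <= s -> seg 0 b (Num.min s b).
  by move=> s0; rewrite /seg/= le_min s0 b0 ge_min lexx orbT.
have [d d0 hd] := cf _ (mb t t0) e e0; exists d => // s s0 sd.
apply: hd; first exact: mb.
apply: le_lt_trans sd.
have [h1|h1] := leP s b; have [h2|h2] := leP t b; rewrite ?lexx// ?subrr ?normr0//.
  by rewrite !ler0_norm; lra.
by rewrite !ger0_norm; lra.
Qed.

Lemma is_bochner_ftc V (f h : R -> V) b : 0 <= b -> cnt (seg 0 b) f -> der (seg 0 b) h f ->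
  is_bochner 0 b f (h b - h 0).
Proof.
move=> b0 cf dh; have cg := cnt_clamp b0 cf; set g := (fun t => _) in cg.
have fg t : 0 <= t <= b -> g t = f t by case/andP=> _ tb; rewrite /g min_l.
suff -> : h b - h 0 = prim g b.
  by apply: is_bochner_ext (is_bochner_prim b0 cg) => t /fg.
have := @der0_cst _ _ _ (fun t => h t - prim g t) 0 b b0.
rewrite prim0// subr0 => <-; first by rewrite opprB addrC subrK.
apply: der_ext (derB dh (der_sub (seg_half (lexx 0)) (der_prim cg))) => // t tb.
by rewrite fg// subrr.
Qed.

(* Operator-valued kernels: the discretized kernel applied to a simple function
   is simple. *)
Lemma is_bochner_op V W (L : R -> V -> W) (c : R) (b : R) (u : R -> V) (s : nat -> R -> V) :
  0 <= b -> 0 <= c ->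
  (forall t, {morph L t : x y / x - y}) ->
  (forall t x, 0 <= t <= b -> N (L t x) <= c * N x) ->
  (forall x, cnt (seg 0 b) (L^~ x)) ->
  (forall n, simple_function (s n)) ->
  (forall t, 0 <= t <= b -> s n t @[n --> \oo] --> u t) ->
  (forall e : R, 0 < e -> exists n0, forall n, (n0 <= n)%N ->
     (L1 b (fun t => (u t - s n t)%R) <= e%:E)%E) ->
  exists v, is_bochner 0 b (fun t => L t (u t)) v.
Proof.
move=> b0 c0 LB Lc Lcnt fs su hsu.
have b1 : 0 < b + 1 by rewrite ltr_wpDl.
have c1 : 0 < c + 1 by rewrite ltr_wpDl.
(* [s n] has finitely many values, so one discretization of the kernel serves all of them. Dividing
   by [b + 1] keeps the total L1 error below [mesh R n]. *)
have unif n : exists m, forall t, 0 <= t <= b ->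
    N (L t (s n t) - L (grid m (idx m t)) (s n t)) <= mesh R n / (b + 1).
  suff [m hm] : exists m, forall x, x \in vals (s n) -> forall m' t, (m <= m')%N -> 0 <= t <= b ->
      N (L t x - L (grid m' (idx m' t)) x) <= mesh R n / (b + 1).
    by exists m => t tb; apply: (hm _ (mem_vals t (fs n))).
  elim: (vals (s n)) => [|x r [m hm]]; first by exists 0%N.
  have [|m1 h1] := step_close b0 (Lcnt x) (e := mesh R n / (b + 1)).
    by rewrite divr_gt0// mesh_gt0.
  exists (maxn m m1) => y; rewrite in_cons => /orP[/eqP ->|yr] m' t.
    by rewrite geq_max => /andP[_ ?] ?; exact: h1.
  by rewrite geq_max => /andP[? _] ?; exact: hm.
have [m hm] := choice unif.
pose s' n t := L (grid (m n) (idx (m n) t)) (s n t).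
have fs' n : simple_function (s' n).
  have fp := finitely_valued_pair (finitely_valued_idx (m n)) (fs n).
  exact: (finitely_valued_comp (fun x => L (grid (m n) x.1) x.2) fp).
have close n t : 0 <= t <= b -> N (L t (u t) - s' n t) <= c * N (u t - s n t) + mesh R n / (b + 1).
  move=> tb; rewrite (le_trans (rdistD (L t (s n t)) _ _))// lerD//; last exact: hm.
  by rewrite -LB Lc.
have pu : strongly_measurable `[0, b] u.
  by exists s; split=> // t; rewrite /= in_itv/=; exact: su.
have pLu : strongly_measurable `[0, b] (fun t => L t (u t)).
  exists s'; split=> // t; rewrite /= in_itv/= => tb; apply/cvgn_rnormP => e e0.
  have e20 : 0 < e / 2 by rewrite divr_gt0.
  have ec : 0 < e / 2 / (c + 1) by rewrite divr_gt0.
  have /cvgn_rnormP/(_ _ ec)[n1 h1] := su t tb.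
  have [n2 h2] := mesh_small e20.
  exists (maxn n1 n2) => n; rewrite geq_max => /andP[/h1 hn1 /h2 hn2].
  rewrite rdistC (le_lt_trans (close n t tb))// (splitr e) ler_ltD//.
    rewrite (@le_trans _ _ ((c + 1) * N (u t - s n t)))//; first by rewrite ler_wpM2r//; lra.
    by rewrite mulrC -ler_pdivlMr// rdistC ltW.
  apply: le_lt_trans hn2; rewrite ler_pdivrMr// ler_peMr ?(ltW (mesh_gt0 _ _))//; lra.
have [|v bv _] := bochner_of_simple pLu fs'; last by exists v.
move=> e e0; have e20 : 0 < e / 2 by rewrite divr_gt0.
have ec : 0 < e / 2 / (c + 1) by rewrite divr_gt0.
have [n1 h1] := hsu _ ec; have [n2 h2] := mesh_small e20.
exists (maxn n1 n2) => n; rewrite geq_max => /andP[/h1 hn1 /h2 hn2].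
have us := sm_sub pu (sm_simple `[0, b]%classic (fs n)).
apply: (@le_trans _ _ (\int[mu]_(t in `[0%R, b])
    ((c%:E * (N (u t - s n t))%:E) + cst (mesh R n / (b + 1))%:E t))%E).
  apply: ge0_le_integral => //.
  - by move=> t _; rewrite lee_fin.
  - by apply: sm_norm_emeasurable; apply: sm_sub pLu (sm_simple _ (fs' n)).
  - apply: emeasurable_funD; last exact: measurable_cst.
    by apply: measurable_funeM; exact: sm_norm_emeasurable.
  - by move=> t; rewrite /= in_itv/= => tb; rewrite -EFinM -EFinD lee_fin close.
have m0 : 0 <= mesh R n / (b + 1) by rewrite divr_ge0// ltW// mesh_gt0.
rewrite ge0_integralD//; last 2 first.
- by move=> t _; rewrite -EFinM lee_fin mulr_ge0.
- by apply: measurable_funeM; exact: sm_norm_emeasurable.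
rewrite ge0_integralZl_EFin//; last 2 first.
- by move=> t _; rewrite lee_fin.
- exact: sm_norm_emeasurable.
rewrite integral_cst//= lebesgue_measure_itv/= lte_fin.
rewrite [e%:E](_ : _ = (e / 2)%:E + (e / 2)%:E)%E; last by rewrite -EFinD -splitr.
apply: leeD.
  apply: (@le_trans _ _ (c%:E * (e / 2 / (c + 1))%:E)%E).
    by apply: lee_pmul => //; rewrite ?lee_fin//; exact: L1_ge0.
  rewrite -EFinM lee_fin mulrCA ler_piMr ?ltW// ltr_pdivrMr//; lra.
have -> : ((mesh R n / (b + 1))%:E * (if (0 < b)%R then b%:E + (- 0%R)%:E else 0) = (mesh R n / (b + 1) * b)%:E)%E.
  case: ltP => h; first by rewrite -EFinD subr0 -EFinM.
  by have -> : b = 0 by lra; rewrite mulr0 mule0.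
rewrite lee_fin mulrAC ler_pdivrMr// (@le_trans _ _ (e / 2 * b))//.
  by rewrite ler_wpM2r// ltW.
by rewrite ler_wpM2l ?(ltW e20)//; lra.
Qed.

End StepFunctions.

(** * Uniform boundedness *)

Section UniformBoundedness.
Context (R : realType) (k : scalar_kind).
Local Notation K := (scalars k R).
Local Notation r2K := (@of_real k R).
Local Notation N := rnorm.

(** The infimum of the admissible constants is itself admissible, and any smaller multiple of it
    fails somewhere. The ratio [2 / 3] exceeds the [1 / 2] lost to the tail in [uniform_bound]. *)
Lemma op_bound (V : Type) (S : set V) (nrm tau : V -> R) : (forall x, 0 <= nrm x) ->
  (exists2 c : R, 0 <= c & forall x, S x -> tau x <= c * nrm x) ->
  exists2 c : R, 0 <= c & (forall x, S x -> tau x <= c * nrm x) /\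
    (0 < c -> exists2 x, S x & 2 / 3 * c * nrm x < tau x).
Proof.
move=> nrm0 [c0 c00 hc0].
pose E := [set c : R | 0 <= c /\ forall x, S x -> tau x <= c * nrm x].
have hE : has_inf E by split; [exists c0|exists 0 => c []].
have i0 : 0 <= inf E by apply: lb_le_inf; [exact: hE.1|move=> c []].
have hi : forall x, S x -> tau x <= inf E * nrm x.
  move=> x Sx; have [x0|x0] := eqVneq (nrm x) 0.
    by rewrite x0 mulr0; have := hc0 x Sx; rewrite x0 mulr0.
  have xp : 0 < nrm x by rewrite lt_neqAle eq_sym x0 nrm0.
  rewrite -ler_pdivrMr//; apply: lb_le_inf; first exact: hE.1.
  by move=> c [_ hc]; rewrite ler_pdivrMr// hc.
exists (inf E) => //; split=> // ip; apply: contrapT => hn.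
have : inf E <= 2 / 3 * inf E; last by lra.
apply: ge_inf; first exact: hE.2.
split; first by rewrite mulr_ge0.
by move=> x Sx; rewrite leNgt; apply/negP => h; apply: hn; exists x.
Qed.

(* Sokal's gliding hump, with signs chosen so that the partial sums do not
   cancel; [S] is only required to be complete along the series it uses. *)
Lemma uniform_bound (V : lmodType K) (S : set V) (nrm : V -> R) (I : Type) (tau : I -> V -> R) :
  S 0 -> (forall x y, S x -> S y -> S (x + y)) -> (forall a x, S x -> S (r2K a *: x)) ->
  (forall x, 0 <= nrm x) -> (forall a x, S x -> nrm (r2K a *: x) = `|a| * nrm x) ->
  (forall i x, 0 <= tau i x) ->
  (forall i x y, S x -> S y -> tau i (x + y) <= tau i x + tau i y) ->
  (forall i a x, S x -> tau i (r2K a *: x) = `|a| * tau i x) ->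
  (forall i, exists2 c : R, 0 <= c & forall x, S x -> tau i x <= c * nrm x) ->
  (forall xi : nat -> V, (forall n, S (xi n) /\ nrm (xi n) <= 3^-1 ^+ n) ->
     exists B : R, forall i C m, 0 <= C -> (forall x, S x -> tau i x <= C * nrm x) ->
       tau i (\sum_(j < m) xi j) <= B + C * (3 / 2 * 3^-1 ^+ m)) ->
  exists2 C : R, 0 <= C & forall i x, S x -> tau i x <= C * nrm x.
Proof.
move=> S0 SD SZ nrm0 nrmZ tau0 tauD tauZ taub compl.
apply: contrapT => hn.
have bad (C : R) : 0 <= C -> exists i, exists2 x, S x & C * nrm x < tau i x.
  move=> C0; apply: contrapT => h; apply: hn; exists C => // i x Sx.
  by rewrite leNgt; apply/negP => hx; apply: h; exists i, x.
have SB x y : S x -> S y -> S (x - y).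
  move=> Sx Sy; apply: SD => //; have := SZ (-1) y Sy.
  by rewrite of_realN of_real1 scaleN1r.
(* The constants grow at least like [4 ^+ n] while the vectors shrink like [3^-1 ^+ n], so the
   values of [tau] are unbounded. *)
have choose n : exists ix : I * V * R, [/\ S ix.1.2, nrm ix.1.2 = 3^-1 ^+ n, 4 ^+ n <= ix.2,
    (forall x, S x -> tau ix.1.1 x <= ix.2 * nrm x) &
    2 / 3 * ix.2 * 3^-1 ^+ n <= tau ix.1.1 ix.1.2].
  have [i [x Sx hx]] := bad (4 ^+ n) (exprn_ge0 _ (ler0n _ _)).
  have [c c0 [hc hc']] := op_bound nrm0 (taub i).
  have nx : 0 < nrm x.
    rewrite lt_neqAle nrm0 andbT eq_sym; apply/negP => /eqP x0.
    by have := hc x Sx; rewrite x0 mulr0 leNgt; move: hx; rewrite x0 mulr0 => ->.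
  have cn : 4 ^+ n < c.
    by rewrite -(ltr_pM2r nx); apply: lt_le_trans hx _; exact: hc.
  have cp : 0 < c by rewrite (le_lt_trans _ cn)// exprn_ge0.
  have [y Sy hy] := hc' cp.
  have ny : 0 < nrm y.
    rewrite lt_neqAle nrm0 andbT eq_sym; apply/negP => /eqP y0.
    by have := hc y Sy; rewrite y0 mulr0 leNgt; move: hy; rewrite y0 mulr0 => ->.
  have p3 : 0 < (3^-1 : R) ^+ n by rewrite exprn_gt0// invr_gt0.
  exists (i, r2K (3^-1 ^+ n / nrm y) *: y, c); split=> //=.
  - exact: SZ.
  - by rewrite nrmZ// ger0_norm ?divfK// ?gt_eqF// divr_ge0// ltW.
  - exact: ltW.
  - rewrite tauZ// ger0_norm; last by rewrite divr_ge0// ltW.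
    rewrite (_ : 2 / 3 * c * 3^-1 ^+ n = 3^-1 ^+ n / nrm y * (2 / 3 * c * nrm y)).
      by rewrite ler_pM2l ?divr_gt0// ltW.
    by set p := 3^-1 ^+ n; field; rewrite gt_eqF.
have [ix hix] := choice choose.
pose i n := (ix n).1.1; pose xi n := (ix n).1.2; pose c n := (ix n).2.
have Sxi n : S (xi n) by have [] := hix n.
(* Twice [xi n] is the difference of [x + xi n] and [x - xi n], so one of the two signs gives [tau]
   a value at least [tau (i n) (xi n)]. *)
pose nxt n x := if tau (i n) (xi n) <= tau (i n) (x + xi n) then x + xi n else x - xi n.
pose y := fix y n := if n is m.+1 then nxt m (y m) else 0.
have Sy n : S (y n).
  elim: n => [|n IH] //=; rewrite /nxt; case: ifP => _; [exact: SD|exact: SB].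
have ytau n : tau (i n) (xi n) <= tau (i n) (y n.+1).
  rewrite /= /nxt; case: ifPn => // h; rewrite -ltNge in h.
  have := tauD (i n) _ _ (SD _ _ (Sy n) (Sxi n)) (SZ (-1) _ (SB _ _ (Sy n) (Sxi n))).
  rewrite tauZ; last exact: SB.
  rewrite of_realN of_real1 scaleN1r normrN1 mul1r.
  have -> : y n + xi n - (y n - xi n) = r2K 2 *: xi n.
    rewrite (_ : 2 = 1 + 1)// of_realD of_real1 scalerDl scale1r; zmod.
  by rewrite tauZ// ger0_norm//; lra.
pose eta n := y n.+1 - y n.
have ysum n : \sum_(j < n) eta j = y n.
  elim: n => [|n IH]; first by rewrite big_ord0.
  by rewrite big_ord_recr/= IH /eta; zmod.
have [|B hB] := compl eta.
  move=> n; split; first exact: SB.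
  have [_ + _ _ _] := hix n; rewrite -/(xi n) => <-.
  rewrite /eta /= /nxt; case: ifP => _.
    by rewrite (_ : _ - _ = xi n)//; zmod.
  rewrite (_ : _ - _ = r2K (-1) *: xi n); first by rewrite nrmZ// normrN1 mul1r.
  by rewrite of_realN of_real1; zmod.
(* The tail beyond [n] costs at most half of [c n * 3^-1 ^+ n], since [3 / 2 * 3^-1 = 1 / 2],
   against a gain of [2 / 3]; the margin [1 / 6] gives the factor 6. *)
have key n : c n * 3^-1 ^+ n <= 6 * B.
  have [_ _ c4 hc h] := hix n; rewrite -/(c n) -/(i n) -/(xi n) in c4 hc h.
  have cn0 : 0 <= c n by apply: le_trans c4; exact: exprn_ge0.
  have := hB (i n) (c n) n.+1 cn0 hc; rewrite ysum => h1.
  have := le_trans (ytau n) h1; have := h; rewrite exprS => h2 h3.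
  have := le_trans h2 h3; move: (3^-1 ^+ n) (c n) => p q; lra.
have key2 n : (4 / 3) ^+ n <= 6 * B.
  have [_ _ c4 _ _] := hix n; apply: le_trans (key n).
  by rewrite exprMn exprVn -exprVn ler_wpM2r// exprn_ge0// invr_ge0.
have bern n : 1 + n%:R / 3 <= (4 / 3 : R) ^+ n.
  elim: n => [|n IH]; first by rewrite mul0r addr0.
  have p0 : 0 <= (n%:R : R) by [].
  rewrite exprS -natr1; lra.
(* By Bernoulli's inequality [(4 / 3) ^+ n] exceeds [6 * B] as soon as [n > 18 * B]. *)
have := le_trans (bern (Num.truncn (18 * B)).+1) (key2 _).
have := truncnS_gt (18 * B); lra.
Qed.

Lemma geometric_tail (r : R) m n : 0 <= r < 1 ->
  \sum_(i < n) r ^+ (m + i) <= (1 - r)^-1 * r ^+ m.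
Proof.
move=> /andP[r0 r1]; have r1' : 0 < 1 - r by rewrite subr_gt0.
have -> : \sum_(i < n) r ^+ (m + i) = (1 - r)^-1 * r ^+ m * (1 - r ^+ n).
  elim: n => [|n IH]; first by rewrite big_ord0 expr0 subrr mulr0.
  by rewrite big_ord_recr/= IH exprD exprS; field; rewrite gt_eqF.
by rewrite ler_piMr ?mulr_ge0 ?exprn_ge0 ?invr_ge0 ?(ltW r1')// gerBl exprn_ge0.
Qed.

Lemma geometric_series_cvg (V : completeNormedModType K) (xi : nat -> V) (r C : R) :
  0 <= r < 1 -> 0 <= C -> (forall n, N (xi n) <= C * r ^+ n) ->
  exists l : V, forall m, N (l - \sum_(j < m) xi j) <= C * ((1 - r)^-1 * r ^+ m).
Proof.
move=> r01 C0 hxi; pose x m := \sum_(j < m) xi j; have /andP[r0 r1] := r01.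
have tail m n : N (x (m + n)%N - x m) <= C * ((1 - r)^-1 * r ^+ m).
  rewrite /x big_split_ord /= addrAC subrr add0r.
  rewrite (le_trans (rnorm_sum _ _ _))// (le_trans _ (ler_wpM2l C0 (geometric_tail m n r01)))//.
  by rewrite mulr_sumr; apply: ler_sum.
have small (e : R) : 0 < e -> exists n0, forall n, (n0 <= n)%N -> C * ((1 - r)^-1 * r ^+ n) < e.
  move=> e0; have c1 : 0 < C * (1 - r)^-1 + 1.
    by rewrite ltr_wpDl// mulr_ge0// invr_ge0 subr_ge0 ltW.
  have /cvgrPdist_lt/(_ _ (divr_gt0 e0 c1))[n0 _ h] : r ^+ n @[n --> \oo] --> (0 : R).
    by apply: cvg_expr; rewrite ger0_norm.
  exists n0 => n /h /=; rewrite sub0r normrN ger0_norm ?exprn_ge0// ltr_pdivlMr// mulrA.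
  by apply: le_lt_trans; rewrite mulrC ler_wpM2l ?exprn_ge0// lerDl.
have [l hl] : exists l : V, x @ \oo --> l.
  apply: rnorm_cauchy_cvg => e e0; have e20 : 0 < e / 2 by rewrite divr_gt0.
  have [n0 h0] := small _ e20; exists n0 => n m hn hm.
  rewrite (le_lt_trans (rdistD (x n0) _ _))// (splitr e) ltrD//.
    by rewrite -(subnKC hn) (le_lt_trans (tail _ _))// h0.
  by rewrite rdistC -(subnKC hm) (le_lt_trans (tail _ _))// h0.
exists l => m.
apply: (@rnorm_lim_le _ _ _ (fun n => x n - x m)).
  by apply: cvgB => //; exact: cvg_cst.
by exists m => n mn; rewrite -(subnKC mn).
Qed.

Lemma series3_cvg (V : completeNormedModType K) (xi : nat -> V) :
  (forall n, N (xi n) <= 3^-1 ^+ n) ->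
  exists l : V, forall m, N (l - \sum_(j < m) xi j) <= 3 / 2 * 3^-1 ^+ m.
Proof.
move=> h; have r3 : 0 <= (3^-1 : R) < 1 by rewrite invr_ge0 invf_lt1 ?ltr0n ?ltr1n// ler0n.
have [|l hl] := @geometric_series_cvg V xi _ 1 r3 ler01; first by move=> n; rewrite mul1r.
by exists l => m; rewrite (le_trans (hl m))// mul1r (_ : (1 - 3^-1)^-1 = 3 / 2)//; field.
Qed.

Lemma banach_steinhaus (X Y : completeNormedModType K) (I : Type) (L : I -> X -> Y) :
  (forall i x y, L i (x + y) = L i x + L i y) ->
  (forall i a x, L i (r2K a *: x) = r2K a *: L i x) ->
  (forall i, exists2 c : R, 0 <= c & forall x, N (L i x) <= c * N x) ->
  (forall x, exists B : R, forall i, N (L i x) <= B) ->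
  exists2 C : R, 0 <= C & forall i x, N (L i x) <= C * N x.
Proof.
move=> LD LZ Lb Lp.
suff [C C0 hC] : exists2 C : R, 0 <= C & forall i x, setT x -> N (L i x) <= C * N x.
  by exists C => // i x; exact: hC.
apply: (@uniform_bound X setT (@rnorm k R X) I (fun i x => N (L i x))) => //.
- by move=> a x _; rewrite rnormZr.
- by move=> i x y _ _; rewrite LD rnormD.
- by move=> i a x _; rewrite LZ rnormZr.
- by move=> i; have [c c0 hc] := Lb i; exists c => // x _.
- move=> xi hxi; have [|l hl] := @series3_cvg X xi; first by move=> n; have [] := hxi n.
  have [B hB] := Lp l; exists B => i c m c0 hc.
  have -> : \sum_(j < m) xi j = l + (\sum_(j < m) xi j - l) by zmod.
  rewrite LD (le_trans (rnormD _ _))// lerD// (le_trans (hc _ Logic.I))//.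
  by rewrite ler_wpM2l// rdistC.
Qed.

End UniformBoundedness.

(** * Exponential weights *)

Section Exponential.
Context (R : realType) (k : scalar_kind).
Local Notation K := (scalars k R).
Local Notation r2K := (@of_real k R).
Local Notation N := rnorm.
Implicit Types V : completeNormedModType K.

(** Both bounds come from [1 + x <= expR x], used at [h] and at [- h]; the latter gives
    [expR h * (1 - h) <= 1], and the claim is tested after multiplication by [1 - h > 0]. *)
Lemma expR_quadratic (h : R) : `|h| <= 1 / 2 -> `|expR h - 1 - h| <= 2 * h ^+ 2.
Proof.
rewrite ler_norml => /andP[h1 h2].
have e1 := expR_ge1Dx h; have e2 := expR_ge1Dx (- h).
have e0 := expR_gt0 h; have : expR h * (1 - h) <= 1.
  by rewrite -[leRHS](expRxMexpNx_1 h) ler_wpM2l// ltW.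
rewrite ger0_norm; last by lra.
have q0 : 0 <= h ^+ 2 by rewrite sqr_ge0.
move=> h3; rewrite -subr_ge0.
have : 0 <= (2 * h ^+ 2 - (expR h - 1 - h)) * (1 - h).
  have : h ^+ 2 * (1 - 2 * h) >= 0 by rewrite mulr_ge0//; lra.
  rewrite expr2; nra.
by rewrite pmulr_lge0//; lra.
Qed.

Lemma rder_expR (D : set R) (c : R) : rder D (fun t => expR (c * t)) (fun t => c * expR (c * t)).
Proof.
move=> t Dt e e0; have c1 : 0 < 1 + `|c| by rewrite ltr_pwDl.
have E0 := expR_gt0 (c * t).
pose q := 1 + 2 * expR (c * t) * (1 + `|c|) ^+ 2.
have q0 : 0 < q by rewrite ltr_pwDl// !mulr_ge0// ?exprn_ge0// ltW.
exists (Num.min (1 / 2 / (1 + `|c|)) (e / q)).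
  by rewrite lt_min !divr_gt0.
move=> s _; rewrite lt_min => /andP[h1 h2].
have cs : `|c * (s - t)| <= (1 + `|c|) * `|s - t|.
  by rewrite normrM ler_wpM2r// lerDr.
have -> : expR (c * s) - expR (c * t) - (s - t) * (c * expR (c * t)) =
    expR (c * t) * (expR (c * (s - t)) - 1 - c * (s - t)).
  rewrite (_ : c * s = c * t + c * (s - t)); last by ring.
  by rewrite expRD; ring.
rewrite normrM (gtr0_norm E0).
have := @expR_quadratic (c * (s - t)).
have -> : `|c * (s - t)| <= 1 / 2.
  by rewrite (le_trans cs)// mulrC -ler_pdivlMr// ltW.
move=> /(_ isT); rewrite -(ler_pM2l E0) => /le_trans; apply.
rewrite -[(c * (s - t)) ^+ 2]ger0_norm ?sqr_ge0// normrX.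
apply: (@le_trans _ _ (q * `|s - t| * `|s - t|)).
  apply: (@le_trans _ _ (expR (c * t) * (2 * ((1 + `|c|) * `|s - t|) ^+ 2))).
    by rewrite ler_pM2l// ler_wpM2l// lerXn2r// nnegrE mulr_ge0// ltW.
  have -> : q * `|s - t| * `|s - t| =
     expR (c * t) * (2 * ((1 + `|c|) * `|s - t|) ^+ 2) + `|s - t| ^+ 2 by rewrite /q; ring.
  by rewrite lerDl sqr_ge0.
by rewrite ler_wpM2r// mulrC -ler_pdivlMr// ltW.
Qed.

Lemma der_scale (D : set R) V (g g' : R -> R) (f f' : R -> V) : rder D g g' -> der D f f' ->
  der D (fun t => r2K (g t) *: f t) (fun t => r2K (g' t) *: f t + r2K (g t) *: f' t).
Proof.
move=> dg df t Dt e e0.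
have G0 : 0 < 1 + `|g t| + `|g' t| by rewrite -addrA ltr_pwDl// addr_ge0.
pose q := 1 + `|g t| + `|g' t| + (1 + `|g' t|) * N (f' t) + N (f t).
have q1 : 1 <= q by rewrite /q -!addrA lerDl !addr_ge0// mulr_ge0// addr_ge0.
have q0 : 0 < q by rewrite (lt_le_trans ltr01).
have eq0 : 0 < e / 3 / q by rewrite !divr_gt0.
have [d1 d10 h1] := df t Dt _ eq0.
have [d2 d20 h2] := dg t Dt _ eq0.
have [d3 d30 h3] := dg t Dt _ ltr01.
exists (Num.min (Num.min 1 (e / 3 / q)) (Num.min d1 (Num.min d2 d3))).
  by rewrite !lt_min ltr01 eq0 d10 d20.
move=> s Ds; rewrite !lt_min => /andP[/andP[s1 se] /and3P[sd1 sd2 sd3]].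
have {}h1 := h1 s Ds sd1; have {}h2 := h2 s Ds sd2; have {}h3 := h3 s Ds sd3.
have gd : `|g s - g t| <= (1 + `|g' t|) * `|s - t|.
  have -> : g s - g t = (g s - g t - (s - t) * g' t) + (s - t) * g' t by ring.
  rewrite [leRHS](_ : _ = 1 * `|s - t| + `|s - t| * `|g' t|); last by ring.
  by rewrite (le_trans (ler_normD _ _))// lerD// normrM.
have gs : `|g s| <= 1 + `|g t| + `|g' t|.
  have -> : g s = g t + (g s - g t) by ring.
  rewrite [leRHS](_ : _ = `|g t| + (1 + `|g' t|)); last by ring.
  rewrite (le_trans (ler_normD _ _))// lerD2l (le_trans gd)// ler_piMr ?addr_ge0// ltW //.
have -> : r2K (g s) *: f s - r2K (g t) *: f t -
    r2K (s - t) *: (r2K (g' t) *: f t + r2K (g t) *: f' t) =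
  r2K (g s) *: (f s - f t - r2K (s - t) *: f' t) + r2K ((s - t) * (g s - g t)) *: f' t +
  r2K (g s - g t - (s - t) * g' t) *: f t.
  set d := s - t; rewrite !(of_realB, of_realM) !mulrBr.
  by rewrite (scalerBr (r2K (g s))) (scalerA (r2K (g s))) (mulrC (r2K (g s))); zmod.
apply: (@le_trans _ _ ((1 + `|g t| + `|g' t|) * (e / 3 / q * `|s - t|) +
    (1 + `|g' t|) * `|s - t| * (e / 3 / q) * N (f' t) + e / 3 / q * `|s - t| * N (f t))).
  rewrite (le_trans (rnormD _ _))// lerD//; last by rewrite rnormZr ler_wpM2r.
  rewrite (le_trans (rnormD _ _))// lerD//.
    by rewrite rnormZr ler_pM.
  by rewrite rnormZr ler_wpM2r// normrM mulrC ler_pM// ltW.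
have -> : (1 + `|g t| + `|g' t|) * (e / 3 / q * `|s - t|) +
    (1 + `|g' t|) * `|s - t| * (e / 3 / q) * N (f' t) + e / 3 / q * `|s - t| * N (f t) =
    e / 3 / q * `|s - t| * q by rewrite {5}/q; ring.
by rewrite mulrAC divfK ?gt_eqF// ler_wpM2r// ler_pdivrMr// ler_peMr ?ler1n// ltW.
Qed.

Lemma rder_cntK (D : set R) V (g g' : R -> R) (f : R -> V) : rder D g g' -> cnt D f ->
  cnt D (fun t => r2K (g t) *: f t).
Proof.
move=> dg cf t Dt e e0.
pose q := 1 + `|g t| + (1 + `|g' t|) * (1 + N (f t)).
have q0 : 0 < q by rewrite /q -!addrA ltr_pwDl// !addr_ge0// mulr_ge0// addr_ge0.
have q20 : 0 < e / q / 2 by rewrite !divr_gt0.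
have [d1 d10 h1] := cf t Dt _ q20.
have [d3 d30 h3] := dg t Dt _ ltr01.
exists (Num.min (Num.min 1 (e / q / 2)) (Num.min d1 d3)).
  by rewrite !lt_min ltr01 d10 q20.
move=> s Ds; rewrite !lt_min => /andP[/andP[s1 se] /andP[sd1 sd3]].
have {}h1 := h1 s Ds sd1; have {}h3 := h3 s Ds sd3.
have gd : `|g s - g t| <= (1 + `|g' t|) * `|s - t|.
  have -> : g s - g t = (g s - g t - (s - t) * g' t) + (s - t) * g' t by ring.
  rewrite [leRHS](_ : _ = 1 * `|s - t| + `|s - t| * `|g' t|); last by ring.
  by rewrite (le_trans (ler_normD _ _))// lerD// normrM.
have gs : `|g s| <= 1 + `|g t| + `|g' t|.
  have -> : g s = g t + (g s - g t) by ring.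
  rewrite [leRHS](_ : _ = `|g t| + (1 + `|g' t|)); last by ring.
  rewrite (le_trans (ler_normD _ _))// lerD2l (le_trans gd)// ler_piMr ?addr_ge0// ltW //.
have -> : r2K (g s) *: f s - r2K (g t) *: f t =
  r2K (g s) *: (f s - f t) + r2K (g s - g t) *: f t by rewrite of_realB; zmod.
apply: (@le_trans _ _ ((1 + `|g t| + `|g' t|) * (e / q / 2) + (1 + `|g' t|) * (e / q / 2) * N (f t))).
  rewrite (le_trans (rnormD _ _))// lerD//.
    by rewrite rnormZr ler_pM.
  rewrite rnormZr ler_wpM2r// (le_trans gd)// ler_wpM2l ?addr_ge0// ltW//.
have -> : (1 + `|g t| + `|g' t|) * (e / q / 2) + (1 + `|g' t|) * (e / q / 2) * N (f t) =
  (e / q / 2) * (q - 1) by rewrite {4}/q; ring.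
apply: (@le_trans _ _ (e / q / 2 * q)); first by rewrite ler_wpM2l ?(ltW q20)//; lra.
by rewrite mulrAC divfK ?gt_eqF// ler_pdivrMr// ler_peMr ?ler1n// ltW.
Qed.

End Exponential.

(** * Semigroups and resolvents *)

Section Semigroup.
Context (R : realType) (k : scalar_kind).
Local Notation K := (scalars k R).
Local Notation r2K := (@of_real k R).
Local Notation N := rnorm.
Variables (V : completeNormedModType K) (T : R -> {linear V -> V}).
Hypothesis hT : c0_semigroup T.

Lemma generatorP x y : generator T (x, y) <->
  (forall e : R, 0 < e -> exists2 d : R, 0 < d &
     forall h, 0 < h < d -> N (T h x - x - r2K h *: y) <= e * h).
Proof.
have eqN (h : R) : 0 < h -> N (T h x - x - r2K h *: y) = N (r2K h^-1 *: (T h x - x) - y) * h.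
  move=> h0; rewrite mulrC -[h in h * _]gtr0_norm// -rnormZr scalerBr scalerA -of_realM.
  by rewrite divff ?gt_eqF// of_real1 scale1r.
rewrite /generator /= cvg_at_right0_rnormP; split=> H e e0.
  have [d d0 hd] := H e e0; exists d => // h /[dup] /andP[h0 _] /hd h1.
  by rewrite eqN// ler_wpM2r// ltW.
have [|d d0 hd] := H (e / 2); first by rewrite divr_gt0.
exists d => // h /[dup] /andP[h0 _] /hd; rewrite eqN// ler_pM2r// => /le_lt_trans; apply.
by rewrite ltr_pdivrMr// ltr_pMr// ltr1n.
Qed.

Lemma sg_strong x (e : R) : 0 < e -> exists2 d : R, 0 < d &
  forall h, 0 <= h < d -> N (T h x - x) <= e.
Proof.
move=> e0; have /cvg_at_right0_rnormP/(_ _ e0)[d d0 hd] := @c0_strong _ _ _ _ hT x.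
exists d => // h /andP[]; rewrite le_eqVlt => /orP[/eqP <- _|h0 hd'].
  by rewrite (c0_id hT) subrr rnorm0 ltW.
by rewrite ltW// hd// h0.
Qed.

Lemma sg_bounded_at t : 0 <= t -> exists2 c : R, 0 <= c & forall x, N (T t x) <= c * N x.
Proof. by move=> t0; apply/continuous_linearP; exact: c0_bounded. Qed.

(** Otherwise there are times [t_n <= mesh n] at which the norm of [T] exceeds [n.+1]. Strong
    continuity at 0 bounds these operators pointwise, up to finitely many terms, which contradicts
    [banach_steinhaus]. *)
Lemma sg_local_bound : exists d C : R, [/\ 0 < d, 1 <= C &
  forall t x, 0 <= t <= d -> N (T t x) <= C * N x].
Proof.
apply: contrapT => hn.
have bad n : exists tx : R * V, 0 <= tx.1 <= mesh R n /\ n.+1%:R * N tx.2 < N (T tx.1 tx.2).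
  apply: contrapT => h; apply: hn; exists (mesh R n), n.+1%:R; split.
  - exact: mesh_gt0.
  - by rewrite ler1n.
  - by move=> t x tn; rewrite leNgt; apply/negP => hx; apply: h; exists (t, x).
have [tx htx] := choice bad.
have [||||C C0 hC] := @banach_steinhaus R k V V nat (fun n => T (tx n).1).
- by move=> n x y; rewrite linearD.
- by move=> n a x; rewrite linearZ.
- by move=> n; apply: sg_bounded_at; have [/andP[]] := htx n.
- move=> x; have [d d0 hd] := sg_strong x ltr01; have [n0 h0] := mesh_small d0.
  exists (1 + N x + \sum_(i < n0) N (T (tx i).1 x)) => n.
  have s0 : 0 <= \sum_(i < n0) N (T (tx i).1 x) by apply: sumr_ge0.
  have [nn|nn] := leqP n0 n.
    have [/andP[t0 t1] _] := htx n.
    have := hd (tx n).1; rewrite t0 (le_lt_trans t1 (h0 n nn)) => /(_ isT) h.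
    have := rnorm_split x (T (tx n).1 x); lra.
  rewrite (bigD1 (Ordinal nn))//= addrCA lerDl !addr_ge0//.
  by apply: sumr_ge0.
have [_ h] := htx (Num.truncn C); have := hC (Num.truncn C) (tx (Num.truncn C)).2.
move=> /(lt_le_trans h); rewrite ltNge => /negP; apply.
by rewrite ler_wpM2r// ltW// truncnS_gt.
Qed.

Lemma sg_growth : exists M w : R, [/\ 1 <= M, 0 <= w &
  forall t x, 0 <= t -> N (T t x) <= M * expR (w * t) * N x].
Proof.
have [d [C [d0 C1 hC]]] := sg_local_bound.
have C0 : 0 < C by rewrite (lt_le_trans ltr01).
have ind n t x : 0 <= t <= n.+1%:R * d -> N (T t x) <= C ^+ n.+1 * N x.
  elim: n t x => [|n IH] t x; first by rewrite mul1r expr1; exact: hC.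
  move=> /andP[t0 tn]; have [td|dt] := leP t d.
    rewrite (le_trans (hC t x _)) ?t0//; rewrite ler_wpM2r// exprS ler_peMr ?(ltW C0)//.
    by rewrite exprn_ege1.
  have -> : t = d + (t - d) by ring.
  rewrite (c0_add hT) ?(ltW d0) ?subr_ge0 ?(ltW dt)//.
  rewrite (le_trans (hC _ _ _)) ?lexx ?(ltW d0)//.
  rewrite exprS -mulrA ler_wpM2l ?(ltW C0)// IH// subr_ge0 (ltW dt)/=.
  by move: tn; rewrite -natr1; lra.
(* With [n] the integer part of [t / d], [C ^+ n.+1] is [C] times the exponential of [n * ln C], and
   [n * ln C <= ln C / d * t]. *)
exists C, (ln C / d); split=> //; first by rewrite divr_ge0 ?ln_ge0// ltW.
move=> t x t0; have td0 : 0 <= t / d by rewrite divr_ge0// ltW.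
have /andP[h1 h2] := truncn_itv td0; set n := Num.truncn _ in h1 h2.
apply: (le_trans (ind n t x _)).
  by rewrite t0 /= -ler_pdivrMr// ltW.
rewrite ler_wpM2r// exprS ler_wpM2l ?(ltW C0)//.
rewrite -[X in X ^+ n](lnK C0) -expRM_natl ler_expR mulrAC -mulrA mulrC.
by rewrite ler_wpM2l ?ln_ge0.
Qed.

Lemma sg_bound b : exists2 C : R, 1 <= C & forall t x, 0 <= t <= b -> N (T t x) <= C * N x.
Proof.
have [M [w [M1 w0 h]]] := sg_growth; have M0 : 0 <= M by exact: le_trans M1.
exists (M * expR (w * `|b|)).
  by rewrite (le_trans M1)// ler_peMr// -expR0 ler_expR mulr_ge0.
move=> t x /andP[t0 tb]; rewrite (le_trans (h t x t0))// ler_wpM2r// ler_wpM2l// ler_expR.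
by rewrite ler_wpM2l// (le_trans tb)// ler_norm.
Qed.

Lemma orbit_cnt x : cnt half (fun t => T t x).
Proof.
move=> t t0 e e0; have [C C1 hC] := sg_bound (t + 1).
have C0 : 0 < C by rewrite (lt_le_trans ltr01).
have [|d d0 hd] := sg_strong x (e := e / C); first by rewrite divr_gt0.
exists (Num.min 1 d); first by rewrite lt_min ltr01.
move=> s s0; rewrite lt_min => /andP[s1 sd].
have [ts|st] := leP t s.
  rewrite ger0_norm ?subr_ge0// in s1 sd.
  have -> : s = t + (s - t) by ring.
  rewrite (c0_add hT) ?subr_ge0// -linearB (le_trans (hC _ _ _))//.
    by apply/andP; split=> //; lra.
  by rewrite mulrC -ler_pdivlMr// hd// subr_ge0 ts.
rewrite ltr0_norm ?subr_lt0// opprB in s1 sd.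
have -> : t = s + (t - s) by ring.
rewrite (c0_add hT) ?subr_ge0 ?(ltW st)// rdistC -linearB (le_trans (hC _ _ _))//.
  by apply/andP; split=> //; lra.
by rewrite mulrC -ler_pdivlMr// hd// subr_ge0 (ltW st).
Qed.

Lemma generator_der x y : generator T (x, y) -> der half (fun t => T t x) (fun t => T t y).
Proof.
move=> /generatorP g t t0 e e0; have [C C1 hC] := sg_bound (t + 1).
have C0 : 0 < C by rewrite (lt_le_trans ltr01).
have eC : 0 < e / C / 2 by rewrite !divr_gt0.
have [d d0 hd] := g _ eC; have [d' d'0 hd'] := sg_strong y eC.
exists (Num.min 1 (Num.min d d')); first by rewrite !lt_min ltr01 d0.
move=> s s0; rewrite !lt_min => /and3P[s1 sd sd'].
have ge h : 0 <= h < d -> N (T h x - x - r2K h *: y) <= e / C / 2 * h.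
  move=> /andP[]; rewrite le_eqVlt => /orP[/eqP <- _|h0 hd1]; last by rewrite hd ?h0.
  by rewrite (c0_id hT) of_real0 scale0r subrr subr0 rnorm0 mulr0.
have [ts|st] := leP t s.
  have r0 : 0 <= s - t by rewrite subr_ge0.
  rewrite ger0_norm// in s1 sd sd' *.
  have -> : T s x - T t x - r2K (s - t) *: T t y = T t (T (s - t) x - x - r2K (s - t) *: y).
    by rewrite !linearB [T t (_ *: _)]linearZ/= -(c0_add hT)// (addrC t) subrK.
  rewrite (le_trans (hC _ _ _))//; first by apply/andP; split=> //; lra.
  rewrite mulrC -ler_pdivlMr// (le_trans (ge _ _)) ?r0//.
  rewrite [leRHS]mulrAC ler_wpM2r// ler_pdivrMr// ler_peMr ?ler1n// ltW// divr_gt0//.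
(* For a left increment, [T t = T s T (t - s)] reduces to time 0, and [T t y] has to be exchanged
   for [T s y], which is the second error term. *)
have r0 : 0 <= t - s by rewrite subr_ge0 ltW.
rewrite ltr0_norm ?subr_lt0// opprB in s1 sd sd' *.
have tE (z : V) : T t z = T s (T (t - s) z) by rewrite -(c0_add hT)// (addrC s) subrK.
have -> : T s x - T t x - r2K (s - t) *: T t y =
    - T s (T (t - s) x - x - r2K (t - s) *: y) + r2K (t - s) *: T s (T (t - s) y - y).
  by rewrite !tE !linearB [T s (_ *: _)]linearZ /= -(opprB t s) of_realN; zmod.
rewrite [leRHS](_ : _ = e / 2 * (t - s) + (t - s) * (e / 2)); last by field.
have st1 : 0 <= s <= t + 1 by apply/andP; split=> //; lra.
have eE : e / 2 = C * (e / C / 2) by field; rewrite gt_eqF.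
rewrite (le_trans (rnormD _ _))// lerD//.
  rewrite rnormN (le_trans (hC _ _ st1))// eE -mulrA ler_wpM2l ?(ltW C0)//.
  by rewrite ge// r0.
rewrite rnormZr ger0_norm// ler_wpM2l// (le_trans (hC _ _ st1))// eE ler_wpM2l ?(ltW C0)//.
by rewrite hd'// r0.
Qed.

Lemma generator_T t x y : 0 <= t -> generator T (x, y) -> generator T (T t x, T t y).
Proof.
move=> t0 /generatorP g; apply/generatorP => e e0.
have [C C1 hC] := sg_bound t; have C0 : 0 < C by rewrite (lt_le_trans ltr01).
have [|d d0 hd] := g (e / C); first by rewrite divr_gt0.
exists d => // h /[dup] /andP[h0 _] hh.
have -> : T h (T t x) - T t x - r2K h *: T t y = T t (T h x - x - r2K h *: y).
  by rewrite !linearB [T t (_ *: _)]linearZ /= -!(c0_add hT) ?(ltW h0)// [h + t]addrC.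
rewrite (le_trans (hC _ _ _)) ?t0 ?lexx//.
by rewrite mulrC -ler_pdivlMr// mulrAC hd.
Qed.

Lemma generator_fun x y y' : generator T (x, y) -> generator T (x, y') -> y = y'.
Proof.
by move=> h h'; apply: (cvg_unique _ h h').
Qed.

Lemma generator_comb (c : K) x y x' y' : generator T (x, y) -> generator T (x', y') ->
  generator T (c *: x + x', c *: y + y').
Proof.
move=> /generatorP g /generatorP g'; apply/generatorP => e e0.
have c1 : 0 < 1 + absK c by rewrite ltr_pwDl// absK_ge0.
have [|d d0 hd] := g (e / 2 / (1 + absK c)); first by rewrite !divr_gt0.
have [|d' d'0 hd'] := g' (e / 2); first by rewrite !divr_gt0.
exists (Num.min d d'); first by rewrite lt_min d0.
move=> h /andP[h0]; rewrite lt_min => /andP[hhd hhd'].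
have -> : T h (c *: x + x') - (c *: x + x') - r2K h *: (c *: y + y') =
   c *: (T h x - x - r2K h *: y) + (T h x' - x' - r2K h *: y').
  by rewrite linearD [T h (_ *: _)]linearZ/= scalerDr (scalerA (r2K h)) (mulrC (r2K h)) -scalerA; zmod.
rewrite (le_trans (rnormD _ _))// (_ : e * h = e / 2 * h + e / 2 * h); last by field.
rewrite lerD//; last by rewrite hd'// h0.
rewrite rnormZ (@le_trans _ _ ((1 + absK c) * N (T h x - x - r2K h *: y)))//.
  by rewrite ler_wpM2r// lerDr.
by rewrite mulrC -ler_pdivlMr// mulrAC hd// h0.
Qed.

Lemma generator0 : generator T (0, 0).
Proof.
apply/generatorP => e e0; exists 1 => // h /andP[h0 _].
by rewrite linear0 scaler0 !subr0 rnorm0 mulr_ge0// ltW.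
Qed.

Lemma generatorZ (c : K) x y : generator T (x, y) -> generator T (c *: x, c *: y).
Proof. by move=> g; have := generator_comb (c:=c) g generator0; rewrite !addr0. Qed.

Lemma generatorD x y x' y' : generator T (x, y) -> generator T (x', y') ->
  generator T (x + x', y + y').
Proof. by move=> g g'; have := generator_comb (c:=1) g g'; rewrite !scale1r. Qed.

Lemma generatorB x y x' y' : generator T (x, y) -> generator T (x', y') ->
  generator T (x - x', y - y').
Proof.
move=> g g'; have := generator_comb (c:=-1) g' g.
by rewrite !scaleN1r ![- _ + _]addrC.
Qed.

Lemma generator_eq x y t : generator T (x, y) -> 0 <= t -> T t x - x = prim (fun s => T s y) t.
Proof.
move=> g t0; have := prim_unique (orbit_cnt y) (generator_der g) t0.
by rewrite (c0_id hT) => ->; rewrite addrC addKr.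
Qed.

Lemma prim_le (f : R -> V) (C t : R) : cnt half f -> 0 <= t ->
  (forall s, 0 <= s <= t -> N (f s) <= C) -> N (prim f t) <= C * t.
Proof.
move=> cf t0 h; have := @lip_of_der _ _ _ (prim f) f C 0 t t0.
rewrite prim0// !subr0; apply => //.
exact: der_sub (seg_half (lexx 0)) (der_prim cf).
Qed.

Lemma primB (f g : R -> V) t : cnt half f -> cnt half g -> 0 <= t ->
  prim (fun s => f s - g s) t = prim f t - prim g t.
Proof.
move=> cf cg t0.
have := prim_unique (cntB cf cg) (derB (der_prim cf) (der_prim cg)) t0.
by rewrite !prim0// subr0 add0r.
Qed.

(** The integrated form of the generator relation contains no derivative, so it survives limits and
    can be pulled back along injective maps. *)
Lemma generator_of_prim x y : (forall t, 0 <= t -> T t x - x = prim (fun s => T s y) t) ->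
  generator T (x, y).
Proof.
move=> h; apply/generatorP => e e0.
have [d d0 hd] := der_prim (orbit_cnt y) (lexx 0) e0.
exists d => // t /andP[t0 td]; rewrite h ?(ltW t0)//.
have := hd t (ltW t0); rewrite subr0 gtr0_norm// => /(_ td).
by rewrite prim0 ?subr0 ?(c0_id hT)//; exact: orbit_cnt.
Qed.

Lemma generator_closed (xs ys : nat -> V) x y : xs @ \oo --> x -> ys @ \oo --> y ->
  (forall n, generator T (xs n, ys n)) -> generator T (x, y).
Proof.
move=> hx hy g; apply: generator_of_prim => t t0.
have [C C1 hC] := sg_bound t; have C0 : 0 < C by rewrite (lt_le_trans ltr01).
apply/eqP; rewrite -subr_eq0; apply/eqP/rnorm_small => e e0.
pose q := C + 1 + C * t; have q0 : 0 < q by rewrite /q ltr_pwDl ?addr_gt0// mulr_ge0// ltW.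
have eq : 0 < e / q by rewrite divr_gt0.
have /cvgn_rnormP/(_ _ eq)[n1 h1] := hx; have /cvgn_rnormP/(_ _ eq)[n2 h2] := hy.
pose n := maxn n1 n2; have {}h1 := h1 n (leq_maxl _ _); have {}h2 := h2 n (leq_maxr _ _).
have -> : T t x - x - prim (fun s => T s y) t =
    (xs n - x) - T t (xs n - x) + prim (fun s => T s (ys n - y)) t.
  have -> : prim (fun s => T s (ys n - y)) t = prim (fun s => T s (ys n) - T s y) t.
    by congr prim; apply/funext => s; rewrite linearB.
  rewrite primB//; try exact: orbit_cnt.
  by rewrite -(generator_eq (g n))// linearB; zmod.
have -> : e = 1 * (e / q) + C * (e / q) + C * (e / q) * t.
  have eE : e = e / q * q by rewrite divfK ?gt_eqF.
  by rewrite [LHS]eE {2}/q; ring.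
rewrite (le_trans (rnormD _ _))// lerD//; last first.
  apply: prim_le => //; first exact: orbit_cnt.
  move=> s s0; rewrite (le_trans (hC _ _ s0))// ler_wpM2l ?(ltW C0)// ltW//.
rewrite (le_trans (rnormB _ _))// lerD//; first by rewrite mul1r ltW.
by rewrite (le_trans (hC _ _ _)) ?t0 ?lexx// ler_wpM2l ?(ltW C0)// ltW.
Qed.

Lemma riemann_generator (f g : R -> V) n t : (forall s, 0 <= s -> generator T (f s, g s)) ->
  generator T (riemann f n t, riemann g n t).
Proof.
move=> h; rewrite /riemann.
elim/big_ind2 : _ => [|x x' y y'|i _]; first exact: generator0.
  exact: generatorD.
by apply: generatorZ; apply: h; exact: grid_ge0.
Qed.

(** A closed operator passes under the integral: Riemann sums are finite combinations of pairs in
    the graph, and the graph is closed. *)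
Lemma prim_generator (f g : R -> V) t : cnt half f -> cnt half g -> 0 <= t ->
  (forall s, 0 <= s -> generator T (f s, g s)) -> generator T (prim f t, prim g t).
Proof.
move=> cf cg t0 h; apply: (generator_closed (riemann_cvg cf t0) (riemann_cvg cg t0)).
by move=> n; exact: riemann_generator.
Qed.

Lemma prim_ext (f g : R -> V) t : (forall s, 0 <= s -> f s = g s) -> prim f t = prim g t.
Proof.
move=> fg; rewrite /prim; suff -> : riemann f ^~ t = riemann g ^~ t by [].
by apply/funext => n; apply: eq_bigr => i _; rewrite fg// grid_ge0.
Qed.

Lemma prim_shift (f : R -> V) (a t : R) : cnt half f -> 0 <= a -> 0 <= t ->
  prim (fun s => f (s + a)) t = prim f (t + a) - prim f a.
Proof.
move=> cf a0 t0.
have sh (s : R) : half s -> half (s + a) by move=> s0; exact: addr_ge0.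
have cf' : cnt half (fun s => f (s + a)).
  move=> s s0 e e0; have [d d0 hd] := cf _ (sh s s0) e e0; exists d => // u u0 ud.
  by apply: hd; [exact: sh|rewrite opprD addrACA subrr addr0].
have df : der half (fun s => prim f (s + a)) (fun s => f (s + a)).
  move=> s s0 e e0; have [d d0 hd] := der_prim cf (sh s s0) e0; exists d => // u u0.
  have -> : u - s = u + a - (s + a) by ring.
  by apply: hd; exact: sh.
by rewrite (prim_unique cf' df t0) add0r [RHS]addrC addKr.
Qed.

Lemma prim_lin (L : {linear V -> V}) (f : R -> V) t : continuous L -> cnt half f -> 0 <= t ->
  prim (fun s => L (f s)) t = L (prim f t).
Proof.
move=> /continuous_linearP[c _ hc] cf t0.
have LB : {morph L : x y / x - y} by move=> x y; rewrite linearB.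
have LZ a x : L (r2K a *: x) = r2K a *: L x by rewrite linearZ.
have := prim_unique (cnt_lin LB hc cf) (der_lin LB LZ hc (der_prim cf)) t0.
by rewrite /= prim0// linear0 add0r.
Qed.

Lemma generator_prim_orbit x t : 0 <= t ->
  generator T (prim (fun s => T s x) t, T t x - x).
Proof.
move=> t0; apply/generatorP => e e0.
have cx := orbit_cnt x; have e20 : 0 < e / 2 by rewrite divr_gt0.
have [d d0 hd] := der_prim cx t0 e20; have [d' d'0 hd'] := der_prim cx (lexx 0) e20.
exists (Num.min d d'); first by rewrite lt_min d0.
move=> h /andP[h0]; rewrite lt_min => /andP[hhd hhd'].
have -> : T h (prim (fun s => T s x) t) = prim (fun s => T s x) (t + h) - prim (fun s => T s x) h.
  rewrite -prim_lin//; last by apply: (c0_bounded hT); exact: ltW.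
  rewrite -(prim_shift cx (ltW h0) t0); apply: prim_ext => s s0.
  by rewrite addrC (c0_add hT) ?(ltW h0).
have hth : 0 <= t + h by rewrite addr_ge0// ltW.
have := hd (t + h) hth; rewrite addrAC subrr add0r gtr0_norm// => /(_ hhd) h1.
have := hd' h (ltW h0); rewrite subr0 gtr0_norm// => /(_ hhd').
rewrite prim0// subr0 (c0_id hT) => h2.
set P := prim _; rewrite -/P in h1 h2.
have -> : P (t + h) - P h - P t - r2K h *: (T t x - x) =
   (P (t + h) - P t - r2K h *: T t x) - (P h - r2K h *: x) by zmod.
rewrite (le_trans (rnormB _ _))// (_ : e * h = e / 2 * h + e / 2 * h); last by field.
exact: lerD.
Qed.

Lemma generator_dense x (e : R) : 0 < e -> exists2 xy, generator T xy & N (x - xy.1) <= e.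
Proof.
move=> e0; have [d d0 hd] := der_prim (orbit_cnt x) (lexx 0) e0.
have h0 : 0 < d / 2 by rewrite divr_gt0.
pose h := d / 2.
exists (r2K h^-1 *: prim (fun s => T s x) h, r2K h^-1 *: (T h x - x)).
  by apply: generatorZ; apply: generator_prim_orbit; exact: ltW.
have := hd h (ltW h0); rewrite subr0 gtr0_norm// prim0; last exact: orbit_cnt.
rewrite (c0_id hT) subr0 {1}/h ltr_pdivrMr// ltr_pMr// ltr1n => /(_ isT).
move=> h1; rewrite /=; set P := prim _ _ in h1 *.
have hp : 0 < h by [].
have -> : x - r2K h^-1 *: P = - (r2K h^-1 *: (P - r2K h *: x)).
  by rewrite scalerBr scalerA -of_realM mulVf ?gt_eqF// of_real1; zmod.
by rewrite rnormN rnormZr gtr0_norm ?invr_gt0// ler_pdivrMl// mulrC.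
Qed.

End Semigroup.
Arguments generator_comb {R k V T} c {x y x' y'} _ _.
Arguments generatorZ {R k V T} c {x y} _.
Arguments generator_prim_orbit {R k V T} hT x {t} _.

(** * Smoothing by exponential densities *)

Section Smoothing.
Context (R : realType) (k : scalar_kind).
Local Notation K := (scalars k R).
Local Notation r2K := (@of_real k R).
Local Notation N := rnorm.
Implicit Types V W : completeNormedModType K.

Definition weighted V (n : R) (f : R -> V) (s : R) : V := r2K (n * expR (n * s)) *: f s.

(* Convolution with the exponential density [n exp (- n s)] on the half-line. *)
Definition smooth V n (f : R -> V) (t : R) : V := r2K (expR (- n * t)) *: prim (weighted n f) t.

Lemma expRNx (x : R) : expR (- x) * expR x = 1.
Proof. by rewrite mulrC expRxMexpNx_1. Qed.

Lemma cnt_weighted V n (f : R -> V) : cnt half f -> cnt half (weighted n f).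
Proof.
move=> cf; have c1 := rder_cntK (@rder_expR R half n) cf.
by apply: cnt_ext (cntZ (r2K n) c1) => t _; rewrite scalerA -of_realM.
Qed.

Lemma der_smooth V n (f : R -> V) : cnt half f ->
  der half (smooth n f) (fun t => r2K n *: (f t - smooth n f t)).
Proof.
move=> cf; apply: der_ext (der_scale (@rder_expR R half (- n)) (der_prim (cnt_weighted n cf))) => // t t0.
rewrite /smooth /weighted scalerBr !scalerA -!of_realM mulrCA mulNr expRNx mulr1.
by rewrite addrC; congr (_ + _); rewrite of_realM of_realN -scaleNr mulNr -of_realM.
Qed.

Lemma cnt_smooth V n (f : R -> V) : cnt half f -> cnt half (smooth n f).
Proof. by move=> /(der_smooth n)/der_cnt. Qed.

Lemma smooth0 V n (f : R -> V) : cnt half f -> smooth n f 0 = 0.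
Proof. by move=> cf; rewrite /smooth prim0 ?scaler0//; exact: cnt_weighted. Qed.

(** Multiplication by [expR (n * t)] turns the equation h' = n (f - h) into a plain primitive.
    Linearity, commutation with operators and the explicit formulas for smoothings all reduce to
    checking this equation and [h 0 = 0]. *)
Lemma smooth_unique V n (f h h' : R -> V) t : cnt half f -> der half h h' -> h 0 = 0 ->
  (forall s, 0 <= s -> h' s = r2K n *: (f s - h s)) -> 0 <= t -> h t = smooth n f t.
Proof.
move=> cf dh h0 hh' t0.
have d := der_scale (@rder_expR R half n) dh.
have e : der half (fun t => r2K (expR (n * t)) *: h t) (weighted n f).
  apply: der_ext d => // s s0; rewrite /weighted hh'// scalerA -of_realM.
  by rewrite [expR (n * s) * n]mulrC scalerBr; zmod.
have := prim_unique (cnt_weighted n cf) e t0; rewrite h0 scaler0 add0r => eq.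
by rewrite /smooth -eq scalerA -of_realM mulNr expRNx of_real1 scale1r.
Qed.

Lemma smooth_ext V n (f g : R -> V) t : (forall s, 0 <= s -> f s = g s) ->
  smooth n f t = smooth n g t.
Proof.
by move=> fg; congr (_ *: _); apply: prim_ext => s s0; rewrite /weighted fg.
Qed.

Lemma smooth_lin V W (L : V -> W) (c n : R) (f : R -> V) t : {morph L : x y / x - y} ->
  (forall a x, L (r2K a *: x) = r2K a *: L x) -> (forall x, N (L x) <= c * N x) ->
  cnt half f -> 0 <= t -> L (smooth n f t) = smooth n (L \o f) t.
Proof.
move=> LB LZ Lc cf t0; have L0 : L 0 = 0 by rewrite -(subrr 0) LB subrr.
apply: (smooth_unique (h := L \o smooth n f) (cnt_lin LB Lc cf) (der_lin LB LZ Lc (der_smooth n cf))) => //.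
  by rewrite /= smooth0.
by move=> s s0; rewrite /= LZ LB.
Qed.

Lemma smoothB V n (f g : R -> V) t : cnt half f -> cnt half g -> 0 <= t ->
  smooth n (fun s => f s - g s) t = smooth n f t - smooth n g t.
Proof.
move=> cf cg t0; apply/esym.
apply: (smooth_unique (cntB cf cg) (derB (der_smooth n cf) (der_smooth n cg))) => //.
  by rewrite !smooth0// subrr.
by move=> s s0; zmod.
Qed.

Lemma smoothD V n (f g : R -> V) t : cnt half f -> cnt half g -> 0 <= t ->
  smooth n (fun s => f s + g s) t = smooth n f t + smooth n g t.
Proof.
move=> cf cg t0; apply/esym.
apply: (smooth_unique (cntD cf cg) (derD (der_smooth n cf) (der_smooth n cg))) => //.
  by rewrite !smooth0// addr0.
by move=> s s0; zmod.
Qed.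

Lemma smoothZ V n (c : K) (f : R -> V) t : cnt half f -> 0 <= t ->
  smooth n (fun s => c *: f s) t = c *: smooth n f t.
Proof.
move=> cf t0; apply/esym; apply: (smooth_unique (cntZ c cf) (derZ c (der_smooth n cf))) => //.
  by rewrite smooth0// scaler0.
by move=> s s0; rewrite -scalerBr !scalerA mulrC.
Qed.

Lemma smooth_prim V n (f : R -> V) t : cnt half f -> 0 <= t ->
  smooth n (prim f) t = prim (smooth n f) t.
Proof.
move=> cf t0; apply/esym.
have cs := cnt_smooth n cf.
apply: (smooth_unique (cnt_prim cf) (der_prim cs)) => //; first exact: prim0.
move=> s s0; have cd : cnt half (fun s => r2K n *: (f s - smooth n f s)).
  by apply: cntZ; exact: cntB.
have := prim_unique cd (der_smooth n cf) s0; rewrite smooth0// add0r => ->.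
have := prim_unique cd (derZ (r2K n) (derB (der_prim cf) (der_prim cs))) s0.
by rewrite !prim0// subrr scaler0 add0r => ->.
Qed.

(** Variation of constants from [a] to [b]: the derivative of [expR (n * t)] times (J f - y) is
    [n * expR (n * t)] times (f - y). The bound is a convex combination of the initial gap [C] and
    the error [e]. *)
Lemma smooth_dist V n (f : R -> V) y (a b C e : R) : 0 < n -> cnt half f -> 0 <= a -> a <= b ->
  N (smooth n f a - y) <= C -> (forall s, a <= s <= b -> N (f s - y) <= e) ->
  N (smooth n f b - y) <= e * (1 - expR (- n * (b - a))) + C * expR (- n * (b - a)).
Proof.
move=> n0 cf a0 ab hC he; have b0 : 0 <= b := le_trans a0 ab.
pose D t := r2K (expR (n * t)) *: (smooth n f t - y).
have dD : der half D (fun t => r2K (n * expR (n * t)) *: (f t - y)).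
  have dS := der_scale (@rder_expR R half n) (derB (der_smooth n cf) (@der_cst R k half V y)).
  apply: (der_ext _ _ dS) => // s s0.
  by rewrite subr0 scalerA -of_realM [expR (n * s) * n]mulrC; zmod.
have dE : rder (seg a b) (fun t => e * expR (n * t)) (fun t => e * (n * expR (n * t))).
  move=> t tab e' e'0; have e1 : 0 < 1 + `|e| by rewrite ltr_pwDl.
  have [|d d0 hd] := @rder_expR R (seg a b) n t tab (e' / (1 + `|e|)); first by rewrite divr_gt0.
  exists d => // s Ds /(hd s Ds) h.
  have -> : e * expR (n * s) - e * expR (n * t) - (s - t) * (e * (n * expR (n * t))) =
     e * (expR (n * s) - expR (n * t) - (s - t) * (n * expR (n * t))) by ring.
  rewrite normrM (@le_trans _ _ ((1 + `|e|) * (e' / (1 + `|e|) * `|s - t|)))//.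
    by rewrite ler_pM// lerDr.
  by rewrite mulrA [_ * (e' / _)]mulrC divfK// gt_eqF.
have := mean_value ab (der_sub (seg_half a0) dD) dE.
have En (s : R) : 0 < expR (n * s) by exact: expR_gt0.
have hb : forall t, a <= t <= b -> N (r2K (n * expR (n * t)) *: (f t - y)) <= e * (n * expR (n * t)).
  move=> t tab; rewrite rnormZr gtr0_norm ?mulr_gt0// mulrC ler_wpM2r ?mulr_ge0 ?(ltW n0) ?(ltW (En t))//.
  exact: he.
move=> /(_ hb) h1.
have h2 : N (D b) <= e * expR (n * b) - e * expR (n * a) + expR (n * a) * C.
  rewrite (le_trans (rnorm_split (D a) _))// lerD// rnormZr gtr0_norm//.
  by rewrite ler_wpM2l ?(ltW (En a)).
have -> : N (smooth n f b - y) = expR (- n * b) * N (D b).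
  by rewrite rnormZr gtr0_norm// mulrA mulNr expRNx mul1r.
apply: (le_trans (ler_wpM2l (expR_ge0 _) h2)).
rewrite (_ : - n * (b - a) = - (n * b) + n * a); last by ring.
rewrite expRD mulNr le_eqVlt; apply/orP; left; apply/eqP.
have := expRNx (n * b); move: (expR (- (n * b))) (expR (n * b)) (expR (n * a)) => p q r pq.
transitivity (e * (p * q) - e * p * r + C * p * r); first by ring.
by rewrite pq; ring.
Qed.

(** The smoothed function starts at 0, so its initial distance to [y] is [N y]; this explains the
    hypothesis [N y <= C]. *)
Lemma smooth_bound V n (f : R -> V) y (b C : R) : 0 < n -> cnt half f ->
  0 <= b -> N y <= C -> (forall s, 0 <= s <= b -> N (f s - y) <= C) ->
  N (smooth n f b - y) <= C.
Proof.
move=> n0 cf b0 yC hC.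
have := @smooth_dist V n f y 0 b C C n0 cf (lexx 0) b0.
rewrite smooth0// sub0r rnormN => /(_ yC hC).
by rewrite -mulrDr subrK mulr1.
Qed.

Lemma cnt_iter_smooth V n m (f : R -> V) : cnt half f -> cnt half (iter m (smooth n) f).
Proof. by move=> cf; elim: m => //= m; exact: cnt_smooth. Qed.

Lemma iter_smooth_bound V n m (f : R -> V) y (b C : R) : 0 < n -> cnt half f ->
  N y <= C -> (forall s, 0 <= s <= b -> N (f s - y) <= C) ->
  forall s, 0 <= s <= b -> N (iter m (smooth n) f s - y) <= C.
Proof.
move=> n0 cf yC hC; elim: m => [|m IH] //= s /andP[s0 sb].
apply: smooth_bound => //; first exact: cnt_iter_smooth.
by move=> u /andP[u0 us]; apply: IH; rewrite u0 (le_trans us).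
Qed.

Lemma expR_small (C e : R) : 0 < e -> exists2 L : R, 0 < L & forall x, L <= x -> C * expR (- x) <= e.
Proof.
move=> e0; exists (1 + `|C| / e); first by rewrite ltr_pwDl// divr_ge0// ltW.
move=> x Lx; have x0 : 0 < x by rewrite (lt_le_trans _ Lx)// ltr_pwDl// divr_ge0// ltW.
rewrite expRN (le_trans (ler_norm _))// normrM [`|_^-1|]gtr0_norm ?invr_gt0 ?expR_gt0//.
rewrite ler_pdivrMr ?expR_gt0// mulrC -ler_pdivrMr//.
by have := expR_ge1Dx x; lra.
Qed.

(** For the induction on [m], closeness is stated on a whole left neighbourhood of [t], uniformly in
    large [n]. The time must be positive because every smoothing vanishes at 0. *)
Lemma iter_smooth_near V m (f : R -> V) t (e : R) : cnt half f -> 0 < t -> 0 < e ->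
  exists a n0 : R, [/\ 0 <= a, a < t & 0 < n0 /\
    forall n s, n0 <= n -> a <= s <= t -> N (iter m (smooth n) f s - f t) <= e].
Proof.
move=> cf t0 e0.
elim: m e e0 => [|m IH] e e0.
  have [d d0 hd] := cf t (ltW t0) e e0.
  pose a := Num.max 0 (t - d / 2).
  have ta : t - d / 2 <= a by rewrite /a le_max lexx orbT.
  exists a, 1; split=> //; first by rewrite /a le_max lexx.
    by rewrite /a gt_max t0/=; lra.
  split=> // n s _ /andP[as_ st]; apply: hd.
    by rewrite /half/= (le_trans _ as_)// /a le_max lexx.
  by rewrite ler0_norm ?subr_le0//; lra.
have e20 : 0 < e / 2 by rewrite divr_gt0.
have [a [n0 [a0 at_ [n00 hn]]]] := IH _ e20.
have [C0 C00 hC0] := cnt_bounded (ltW t0) (cnt_seg_half (ltW t0) cf).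
pose C := C0 + C0.
have [L L0 hL] := expR_small C e20.
have r0 : 0 < (t - a) / 2 by rewrite divr_gt0// subr_gt0.
(* Halving the neighbourhood leaves at least the time [(t - a) / 2] for the exponential factor to
   absorb the gap present at [a]. *)
pose a' := (a + t) / 2.
exists a', (Num.max n0 (L / ((t - a) / 2))); split.
- by rewrite divr_ge0// addr_ge0// ltW.
- by rewrite /a'; lra.
split; first by rewrite lt_max n00.
move=> n s; rewrite ge_max => /andP[nn nL] /andP[as_ st] /=.
have np : 0 < n := lt_le_trans n00 nn.
have C1 : 0 <= C by rewrite /C addr_ge0.
have Cy : N (f t) <= C.
  by rewrite (le_trans (hC0 t _)) ?lexx ?(ltW t0)// lerDl.
have bd u : 0 <= u <= t -> N (iter m.+1 (smooth n) f u - f t) <= C.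
  apply: iter_smooth_bound => // v vt; rewrite (le_trans (rnormB _ _))// lerD//; first exact: hC0.
  by rewrite hC0// (ltW t0) lexx.
have as' : a <= s by rewrite (le_trans _ as_)// /a'; lra.
have := @smooth_dist V n (iter m (smooth n) f) (f t) a s C (e / 2) np _ a0 as'.
have bda := bd a; rewrite a0 (ltW at_) /= in bda.
move=> /(_ (cnt_iter_smooth _ _ cf) (bda isT)).
have hs : forall u, a <= u <= s -> N (iter m (smooth n) f u - f t) <= e / 2.
  by move=> u /andP[au us]; apply: hn => //; rewrite au (le_trans us).
move=> /(_ hs) /le_trans; apply.
rewrite [leRHS](splitr e) lerD//.
  by rewrite ler_piMr ?(ltW e20)// gerBl expR_ge0.
rewrite mulNr hL//; rewrite ler_pdivrMr// in nL.
by rewrite (le_trans nL)// ler_wpM2l ?(ltW np)//; rewrite /a' in as_; lra.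
Qed.

Lemma iter_smooth_cvg V m (f : R -> V) t : cnt half f -> 0 < t ->
  iter m (smooth n.+1%:R) f t @[n --> \oo] --> f t.
Proof.
move=> cf t0; apply/cvgn_rnormP => e e0; have e20 : 0 < e / 2 by rewrite divr_gt0.
have [a [n0 [a0 at_ [n00 hn]]]] := iter_smooth_near m cf t0 e20.
exists (Num.truncn n0) => n nn; rewrite (le_lt_trans (hn _ _ _ _))//.
- by rewrite ltW// truncn_large.
- by rewrite (ltW at_) lexx.
- by rewrite ltr_pdivrMr// ltr_pMr// ltr1n.
Qed.

Variables (V : completeNormedModType K) (T : R -> {linear V -> V}).
Hypothesis hT : c0_semigroup T.

Lemma smooth_generator n (f g : R -> V) t : cnt half f -> cnt half g -> 0 <= t ->
  (forall s, 0 <= s -> generator T (f s, g s)) -> generator T (smooth n f t, smooth n g t).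
Proof.
move=> cf cg t0 h; apply: generatorZ; apply: prim_generator => //.
- exact: cnt_weighted.
- exact: cnt_weighted.
- by move=> s s0; apply: generatorZ; exact: h.
Qed.

End Smoothing.

(** * Resolvents and Laplace transforms *)

Section Resolvent.
Context (R : realType) (k : scalar_kind).
Local Notation K := (scalars k R).
Local Notation r2K := (@of_real k R).
Local Notation N := rnorm.
Variables (V : completeNormedModType K) (T : R -> {linear V -> V}).
Hypothesis hT : c0_semigroup T.
Local Notation A := (generator T).
Local Notation Res := (resolvent (generator T)).

Lemma resolvent_gen lam x : resolvent_set A lam -> A (Res lam x, lam *: Res lam x - x).
Proof.
move=> [/(_ x)[y [hy _]] _].
exact: (@xgetI _ 0 [set y | A (y, lam *: y - x)] y hy).
Qed.

Arguments resolvent_gen {lam} x _.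

Lemma resolvent_unique lam x y : resolvent_set A lam -> A (y, lam *: y - x) -> Res lam x = y.
Proof.
move=> hl hy; have [/(_ x)[z [_ hz]] _] := hl.
by rewrite -(hz _ hy); apply/esym/hz; exact: resolvent_gen.
Qed.

Lemma resolvent_ofgen lam x y : resolvent_set A lam -> A (x, y) -> Res lam (lam *: x - y) = x.
Proof. by move=> hl hxy; apply: resolvent_unique => //; rewrite opprB addrC subrK. Qed.

Lemma resolvent_comb lam (c : K) x y : resolvent_set A lam ->
  Res lam (c *: x + y) = c *: Res lam x + Res lam y.
Proof.
move=> hl; apply: resolvent_unique => //.
have := generator_comb c (resolvent_gen x hl) (resolvent_gen y hl).
by congr A; congr pair; rewrite scalerBr scalerDr !scalerA [c * lam]mulrC; zmod.
Qed.

Lemma resolventB lam : resolvent_set A lam -> {morph Res lam : x y / x - y}.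
Proof.
move=> hl x y; have := resolvent_comb (-1) y x hl.
by rewrite !scaleN1r addrC => ->; rewrite addrC.
Qed.

Lemma resolvent0 lam : resolvent_set A lam -> Res lam 0 = 0.
Proof. by move=> hl; have := resolventB hl 0 0; rewrite !subrr. Qed.

Lemma resolventZ lam (c : K) x : resolvent_set A lam -> Res lam (c *: x) = c *: Res lam x.
Proof.
by move=> hl; have := resolvent_comb c x 0 hl; rewrite resolvent0// !addr0.
Qed.

Lemma resolventD lam : resolvent_set A lam -> {morph Res lam : x y / x + y}.
Proof. by move=> hl x y; have := resolvent_comb 1 x y hl; rewrite !scale1r. Qed.

Lemma resolvent_bounded lam : resolvent_set A lam ->
  exists2 c : R, 0 <= c & forall x, N (Res lam x) <= c * N x.
Proof.
move=> hl; apply/continuous_boundedP; last exact: hl.2.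
- exact: resolventB.
- by move=> a x; exact: resolventZ.
Qed.

Lemma resolvent_identity lam mu x : resolvent_set A lam -> resolvent_set A mu ->
  Res lam x = Res mu (x + (mu - lam) *: Res lam x).
Proof.
move=> hl hm; apply/esym/resolvent_unique => //.
have := resolvent_gen x hl; congr A; congr pair.
by rewrite scalerBl; zmod.
Qed.

Section Growth.
Variables M w : R.
Hypotheses (M1 : 1 <= M) (w0 : 0 <= w).
Hypothesis TM : forall t x, 0 <= t -> N (T t x) <= M * expR (w * t) * N x.
Let M0 : 0 < M. Proof. exact: lt_le_trans M1. Qed.

Section Laplace.
Variable lam : R.
Hypothesis lw : w < lam.
Let lw0 : 0 < lam - w. Proof. by rewrite subr_gt0. Qed.

Let damp x (s : R) : V := r2K (expR (- lam * s)) *: T s x.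

Lemma damp_le x s : 0 <= s -> N (damp x s) <= M * N x * expR (- (lam - w) * s).
Proof.
move=> s0; rewrite /damp rnormZr gtr0_norm ?expR_gt0//.
apply: (le_trans (ler_wpM2l (expR_ge0 _) (TM x s0))).
rewrite (_ : - (lam - w) * s = - lam * s + w * s); last by ring.
by rewrite expRD le_eqVlt; apply/orP; left; apply/eqP; ring.
Qed.

Lemma cnt_damp x : cnt half (damp x).
Proof. exact: rder_cntK (@rder_expR R half (- lam)) (orbit_cnt hT x). Qed.

(** As [x] need not lie in the domain, the truncated Laplace integral is first integrated by parts
    through the integrated orbit [W], whose values do lie in it. *)
Lemma prim_damp_gen x t : 0 <= t ->
  A (prim (damp x) t, r2K lam *: prim (damp x) t + (damp x t - x)).
Proof.
move=> t0; have cx := orbit_cnt hT x; pose W := prim (fun s => T s x).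
pose f s := r2K (expR (- lam * s)) *: W s.
pose g s := r2K (expR (- lam * s)) *: (T s x - x).
have dexp := @rder_expR R half (- lam).
have cf : cnt half f by apply: (rder_cntK dexp); exact: cnt_prim.
have cg : cnt half g by apply: (rder_cntK dexp); apply: cntB cx _; exact: cnt_cst.
have fg : A (prim f t, prim g t).
  by apply: prim_generator => // s s0; apply: generatorZ; exact: generator_prim_orbit.
have df := der_scale dexp (der_prim cx).
have e1 : prim (damp x) t = f t + r2K lam *: prim f t.
  have := prim_unique (cnt_damp x) _ t0.
  move=> /(_ (fun t => f t + r2K lam *: prim f t)) -> //.
    by rewrite /f /W !prim0// !scaler0 !add0r.
  apply: (der_ext _ _ (derD df (derZ (r2K lam) (der_prim cf)))) => // s s0.
  by rewrite /damp /f /W of_realM of_realN mulNr; zmod.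
have e2 : r2K lam *: prim g t = r2K lam *: prim (damp x) t - (x - r2K (expR (- lam * t)) *: x).
  have dp : der half (fun t => r2K (expR (- lam * t)) *: x) (fun t => r2K (- lam * expR (- lam * t)) *: x).
    by apply: (der_ext _ _ (der_scale dexp (@der_cst R k half V x))) => // s s0; rewrite scaler0 addr0.
  have := prim_unique (cntZ (r2K lam) cg) (derZ (r2K lam) (der_prim cg)) t0.
  rewrite prim0// scaler0 add0r => ->.
  pose q t := r2K lam *: prim (damp x) t - (x - r2K (expR (- lam * t)) *: x).
  have dq : der half q (fun s => r2K lam *: g s).
    apply: (der_ext _ _ (derB (derZ (r2K lam) (der_prim (cnt_damp x))) (derB (@der_cst R k half V x) dp))) => // s s0.
    by rewrite /g /damp of_realM of_realN (mulNr (r2K lam)); zmod.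
  rewrite -[prim _ t]add0r -(_ : q 0 = 0) -?(prim_unique (cntZ (r2K lam) cg) dq t0)//.
  by rewrite /q prim0 ?mulr0 ?expR0 ?of_real1; [zmod|exact: cnt_damp].
have := generatorD (generatorZ (r2K (expR (- lam * t))) (generator_prim_orbit hT x t0))
   (generatorZ (r2K lam) fg).
rewrite -/(f t) -e1 e2; congr A; congr pair.
by rewrite /damp scalerBr; zmod.
Qed.

Lemma prim_damp_dist x s t : 0 <= s -> s <= t ->
  N (prim (damp x) t - prim (damp x) s) <= M / (lam - w) * N x * expR (- (lam - w) * s).
Proof.
move=> s0 st; set c := lam - w.
have dE : rder (seg s t) (fun t => - (M / c * N x) * expR (- c * t)) (fun t => M * N x * expR (- c * t)).
  move=> u uab e e0; have e1 : 0 < 1 + `|M / c * N x| by rewrite ltr_pwDl.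
  have [|d d0 hd] := @rder_expR R (seg s t) (- c) u uab (e / (1 + `|M / c * N x|)); first by rewrite divr_gt0.
  exists d => // r Dr /(hd r Dr) h.
  have cn : c != 0 by rewrite gt_eqF.
  have -> : - (M / c * N x) * expR (- c * r) - - (M / c * N x) * expR (- c * u) -
      (r - u) * (M * N x * expR (- c * u)) =
     - (M / c * N x) * (expR (- c * r) - expR (- c * u) - (r - u) * (- c * expR (- c * u))) by field.
  rewrite normrM normrN (@le_trans _ _ ((1 + `|M / c * N x|) * (e / (1 + `|M / c * N x|) * `|r - u|)))//.
    by rewrite ler_pM// lerDr.
  by rewrite mulrA [_ * (e / _)]mulrC divfK// gt_eqF.
have := mean_value st (der_sub (seg_half s0) (der_prim (cnt_damp x))) dE.
have hb : forall u, s <= u <= t -> N (damp x u) <= M * N x * expR (- c * u).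
  by move=> u /andP[su ut]; apply: damp_le; exact: le_trans su.
move=> /(_ hb) /le_trans; apply.
have q0 : 0 <= M / c * N x by rewrite mulr_ge0// divr_ge0 ?(ltW M0)// ltW.
have := mulr_ge0 q0 (expR_ge0 (- c * t)).
by move: (M / c * N x) (expR (- c * t)) (expR (- c * s)) => q u v; lra.
Qed.

Lemma laplace_exists x : exists2 y, A (y, r2K lam *: y - x) & N y <= M / (lam - w) * N x.
Proof.
pose xs (n : nat) := prim (damp x) n%:R.
have c0 : 0 < M / (lam - w) * N x + 1.
  by rewrite ltr_wpDl// mulr_ge0// divr_ge0 ?(ltW M0)// ltW.
have small (C e : R) : 0 <= C -> 0 < e -> exists n0 : nat, forall n : nat, (n0 <= n)%N ->
    C * expR (- (lam - w) * n%:R) <= e.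
  move=> C0 e0; have [L L0 hL] := expR_small C e0.
  exists (Num.truncn (L / (lam - w))).+1 => n nn; rewrite mulNr hL//.
  by rewrite mulrC -ler_pdivrMr// ltW// (lt_le_trans (truncnS_gt _))// ler_nat.
have [y hy] : exists y : V, xs n @[n --> \oo] --> y.
  apply: rnorm_cauchy_cvg => e e0; have e20 : 0 < e / 2 by rewrite divr_gt0.
  have [||n0 h0] := small (M / (lam - w) * N x) (e / 2) => //.
    by rewrite mulr_ge0// divr_ge0 ?(ltW M0)// ltW.
  have e4 : e / 2 < e by rewrite ltr_pdivrMr// ltr_pMr// ltr1n.
  exists n0 => n m nn nm; apply: le_lt_trans e4.
  have [nlm|/ltnW mln] := leqP n m.
    by rewrite rdistC (le_trans (prim_damp_dist _ _ _)) ?ler_nat ?h0.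
  by rewrite (le_trans (prim_damp_dist _ _ _)) ?ler_nat ?h0.
exists y; last first.
  apply: (rnorm_lim_le hy); exists 0%N => n _.
  have := @prim_damp_dist x 0 n%:R (lexx 0) (ler0n _ _).
  by rewrite mulr0 expR0 mulr1 prim0 ?subr0//; exact: cnt_damp.
apply: (generator_closed hT hy (ys := fun n => r2K lam *: xs n + (damp x n%:R - x))).
  apply: cvgD; first exact: cvgZr.
  rewrite -[X in _ --> X]add0r; apply: cvgB; last exact: cvg_cst.
  apply/cvgn_rnormP => e e0; have e20 : 0 < e / 2 by rewrite divr_gt0.
  have [||n0 h0] := small (M * N x) (e / 2) => //; first by rewrite mulr_ge0// ltW.
  exists n0 => n nn; rewrite subr0 (le_lt_trans (damp_le _ _))// (le_lt_trans (h0 n nn))//.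
  by rewrite ltr_pdivrMr// ltr_pMr// ltr1n.
by move=> n; apply: prim_damp_gen.
Qed.

(** The damped orbit would have derivative 0 and hence be constantly [x], whereas it decays because
    [lam > w]. *)
Lemma eigen_zero x : A (x, r2K lam *: x) -> x = 0.
Proof.
move=> g; have de : der half (damp x) (fun=> 0).
  apply: (der_ext _ _ (der_scale (@rder_expR R half (- lam)) (generator_der hT g))) => // s s0.
  by rewrite linearZ /= of_realM of_realN scalerA [r2K (expR _) * _]mulrC mulNr scaleNr addNr.
apply: rnorm_small => e e0; have [L L0 hL] := expR_small (M * N x) e0.
have t0 : 0 <= L / (lam - w) by rewrite divr_ge0// ltW.
have := der0_cst t0 (der_sub (seg_half (lexx 0)) de).
rewrite /damp mulr0 expR0 of_real1 scale1r (c0_id hT) => <-.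
rewrite (le_trans (damp_le x t0))// mulNr hL//.
by rewrite mulrC divfK// gt_eqF.
Qed.

Lemma resolvent_set_large : resolvent_set A (r2K lam).
Proof.
have ex x : exists! y, A (y, r2K lam *: y - x).
  have [y hy _] := laplace_exists x; exists y; split=> // y' hy'.
  apply/eqP; rewrite -subr_eq0; apply/eqP/eigen_zero.
  by have := generatorB hy hy'; congr A; congr pair; zmod.
split=> //.
have gen x : A (Res (r2K lam) x, r2K lam *: Res (r2K lam) x - x).
  by have [y [hy _]] := ex x; exact: (@xgetI _ 0 [set y | A (y, r2K lam *: y - x)] y hy).
have uni x y : A (y, r2K lam *: y - x) -> Res (r2K lam) x = y.
  by move=> hy; have [z [_ hz]] := ex x; rewrite -(hz _ hy) (hz _ (gen x)).
apply/continuous_boundedP.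
- move=> x y; apply: uni; have := generatorB (gen x) (gen y).
  by congr A; congr pair; zmod.
- move=> a x; apply: uni; have := generatorZ (r2K a) (gen x).
  by congr A; congr pair; rewrite scalerBr !scalerA [r2K a * _]mulrC.
- exists (M / (lam - w)); first by rewrite divr_ge0 ?(ltW M0)// ltW.
  by move=> x; have [y hy hb] := laplace_exists x; rewrite (uni _ _ hy).
Qed.

Lemma resolvent_large_bound x : N (Res (r2K lam) x) <= M / (lam - w) * N x.
Proof.
by have [y hy hb] := laplace_exists x; rewrite (resolvent_unique resolvent_set_large hy).
Qed.

End Laplace.
End Growth.

Lemma resolvent_large : exists L c : R, [/\ 0 < L, 0 <= c & forall lam, L < lam ->
  resolvent_set A (r2K lam) /\ forall x, N (r2K lam *: Res (r2K lam) x) <= c * N x].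
Proof.
have [M [w [M1 w0 TM]]] := sg_growth hT.
(* For [lam >= 2 * w] the ratio [lam / (lam - w)] is at most 2; the summand 1 makes the threshold
   positive. *)
exists (2 * w + 1), (2 * M); split.
- by rewrite ltr_wpDl// mulr_ge0.
- by rewrite mulr_ge0// (le_trans _ M1).
move=> lam hl; have lw : w < lam by lra.
have lp : 0 < lam by lra.
split; first exact: (resolvent_set_large M1 TM lw).
move=> x; rewrite rnormZr gtr0_norm//.
apply: (le_trans (ler_wpM2l (ltW lp) (resolvent_large_bound M1 TM lw x))).
rewrite mulrA ler_wpM2r// mulrA ler_pdivrMr; last by lra.
rewrite [lam * M]mulrC -[2 * M]mulrC -mulrA ler_wpM2l//; last by lra.
by rewrite (le_trans _ M1).
Qed.

(** On the domain, [lam R(lam) x' - x' = R(lam) y'] is of order [1 / lam]; the uniform bound of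
    [resolvent_large] extends the convergence from this dense set. *)
Lemma yosida_cvg x (e : R) : 0 < e -> exists L : R, forall lam, L < lam ->
  N (r2K lam *: Res (r2K lam) x - x) <= e.
Proof.
move=> e0; have [L [c [L0 c0 hL]]] := resolvent_large.
have c1 : 0 < c + 1 by rewrite ltr_wpDl.
have e3 : 0 < e / 2 / (c + 1) by rewrite !divr_gt0.
have [[x' y'] /= g hx] := generator_dense hT x e3.
exists (Num.max L (c * N y' / (e / 2))) => lam; rewrite gt_max => /andP[lL lY].
have [hr hb] := hL lam lL; have lp : 0 < lam := lt_trans L0 lL.
have -> : r2K lam *: Res (r2K lam) x - x =
    r2K lam *: Res (r2K lam) (x - x') + Res (r2K lam) y' - (x - x').
  have := resolvent_ofgen hr g; rewrite !resolventB// resolventZ// => h.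
  have -> : Res (r2K lam) y' = r2K lam *: Res (r2K lam) x' - x' by rewrite -{2}h; zmod.
  by zmod.
have h2 : N (Res (r2K lam) y') <= e / 2.
  have := hb y'; rewrite rnormZr gtr0_norm// -ler_pdivlMl// => /le_trans; apply.
  by rewrite ler_pdivrMl// -ler_pdivrMr ?divr_gt0// ltW.
rewrite (le_trans (rnormB _ _))//.
have h1 := hb (x - x').
have : N (r2K lam *: Res (r2K lam) (x - x') + Res (r2K lam) y') <= c * N (x - x') + e / 2.
  by rewrite (le_trans (rnormD _ _))// lerD.
have : (c + 1) * N (x - x') <= e / 2 by rewrite mulrC -ler_pdivlMr.
rewrite mulrDl mul1r; lra.
Qed.

End Resolvent.

(** * Integral norms *)

Section LpEstimates.
Context (R : realType) (k : scalar_kind) (p : R).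
Hypothesis p1 : 1 < p.
Local Notation mu := (@lebesgue_measure R).
Local Notation K := (scalars k R).
Local Notation N := rnorm.
Implicit Types V W : completeNormedModType K.
Let p0 : 0 < p. Proof. exact: lt_trans p1. Qed.

(** The p-th power of the norm is kept without its root, as it is additive over intervals and suits
    limit theorems; [Lpnorm_leP] translates bounds. *)
Definition Ip V (b : R) (f : R -> V) : \bar R := (\int[mu]_(t in `[0%R, b]) (N (f t) `^ p)%:E)%E.

Lemma ae_mono (P Q : R -> Prop) : (forall t, P t -> Q t) ->
  {ae mu, forall t, P t} -> {ae mu, forall t, Q t}.
Proof. by move=> h; apply: (@filterS _ _ (ae_filter_ringOfSetsType mu)). Qed.

Lemma ae_mono2 (P Q S : R -> Prop) : (forall t, P t -> Q t -> S t) ->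
  {ae mu, forall t, P t} -> {ae mu, forall t, Q t} -> {ae mu, forall t, S t}.
Proof. by move=> h; apply: (@filterS2 _ _ (ae_filter_ringOfSetsType mu)). Qed.

Lemma LpnormE V b (f : R -> V) : Lpnorm p b f = (Ip b f `^ p^-1)%E.
Proof. by []. Qed.

Lemma Ip_ge0 V b (f : R -> V) : (0 <= Ip b f)%E.
Proof. by apply: integral_ge0 => t _; rewrite lee_fin powR_ge0. Qed.

Lemma powR_lexp (x y : R) : 0 <= x -> x <= y -> x `^ p <= y `^ p.
Proof. by move=> x0 xy; apply: ge0_ler_powR; rewrite ?nnegrE ?(ltW p0)// (le_trans x0). Qed.

Lemma powRVK (x : R) : 0 <= x -> (x `^ p) `^ p^-1 = x.
Proof. by move=> x0; rewrite -powRrM divff ?gt_eqF// powRr1. Qed.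

Lemma powRKV (x : R) : 0 <= x -> (x `^ p^-1) `^ p = x.
Proof. by move=> x0; rewrite -powRrM mulVf ?gt_eqF// powRr1. Qed.

Lemma Lpnorm_leP V b (f : R -> V) (c : R) : 0 <= c ->
  (Lpnorm p b f <= c%:E)%E <-> (Ip b f <= (c `^ p)%:E)%E.
Proof.
move=> c0; rewrite LpnormE; have := Ip_ge0 b f.
case: (Ip b f) => [r||] //=; rewrite ?lee_fin ?leey// => r0.
  split=> h; first by have := powR_lexp (powR_ge0 _ _) h; rewrite powRKV.
  rewrite -(powRVK c0); apply: ge0_ler_powR => //.
  - by rewrite invr_ge0 ltW.
  - by rewrite nnegrE powR_ge0.
by rewrite gt_eqF ?invr_gt0//.
Qed.

Lemma powR_cvg (T : Type) (F : set_system T) (FF : Filter F) (u : T -> R) (l : R) :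
  (forall t, 0 <= u t) -> 0 <= l -> u @ F --> l -> u t `^ p @[t --> F] --> l `^ p.
Proof.
move=> u0 l0 ul; have [l00|l00] := eqVneq l 0; last first.
  have lp : 0 < l by rewrite lt_neqAle eq_sym l00 l0.
  apply: (@cvg_comp _ _ _ _ (fun x : R => x `^ p) _ _ _ ul).
  have dd := @is_derive1_powR R p l lp.
  have cp : {for l, continuous (fun x : R => x `^ p)}.
    by apply: differentiable_continuous; apply/derivable1_diffP; case: dd.
  exact: cp.
rewrite l00 powR0 ?gt_eqF//; rewrite l00 in ul.
apply/cvgrPdist_le => e e0; move/cvgrPdist_le : ul => /(_ (Num.min 1 e)).
rewrite lt_min ltr01 e0 => /(_ isT); apply: filterS => n /=.
rewrite !sub0r !normrN ![`|u _|]ger0_norm// le_min => /andP[h1 h2].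
rewrite ger0_norm ?powR_ge0//; apply: le_trans h2.
have [-> |h] := eqVneq (u n) 0; first by rewrite powR0 ?gt_eqF.
by apply: ge1r_powR; [rewrite h1 andbT lt_neqAle eq_sym h u0|exact: ltW].
Qed.

Lemma sm_Ip_measurable V b (f : R -> V) : strongly_measurable `[0, b] f ->
  measurable_fun `[0, b] (fun t => (N (f t) `^ p)%:E).
Proof.
move=> /sm_norm_measurable mf; apply/measurable_EFinP.
exact: (measurableT_comp (measurable_powR p)).
Qed.

Lemma Ip_ae V b (f g : R -> V) : strongly_measurable `[0, b] f -> strongly_measurable `[0, b] g ->
  {ae mu, forall t, 0 <= t <= b -> f t = g t} -> Ip b f = Ip b g.
Proof.
move=> mf mg fg; apply: ge0_ae_eq_integral => //; try exact: sm_Ip_measurable.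
- by move=> t _; rewrite lee_fin powR_ge0.
- by move=> t _; rewrite lee_fin powR_ge0.
- by move: fg; apply: ae_mono => t h; rewrite /= in_itv/= => /h ->.
Qed.

Lemma IpZ V b (c : K) (f : R -> V) : strongly_measurable `[0, b] f ->
  Ip b (fun t => c *: f t) = ((absK c `^ p)%:E * Ip b f)%E.
Proof.
move=> mf; rewrite /Ip -ge0_integralZl_EFin ?powR_ge0//; last 2 first.
- by move=> t _; rewrite lee_fin powR_ge0.
- exact: sm_Ip_measurable.
by apply: eq_integral => t _; rewrite rnormZ powRM ?absK_ge0// EFinM.
Qed.

Lemma Ip_bounded V b (f : R -> V) (C : R) : 0 <= b -> strongly_measurable `[0, b] f ->
  (forall t, 0 <= t <= b -> N (f t) <= C) -> (Ip b f <= (C `^ p * b)%:E)%E.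
Proof.
move=> b0 mf h; apply: (@le_trans _ _ (\int[mu]_(t in `[0%R, b]) (cst (C `^ p)%:E) t)%E).
  apply: ge0_le_integral => //; first by move=> t _; rewrite lee_fin powR_ge0.
    exact: sm_Ip_measurable.
  by move=> t; rewrite /= in_itv/= => tb; rewrite lee_fin powR_lexp// h.
rewrite integral_cst//= lebesgue_measure_itv/= lte_fin.
case: ltP => h0; first by rewrite -EFinD subr0 -EFinM.
by rewrite mule0 lee_fin mulr_ge0// powR_ge0.
Qed.

Lemma Lp_bounded V b (f : R -> V) (C : R) : 0 <= b -> strongly_measurable `[0, b] f ->
  (forall t, 0 <= t <= b -> N (f t) <= C) -> Lp p b f.
Proof.
move=> b0 mf h; split=> //; rewrite LpnormE.
have := Ip_bounded b0 mf h; have := Ip_ge0 b f.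
by case: (Ip b f) => [r||] //=; rewrite ?poweR_EFin ltry.
Qed.

Lemma Lp_cnt V b (f : R -> V) : 0 <= b -> cnt (seg 0 b) f -> Lp p b f.
Proof.
move=> b0 cf; have [C _ hC] := cnt_bounded b0 cf.
by apply: (Lp_bounded b0 (sm_cnt b0 cf)); exact: hC.
Qed.

Lemma Lp_loc_cnt V (f : R -> V) : cnt half f -> Lp_loc p f.
Proof. by move=> cf b b0; apply: Lp_cnt; rewrite ?(ltW b0)//; apply: cnt_seg_half; rewrite ?ltW. Qed.

Lemma Lp_simple V b (s : R -> V) : 0 <= b -> simple_function s -> Lp p b s.
Proof.
move=> b0 fs; apply: (@Lp_bounded _ _ _ (\sum_(x <- vals s) N x)) => //; first exact: sm_simple.
by move=> t _; rewrite (bigD1_seq (s t))/= ?mem_vals ?uniq_vals// lerDl sumr_ge0.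
Qed.

Lemma L1_le_Lp V b (f : R -> V) (c : R) : 0 <= b -> strongly_measurable `[0, b] f -> 0 < c ->
  (Lpnorm p b f <= c%:E)%E -> (L1 b f <= ((b + 1) * c)%:E)%E.
Proof.
move=> b0 mf c0 /(Lpnorm_leP _ _ (ltW c0)) h.
have cp : 0 < c `^ p by rewrite powR_gt0.
apply: (@le_trans _ _ (\int[mu]_(t in `[0%R, b]) (cst c%:E t + (c / c `^ p)%:E * (N (f t) `^ p)%:E))%E).
  apply: ge0_le_integral => //.
  - by move=> t _; rewrite lee_fin.
  - exact: sm_norm_emeasurable.
  - apply: emeasurable_funD; first exact: measurable_cst.
    by apply: measurable_funeM; exact: sm_Ip_measurable.
  - move=> t _; rewrite /= -EFinM -EFinD lee_fin mulrAC -mulrA.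
    have -> : N (f t) = c * (N (f t) / c) by rewrite mulrC divfK// gt_eqF.
    set x := N (f t) / c; have x0 : 0 <= x by rewrite divr_ge0// ltW.
    have [x1|x1] := leP x 1.
      rewrite -[leLHS]addr0 lerD//; first by rewrite -[leRHS]mulr1 ler_wpM2l// ltW.
      by rewrite mulr_ge0 ?(ltW c0)// divr_ge0// ?powR_ge0.
    rewrite -[leLHS]add0r lerD ?(ltW c0)// ler_wpM2l ?(ltW c0)//.
    by rewrite powRM ?(ltW c0)// mulrAC divff ?gt_eqF// mul1r; apply: le1r_powR; exact: ltW.
have cc : 0 <= c / c `^ p by rewrite divr_ge0// ltW.
rewrite ge0_integralD//; last 3 first.
- by move=> t _; rewrite lee_fin ltW.
- by move=> t _; rewrite -EFinM lee_fin mulr_ge0// powR_ge0.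
- by apply: measurable_funeM; exact: sm_Ip_measurable.
rewrite ge0_integralZl_EFin//; last 2 first.
- by move=> t _; rewrite lee_fin powR_ge0.
- exact: sm_Ip_measurable.
rewrite mulrDl mul1r EFinD; apply: leeD.
  rewrite integral_cst//= lebesgue_measure_itv/= lte_fin.
  case: ltP => h0; first by rewrite -EFinD subr0 -EFinM mulrC.
  by rewrite mule0 lee_fin mulr_ge0// ltW.
apply: (@le_trans _ _ ((c / c `^ p)%:E * (c `^ p)%:E)%E); first by rewrite lee_pmul// ?lee_fin// Ip_ge0.
by rewrite -EFinM divfK// gt_eqF.
Qed.

(** Convergence is asked for [0 < t] only: iterated smoothings vanish at 0 whatever the limit, and
    that point is negligible. *)
Lemma Ip_dominated V b (f : R -> V) (g : nat -> R -> V) (C : R) : 0 <= b ->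
  strongly_measurable `[0, b] f -> (forall n, strongly_measurable `[0, b] (g n)) ->
  (forall n t, 0 <= t <= b -> N (g n t) <= C) ->
  (forall t, 0 < t <= b -> g n t @[n --> \oo] --> f t) ->
  Ip b (g n) @[n --> \oo] --> Ip b f.
Proof.
move=> b0 mf mg gC gf.
have C0 : 0 <= C by rewrite (le_trans _ (gC 0%N 0 _)) ?lexx.
have [] := @dominated_convergence _ _ R mu `[0, b]%classic (measurable_seg b)
  (fun n t => (N (g n t) `^ p)%:E) (fun t => (N (f t) `^ p)%:E) (cst (C `^ p)%:E) => //.
- by move=> n; exact: sm_Ip_measurable.
- exact: sm_Ip_measurable.
- have : {ae mu, forall t, t != 0}.
    exists [set 0]; split; first exact: measurable_set1.
      exact: lebesgue_measure_set1.
    by move=> t /= /negP; rewrite negbK => /eqP.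
  apply: ae_mono => t t0; rewrite /= in_itv/= => /andP[t1 t2].
  apply: cvg_EFin; first by apply: nearW.
  have tp : 0 < t by rewrite lt_neqAle eq_sym t0.
  have := rnorm_cvg (gf t _); rewrite tp t2 => /(_ isT) hN.
  by apply: powR_cvg hN => // n; exact: rnorm_ge0.
- apply/integrableP; split; first exact: measurable_cst.
  rewrite integral_cst//= lebesgue_measure_itv/= lte_fin.
  by case: (ltP 0 b) => h0; [rewrite -EFinD -EFinM ltry|rewrite mule0 ltry].
- apply: aeW => t n; rewrite /= in_itv/= => tb.
  by rewrite ger0_norm ?powR_ge0// lee_fin powR_lexp// gC.
Qed.

(** The clamp at 0 gives an integrand continuous on the whole line, ready for the change of
    variables in [Ip_shift]. *)
Lemma continuous_norm_pow V (f : R -> V) : cnt half f ->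
  continuous (fun s : R => N (f (Num.max 0 s)) `^ p).
Proof.
move=> cf s.
have hN : N (f (Num.max 0 u)) @[u --> s] --> N (f (Num.max 0 s)).
  apply/cvgrPdist_le => e e0; have ms u : half (Num.max (0 : R) u) by rewrite /half/= le_max lexx.
  have [d d0 hd] := cf _ (ms s) e e0; exists d => //= u /= su.
  have : `|Num.max 0 u - Num.max 0 s| < d.
    apply: le_lt_trans su; rewrite distrC.
    have [h1|h1] := leP 0 u; have [h2|h2] := leP 0 s; rewrite ?lexx// ?subrr ?normr0//.
      by rewrite !ler0_norm; lra.
    by rewrite !ger0_norm; lra.
  move=> /(hd _ (ms u)) h; rewrite ler_norml.
  have := rnorm_split (f (Num.max 0 u)) (f (Num.max 0 s)).
  have := rnorm_split (f (Num.max 0 s)) (f (Num.max 0 u)).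
  by rewrite [N (f (Num.max 0 s) - _)]rdistC; lra.
by apply: powR_cvg hN => // u; exact: rnorm_ge0.
Qed.

Lemma Ip_shift V (f : R -> V) (a d : R) : cnt half f -> 0 <= a -> 0 < d ->
  (Ip (d + a) f <= Ip a f + Ip d (fun s => f (s + a)%R))%E.
Proof.
move=> cf a0 d0; pose G (s : R) := N (f (Num.max 0 s)) `^ p.
have cG : continuous G := continuous_norm_pow cf.
have mG : measurable_fun setT G by exact: continuous_measurable_fun.
have mGE (D : set R) : measurable_fun D (EFin \o G).
  by apply/measurable_EFinP; apply: measurable_funTS.
have IG b (g : R -> V) : (forall s, 0 <= s <= b -> g s = f s) -> Ip b g = (\int[mu]_(s in `[0%R, b]) (G s)%:E)%E.
  move=> gf; apply: eq_integral => s; rewrite inE/= in_itv/= => sb.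
  by rewrite /G max_r ?gf//; case/andP: sb.
rewrite (IG _ f)// (IG _ f)//.
have G0 s : 0 <= G s by exact: powR_ge0.
have sub : (Ip d (fun s => f (s + a)%R) = \int[mu]_(s in `[a, (d + a)%R]) (G s)%:E)%E.
  have F1 : (fun x : R => x + a)^`()%classic = cst 1.
    by apply/funext => x; rewrite derive1E deriveD// derive_id derive_cst addr0.
  have := @integration_by_substitution_increasing R (fun x => x + a) G 0 d (ltW d0).
  rewrite add0r => ->.
  - apply: eq_integral => s; rewrite inE/= in_itv/= => /andP[s0 sd].
    by rewrite F1 /= !fctE /cst /= mulr1 /G max_r// addr_ge0.
  - by move=> x y _ _; rewrite ltrD2r.
  - by rewrite F1 => x _; exact: cvg_cst.
  - by rewrite F1; exact: is_cvg_cst.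
  - by rewrite F1; exact: is_cvg_cst.
  - split.
    + by move=> x _; exact: derivableD.
    + by apply: cvg_at_right_filter; apply: cvgD => //; exact: cvg_cst.
    + by apply: cvg_at_left_filter; apply: cvgD => //; exact: cvg_cst.
  - exact: continuous_subspaceT.
rewrite sub.
have -> : `[0, d + a]%classic = `[0, a]%classic `|` `]a, d + a]%classic :> set R.
  apply/seteqP; split=> s /=; rewrite !in_itv/=; last by case; lra.
  by move=> /andP[s0 sd]; have [sa|sa] := leP s a; [left|right]; lra.
rewrite ge0_integral_setU; last 5 first.
- exact: measurable_itv.
- exact: measurable_itv.
- exact: mGE.
- by move=> s _; rewrite lee_fin.
- by apply/disj_setPS => s [] /=; rewrite !in_itv/=; lra.
apply: leeD; first exact: lexx.
apply: ge0_subset_integral.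
- exact: measurable_itv.
- exact: measurable_itv.
- exact: mGE.
- by move=> s _; rewrite lee_fin.
- by move=> s /=; rewrite !in_itv/=; lra.
Qed.

End LpEstimates.

Section Reversal.
Context (R : realType) (k : scalar_kind).
Local Notation K := (scalars k R).
Local Notation r2K := (@of_real k R).
Variables (V : completeNormedModType K).

Lemma cnt_rev (f : R -> V) t : cnt half f -> cnt (seg 0 t) (fun s => f (t - s)).
Proof.
move=> cf s /andP[s0 st] e e0; have ts : half (t - s) by rewrite /half/= subr_ge0.
have [d d0 hd] := cf _ ts e e0; exists d => // u /andP[u0 ut] us.
apply: hd; first by rewrite /half/= subr_ge0.
by rewrite opprD addrACA subrr add0r -opprD normrN.
Qed.

Lemma der_rev (f f' : R -> V) t : der half f f' ->
  der (seg 0 t) (fun s => f (t - s)) (fun s => - f' (t - s)).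
Proof.
move=> df s /andP[s0 st] e e0; have ts : half (t - s) by rewrite /half/= subr_ge0.
have [d d0 hd] := df _ ts e e0; exists d => // u /andP[u0 ut] us.
have := hd (t - u); rewrite /half/= subr_ge0 => /(_ ut).
have -> : t - u - (t - s) = - (u - s) by ring.
by rewrite normrN of_realN scaleNr scalerN => /(_ us).
Qed.

Lemma smooth_cst n (x : V) t : 0 <= t ->
  smooth n (fun=> x) t = r2K (1 - expR (- n * t)) *: x.
Proof.
move=> t0; apply/esym.
have d := der_scale (@rder_expR R half (- n)) (@der_cst R k half V x).
apply: (smooth_unique (n := n) (h := fun t => r2K (1 - expR (- n * t)) *: x)
   (h' := fun s => r2K (n * expR (- n * s)) *: x) (@cnt_cst R k half V x) _ _ _ t0).
- apply: (der_ext _ _ (derB (@der_cst R k half V x) d)) => s s0.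
    by rewrite of_realB of_real1 scalerBl scale1r.
  by rewrite scaler0 addr0 sub0r -scaleNr -of_realN (mulNr n (expR _)) opprK.
- by rewrite mulr0 expR0 subrr of_real0 scale0r.
- move=> s s0; rewrite -[X in X - _]scale1r -of_real1 -scalerBl -of_realB scalerA -of_realM.
  by congr (r2K _ *: _); ring.
Qed.

(** The distribution function of the sum of two independent exponential times of rate [n], that is,
    the double smoothing of the constant 1. *)
Definition ramp2 (n t : R) : R := 1 - expR (- n * t) - n * t * expR (- n * t).

Lemma smooth2_cst n (x : V) t : 0 <= t ->
  smooth n (smooth n (fun=> x)) t = r2K (ramp2 n t) *: x.
Proof.
move=> t0; apply/esym; have cx := @cnt_cst R k half V x.
have d := der_scale (@rder_expR R half (- n)) (@der_cst R k half V x).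
have d1 := der_prim cx.
have pE s : 0 <= s -> prim (fun=> x) s = r2K s *: x.
  move=> s0; have := prim_unique (h := fun s => r2K s *: x) cx _ s0.
  rewrite of_real0 scale0r add0r => <- // u u0 e e0; exists 1 => // v v0 _.
  by rewrite of_realB -!scalerBl subrr scale0r rnorm0 mulr_ge0// ltW.
have d2 := derZ (r2K n) (der_scale (@rder_expR R half (- n)) d1).
apply: (smooth_unique (n := n) (h := fun t => r2K (ramp2 n t) *: x)
   (h' := fun s => r2K (n * (n * s * expR (- n * s))) *: x) (cnt_smooth n cx) _ _ _ t0).
- apply: (der_ext _ _ (derB (derB (@der_cst R k half V x) d) d2)) => s s0.
    rewrite pE// !scalerA -!of_realM -[X in X - _ - _]scale1r -of_real1 -!scalerBl -!of_realB.
    by congr (r2K _ *: _); rewrite /ramp2; ring.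
  rewrite pE// scaler0 addr0 sub0r scalerDr !scalerA -!of_realM -scalerDl -of_realD -!scaleNr.
  by rewrite -!of_realN -scalerDl -of_realD; congr (r2K _ *: _); ring.
- by rewrite /ramp2 !mulr0 mul0r expR0 subrr subr0 of_real0 scale0r.
- move=> s s0; rewrite smooth_cst// -scalerBl -of_realB scalerA -of_realM.
  by congr (r2K _ *: _); rewrite /ramp2; ring.
Qed.

End Reversal.

(** * Boundary control systems *)

Section BoundarySystem.
Context (R : realType) (k : scalar_kind).
Local Notation K := (scalars k R).
Local Notation r2K := (@of_real k R).
Local Notation N := rnorm.
Variables (X U Z : completeNormedModType K).
Variables (iZ Am : {linear Z -> X}) (G M : {linear Z -> U}).
Variable T : R -> {linear X -> X}.
Hypothesis bd : boundary_setting iZ Am G M T.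
Let hT : c0_semigroup T := T_semigroup bd.
Local Notation A := (generator T).
Local Notation Res := (resolvent (generator T)).
Local Notation obs := (observe iZ M).

Lemma mainE : main_operator iZ Am G = A.
Proof. by rewrite (T_generator bd). Qed.

Lemma mainP x y : A (x, y) <-> exists z, [/\ G z = 0, iZ z = x & Am z = y].
Proof.
rewrite -mainE /main_operator; split=> [[z Gz [<- <-]]|[z [Gz <- <-]]]; first by exists z.
by exists z.
Qed.

Lemma observe_iZ z : obs (iZ z) = M z.
Proof.
rewrite /observe pinvKV ?inE// => x y _ _; exact: (iZ_injective bd).
Qed.

(** [observe] is total but linear only on the range of [iZ], hence on the domain of [A]. Composed
    with a resolvent it becomes linear on all of [X]. *)
Lemma observe_comb (c : K) x y x' y' : A (x, y) -> A (x', y') ->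
  obs (c *: x + x') = c *: obs x + obs x'.
Proof.
move=> /mainP[z [_ <- _]] /mainP[z' [_ <- _]].
by rewrite -linearZ/= -linearD !observe_iZ linearD linearZ.
Qed.

Section Observe.
Variable lam : K.
Hypothesis hl : resolvent_set A lam.
Let cres x := obs (Res lam x).

Lemma observe_resB : {morph cres : x y / x - y}.
Proof.
move=> x y; rewrite /cres resolventB// addrC -scaleN1r.
rewrite (observe_comb (-1) (resolvent_gen hl) (resolvent_gen hl)).
by rewrite scaleN1r addrC.
Qed.

Lemma observe_resZ (c : K) x : cres (c *: x) = c *: cres x.
Proof.
rewrite /cres resolventZ// -[c *: _]addr0.
have g0 : A (0, 0) by exact: generator0.
rewrite (observe_comb c (resolvent_gen hl) g0) -[in obs 0](linear0 iZ) observe_iZ.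
by rewrite linear0 addr0.
Qed.

Lemma observe_resD : {morph cres : x y / x + y}.
Proof.
by move=> x y; rewrite -[y in LHS]opprK observe_resB -[- y]scaleN1r observe_resZ scaleN1r opprK.
Qed.
End Observe.

Lemma observe_graph_bound : exists2 c : R, 0 <= c & forall x y, A (x, y) ->
  N (obs x) <= c * (N x + N y).
Proof.
have [c hc] := C_bounded bd; exists `|c| => // x y /mainP[z [Gz <- <-]].
rewrite observe_iZ (le_trans (hc z Gz))// ler_wpM2r ?addr_ge0//.
exact: ler_norm.
Qed.

Lemma observe_res_bound lam : resolvent_set A lam ->
  exists2 c : R, 0 <= c & forall x, N (obs (Res lam x)) <= c * N x.
Proof.
move=> hl; have [c c0 hc] := observe_graph_bound.
have [b b0 hb] := resolvent_bounded hl.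
have l0 := absK_ge0 lam.
exists (c * (b + absK lam * b + 1)).
  by rewrite mulr_ge0// !addr_ge0// mulr_ge0.
move=> x; rewrite (le_trans (hc _ _ (resolvent_gen hl)))// -mulrA ler_wpM2l//.
rewrite !mulrDl mul1r -addrA lerD// (le_trans (rnormB _ _))// lerD// rnormZ -mulrA.
by rewrite ler_wpM2l.
Qed.

(** Existence: any lift [z0] of [u], corrected by the element [z1] of the kernel of [G] representing
    R(lam) (lam z0 - Am z0), solves both equations. *)
Lemma dirichlet_spec lam u : resolvent_set A lam ->
  Am (dirichlet iZ Am G lam u) = lam *: iZ (dirichlet iZ Am G lam u) /\
  G (dirichlet iZ Am G lam u) = u.
Proof.
move=> hl; have [z0 _ Gz0] := G_surjective bd (I : setT u).
have /mainP[z1 [Gz1 iz1 az1]] := resolvent_gen (x := lam *: iZ z0 - Am z0) hl.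
apply: (@xgetI _ 0 [set z | Am z = lam *: iZ z /\ G z = u] (z0 - z1)).
split; last by rewrite linearB Gz1 Gz0 subr0.
by rewrite !linearB/= iz1 az1; zmod.
Qed.

Lemma boundary_decomposition lam z : resolvent_set A lam ->
  exists2 z0, G z0 = 0 & z = dirichlet iZ Am G lam (G z) + z0.
Proof.
move=> hl; exists (z - dirichlet iZ Am G lam (G z)); last by zmod.
by rewrite linearB/= (dirichlet_spec _ hl).2 subrr.
Qed.

Section Extrapolation.
Variables (Xm1 : completeNormedModType K) (j : {linear X -> Xm1}).
Variables (Tm1 : R -> {linear Xm1 -> Xm1}) (Am1 : {linear X -> Xm1}).
Variable B : {linear U -> Xm1}.
Hypothesis ex : extrapolation_setting iZ Am G T j Tm1 Am1.
Hypothesis ct : is_control_operator iZ Am G j Am1 B.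
Let hT1 : c0_semigroup Tm1 := Tm1_semigroup ex.

Lemma beta_exists : exists2 beta, resolvent_set A beta &
  forall x, N (j x) = N (Res beta x).
Proof. by have := j_norm ex; rewrite mainE. Qed.

Lemma j_inj : injective j.
Proof.
have [b hb jb] := beta_exists.
move=> x y jxy; apply/eqP; rewrite -subr_eq0; apply/eqP; set z := x - y.
have : N (j z) = 0 by rewrite linearB jxy subrr rnorm0.
rewrite jb => /rnorm0_eq0 rz; have := resolvent_gen (x := z) hb; rewrite rz scaler0 sub0r => g.
have g0 : A (0, 0) by exact: generator0.
by have /eqP := generator_fun g g0; rewrite oppr_eq0 => /eqP.
Qed.

Lemma j_bounded : exists2 c : R, 0 <= c & forall x, N (j x) <= c * N x.
Proof.
have [b hb jb] := beta_exists; have [c c0 hc] := resolvent_bounded hb.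
by exists c => // x; rewrite jb.
Qed.

Lemma jB : {morph j : x y / x - y}. Proof. by move=> x y; rewrite linearB. Qed.
Lemma jZ a x : j (r2K a *: x) = r2K a *: j x. Proof. by rewrite linearZ. Qed.

Lemma cnt_j (D : set R) (f : R -> X) : cnt D f -> cnt D (j \o f).
Proof. by have [c _ hc] := j_bounded; move=> cf; exact: (cnt_lin jB hc cf). Qed.

Lemma der_j (D : set R) (f f' : R -> X) : der D f f' -> der D (j \o f) (j \o f').
Proof. by have [c _ hc] := j_bounded; move=> df; exact: (der_lin jB jZ hc df). Qed.

Lemma smooth_j n (f : R -> X) t : cnt half f -> 0 <= t ->
  j (smooth n f t) = smooth n (j \o f) t.
Proof. by have [c _ hc] := j_bounded; move=> cf t0; exact: (smooth_lin n jB jZ hc cf t0). Qed.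

Lemma BB : {morph B : x y / x - y}. Proof. by move=> x y; rewrite linearB. Qed.
Lemma BZ a x : B (r2K a *: x) = r2K a *: B x. Proof. by rewrite linearZ. Qed.

Lemma B_bounded : exists2 c : R, 0 <= c & forall x, N (B x) <= c * N x.
Proof. by apply/continuous_linearP; case: ct. Qed.

Lemma cnt_B (D : set R) (f : R -> U) : cnt D f -> cnt D (B \o f).
Proof. by have [c _ hc] := B_bounded; move=> cf; exact: (cnt_lin BB hc cf). Qed.

Lemma smooth_B n (f : R -> U) t : cnt half f -> 0 <= t ->
  B (smooth n f t) = smooth n (B \o f) t.
Proof. by have [c _ hc] := B_bounded; move=> cf t0; exact: (smooth_lin n BB BZ hc cf t0). Qed.

Lemma Tm1_gen x : generator Tm1 (j x, Am1 x).
Proof. by rewrite (Tm1_generator ex); exists x. Qed.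

(** [A] is the part of [Am1] in [X]. Convergence of difference quotients in [Xm1] says nothing in
    [X], so the integrated orbit identity is pulled back through the injective [j] instead. *)
Lemma Am1_gen x y : Am1 x = j y -> A (x, y).
Proof.
move=> axy; apply: (generator_of_prim hT) => t t0; apply: j_inj.
have := Tm1_gen (x := x); rewrite axy => g.
have [c _ hc] := j_bounded.
have := prim_unique (cnt_lin jB hc (orbit_cnt hT y)) (der_lin jB jZ hc (der_prim (orbit_cnt hT y))) t0.
rewrite /= prim0 ?linear0 ?add0r => [->|]; last exact: orbit_cnt.
rewrite linearB -(Tm1_extends ex)// (generator_eq hT1 g t0); apply: prim_ext => s s0.
by rewrite (Tm1_extends ex).
Qed.

Lemma Am1_T t x : 0 <= t -> Am1 (T t x) = Tm1 t (Am1 x).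
Proof.
move=> t0; have := generator_T hT1 t0 (Tm1_gen (x := x)); rewrite (Tm1_extends ex)// => g.
exact: (generator_fun (Tm1_gen (x := T t x)) g).
Qed.

(** On the kernel of [G] this is the extension property of [Am1]; on Dirichlet states it is the
    formula defining [B]. The decomposition of [Z] combines the two. *)
Lemma Am1_iZ z : Am1 (iZ z) + B (G z) = j (Am z).
Proof.
have [b hb _] := beta_exists; have [z0 Gz0 ->] := boundary_decomposition z hb.
rewrite !linearD/= Gz0 linear0 addr0; set d := dirichlet _ _ _ _ _.
have [hd1 hd2] := dirichlet_spec (G z) hb; rewrite -/d in hd1 hd2; rewrite hd2.
have hm : resolvent_set (main_operator iZ Am G) b by rewrite mainE.
have -> : B (G z) = b *: j (iZ d) - Am1 (iZ d) by rewrite (ct.2 b hm).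
have -> : Am1 (iZ z0) = j (Am z0).
  by apply: (Am1_extends ex); rewrite mainE; apply/mainP; exists z0.
by rewrite hd1 linearZ/=; zmod.
Qed.

Lemma boundary_representation x u y : Am1 x + B u = j y ->
  exists z, [/\ iZ z = x, G z = u & Am z = y].
Proof.
move=> h; have [b hb _] := beta_exists; pose d := dirichlet iZ Am G b u.
have [hd1 hd2] := dirichlet_spec u hb; rewrite -/d in hd1 hd2.
have : Am1 (x - iZ d) = j (y - Am d).
  by have := Am1_iZ d; rewrite hd2 !linearB/= -h => <-; zmod.
move=> /Am1_gen/mainP[z [Gz iz az]]; exists (z + d).
by rewrite !linearD/= iz az Gz hd2 add0r !subrK.
Qed.

(** Classical trajectories from rest: [q' = Am1 q + B f], the derivative being taken in [Xm1].
    Continuity of [Am1 \o q] there is what smoothing by a closed operator requires. *)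
Definition strict (q : R -> X) (f : R -> U) : Prop :=
  [/\ cnt half q, cnt half f, cnt half (Am1 \o q), q 0 = 0 &
      der half (j \o q) (fun s => Am1 (q s) + B (f s))].

(** [Am1] is closed as a generator in [Xm1], so it commutes with smoothing. The equation is smoothed
    in integrated form, where [q 0 = 0] leaves no initial term. *)
Lemma strict_smooth n q f : strict q f -> strict (smooth n q) (smooth n f).
Proof.
move=> [cq cf ca q0 dq]; have cs := cnt_smooth n cq.
have cg : cnt half (fun s => Am1 (q s) + B (f s)) by apply: cntD ca _; exact: cnt_B.
have AmE t : 0 <= t -> Am1 (smooth n q t) = smooth n (Am1 \o q) t.
  move=> t0; have := smooth_generator (n := n) hT1 (cnt_j cq) ca t0 (fun s _ => Tm1_gen (x := q s)).
  rewrite -smooth_j// => g; exact: (generator_fun (Tm1_gen (x := smooth n q t)) g).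
have gE t : 0 <= t -> smooth n (fun s => Am1 (q s) + B (f s)) t =
    Am1 (smooth n q t) + B (smooth n f t).
  by move=> t0; rewrite AmE// smooth_B//; exact: smoothD ca (cnt_B cf) t0.
split=> //; try exact: cnt_smooth.
- by apply: cnt_ext (cnt_smooth n ca) => t t0; rewrite /= AmE.
- exact: smooth0.
have jE t : 0 <= t -> prim (smooth n (fun s => Am1 (q s) + B (f s))) t = (j \o smooth n q) t.
  move=> t0; rewrite -smooth_prim// /= smooth_j//; apply: smooth_ext => s s0.
  by have := prim_unique cg dq s0; rewrite /= q0 linear0 add0r.
apply: (der_ext _ _ (der_prim (cnt_smooth n cg))) => t t0; first exact: jE.
exact: gE.
Qed.

(** The derivative of [Tm1 (t - s) (j (q s))] in [s] is the integrand, the two [Am1] terms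
    cancelling; the end values are [j (q t)] and 0. *)
Lemma strict_input q f t : strict q f -> 0 <= t ->
  is_bochner 0 t (fun s => Tm1 (t - s) (B (f s))) (j (q t)).
Proof.
move=> [cq cf ca q0 dq] t0; have [C C1 hC] := sg_bound hT1 t.
have ts s : seg 0 t s -> 0 <= t - s <= t.
  by move=> /andP[s0 st]; rewrite subr_ge0 st gerBl s0.
have LB s : seg 0 t s -> {morph (fun x => Tm1 (t - s) x) : x y / x - y}.
  by move=> _ x y; rewrite linearB.
have LZ s a x : seg 0 t s -> Tm1 (t - s) (r2K a *: x) = r2K a *: Tm1 (t - s) x.
  by move=> _; rewrite linearZ.
have Lc s x : seg 0 t s -> N (Tm1 (t - s) x) <= C * N x by move=> /ts; exact: hC.
have Lcnt x s : seg 0 t s -> cnt_at (seg 0 t) (fun s => Tm1 (t - s) x) s.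
  exact: (cnt_rev (t := t) (orbit_cnt hT1 x)).
have dh := der_op LB LZ Lc (Lf' := fun s => - Tm1 (t - s) (Am1 (q s))) Lcnt
  (fun s hs => der_rev (t := t) (generator_der hT1 (Tm1_gen (x := q s))) hs)
  (der_sub (seg_half (lexx 0)) dq).
have ci : cnt (seg 0 t) (fun s => Tm1 (t - s) (B (f s))).
  apply: (cnt_op LB Lc (f := B \o f)) => [s hs|]; first exact: Lcnt.
  by apply: cnt_sub (cnt_B cf); exact: seg_half.
have dh' : der (seg 0 t) (fun s => Tm1 (t - s) (j (q s))) (fun s => Tm1 (t - s) (B (f s))).
  apply: (der_ext _ _ dh) => s hs //; rewrite linearD; zmod.
have := is_bochner_ftc t0 ci dh'.
by rewrite subrr subr0 (c0_id hT1) q0 !linear0 addr0.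
Qed.

Lemma input_map_strict q f t : strict q f -> 0 <= t -> input_map Tm1 B t f = j (q t).
Proof. by move=> h t0; apply: bochnerE; exact: strict_input. Qed.

Lemma io_map_strict q f t z : strict q f -> 0 <= t -> iZ z = q t ->
  io_map iZ M j Tm1 B f t = M z.
Proof.
move=> h t0 iz; rewrite /io_map (input_map_strict h t0) -iz.
rewrite -[j (iZ z)]/((j \o iZ) z) pinvKV ?inE// => x y _ _ /j_inj.
exact: (iZ_injective bd).
Qed.

End Extrapolation.
End BoundarySystem.

(** * Observation along curves in the domain of a semigroup generator *)

Section ObserveAlong.
Context (R : realType) (k : scalar_kind).
Local Notation K := (scalars k R).
Local Notation r2K := (@of_real k R).
Local Notation N := rnorm.
Variables (X U Z : completeNormedModType K).
Variables (iZ Am : {linear Z -> X}) (G M : {linear Z -> U}).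
Variable T : R -> {linear X -> X}.
Hypothesis bd : boundary_setting iZ Am G M T.
Local Notation obs := (observe iZ M).

Lemma observe_range (a : K) x y : range iZ x -> range iZ y -> obs (a *: x + y) = a *: obs x + obs y.
Proof.
move=> [z _ <-] [z' _ <-]; rewrite -linearZ/= -linearD !(observe_iZ bd).
by rewrite linearD linearZ.
Qed.

Variable S : R -> {linear X -> X}.
Hypothesis hS : c0_semigroup S.
Hypothesis gen_range : forall x y, generator S (x, y) -> range iZ x.
Variable c : R.
Hypothesis gen_bound : forall x y, generator S (x, y) -> N (obs x) <= c * (N x + N y).

Let observe_rangeB x y : range iZ x -> range iZ y -> obs (x - y) = obs x - obs y.
Proof. by move=> hx hy; rewrite addrC -scaleN1r observe_range// scaleN1r addrC. Qed.

Let range0 : range iZ 0. Proof. by exists 0; rewrite ?linear0. Qed.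

Let observe_rangeZ a x : range iZ x -> obs (a *: x) = a *: obs x.
Proof.
move=> hx; rewrite -[a *: x]addr0 observe_range// -[in obs 0](linear0 iZ) (observe_iZ bd).
by rewrite linear0 addr0.
Qed.

Lemma observe_cnt (D : set R) f g : cnt D f -> cnt D g ->
  (forall s, D s -> generator S (f s, g s)) -> cnt D (obs \o f).
Proof.
move=> cf cg fg s Ds e e0; have c0 : 0 < 2 * (`|c| + 1) by rewrite mulr_gt0// ltr_wpDl.
have e1 := divr_gt0 e0 c0.
have [d1 d10 h1] := cf s Ds _ e1; have [d2 d20 h2] := cg s Ds _ e1.
exists (Num.min d1 d2) => [|t Dt]; first by rewrite lt_min d10.
rewrite lt_min => /andP[/(h1 _ Dt) {}h1 /(h2 _ Dt) {}h2] /=.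
rewrite -observe_rangeB; [|exact: gen_range (fg _ Dt)|exact: gen_range (fg _ Ds)].
rewrite (le_trans (gen_bound (generatorB (fg _ Dt) (fg _ Ds))))//.
rewrite (le_trans (ler_wpM2r (addr_ge0 (rnorm_ge0 _) (rnorm_ge0 _)) (ler_norm c)))//.
rewrite (le_trans (ler_wpM2l (normr_ge0 c) (lerD h1 h2)))//.
rewrite [leRHS](_ : e = (`|c| + 1) * (e / (2 * (`|c| + 1)) + e / (2 * (`|c| + 1)))).
  by rewrite ler_wpM2r ?lerDl// addr_ge0// ltW.
by field; rewrite gt_eqF// ltr_wpDl.
Qed.

Lemma observe_der (D : set R) f f' g g' : der D f f' -> der D g g' ->
  (forall s, D s -> generator S (f s, g s)) -> (forall s, D s -> generator S (f' s, g' s)) ->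
  der D (obs \o f) (obs \o f').
Proof.
move=> df dg fg fg' s Ds e e0; have c0 : 0 < 2 * (`|c| + 1) by rewrite mulr_gt0// ltr_wpDl.
have e1 := divr_gt0 e0 c0.
have [d1 d10 h1] := df s Ds _ e1; have [d2 d20 h2] := dg s Ds _ e1.
exists (Num.min d1 d2) => [|t Dt]; first by rewrite lt_min d10.
rewrite lt_min => /andP[/(h1 _ Dt) {}h1 /(h2 _ Dt) {}h2] /=.
have rt := gen_range (fg _ Dt); have rs := gen_range (fg _ Ds); have rs' := gen_range (fg' _ Ds).
have gZ := generatorZ (r2K (t - s)) (fg' _ Ds).
have rts := gen_range (generatorB (fg _ Dt) (fg _ Ds)); have rz := gen_range gZ.
rewrite -(observe_rangeZ _ rs') -(observe_rangeB rt rs) -(observe_rangeB rts rz).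
rewrite (le_trans (gen_bound (generatorB (generatorB (fg _ Dt) (fg _ Ds)) gZ)))//.
rewrite (le_trans (ler_wpM2r (addr_ge0 (rnorm_ge0 _) (rnorm_ge0 _)) (ler_norm c)))//.
rewrite (le_trans (ler_wpM2l (normr_ge0 c) (lerD h1 h2)))//.
rewrite [leRHS](_ : _ = (`|c| + 1) * (e / (2 * (`|c| + 1)) * `|t - s| + e / (2 * (`|c| + 1)) * `|t - s|)).
  by rewrite ler_wpM2r ?lerDl// addr_ge0// mulr_ge0// ltW.
by field; rewrite gt_eqF// ltr_wpDl.
Qed.

(** [observe] is bounded only for a graph norm, so curves come in pairs [(f, g)] with [g] the
    generator applied to [f]. The semigroup [S] is left abstract because both [T] and [Tcl] are
    needed. *)
Lemma observe_smooth n f g t : cnt half f -> cnt half g ->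
  (forall s, 0 <= s -> generator S (f s, g s)) -> 0 <= t ->
  obs (smooth n f t) = smooth n (obs \o f) t.
Proof.
move=> cf cg fg t0.
have sfg s : 0 <= s -> generator S (smooth n f s, smooth n g s).
  by move=> s0; exact: (smooth_generator (n := n) hS cf cg s0 fg).
have dfg s : 0 <= s -> generator S (r2K n *: (f s - smooth n f s), r2K n *: (g s - smooth n g s)).
  by move=> s0; exact: generatorZ (generatorB (fg s s0) (sfg s s0)).
have d := observe_der (der_smooth n cf) (der_smooth n cg) sfg dfg.
have co := observe_cnt cf cg fg.
apply: (smooth_unique (h := obs \o smooth n f) co d) => //=.
  by rewrite smooth0// -(linear0 iZ) (observe_iZ bd) linear0.
move=> s s0; rewrite observe_rangeZ ?observe_rangeB//.
- exact: gen_range (fg s s0).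
- exact: gen_range (sfg s s0).
- exact: gen_range (generatorB (fg s s0) (sfg s s0)).
Qed.

End ObserveAlong.

(** * Responses to constant controls *)

Section Boundary.
Context (R : realType) (k : scalar_kind) (p : R).
Local Notation K := (scalars k R).
Local Notation r2K := (@of_real k R).
Local Notation N := rnorm.
Hypothesis p1 : 1 < p.
Let p0 : 0 < p. Proof. exact: lt_trans p1. Qed.

Lemma der_W1p (V : completeNormedModType K) (h f : R -> V) :
  cnt half f -> der half h f -> W1p_loc p h f.
Proof.
move=> cf df; split; [exact: (Lp_loc_cnt p1 (der_cnt df))|exact: (Lp_loc_cnt p1 cf)|].
by move=> t t0; rewrite (bochnerE (is_bochner_prim t0 cf)); exact: prim_unique.
Qed.

Lemma smooth_W2p0 (V : completeNormedModType K) n (y : R -> V) :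
  cnt half y -> W2p0_loc p (smooth n (smooth n y)).
Proof.
move=> cy; have cs := cnt_smooth n cy; have css := cnt_smooth n cs.
exists (fun t => r2K n *: (smooth n y t - smooth n (smooth n y) t)).
exists (fun t => r2K n *: (r2K n *: (y t - smooth n y t) -
                           r2K n *: (smooth n y t - smooth n (smooth n y) t))).
split.
- apply: der_W1p (der_smooth n cs); exact: (cntZ (r2K n) (cntB cs css)).
- apply: der_W1p; last first.
    exact: (derZ (r2K n) (derB (der_smooth n cy) (der_smooth n cs))).
  exact: (cntZ (r2K n) (cntB (cntZ (r2K n) (cntB cy cs)) (cntZ (r2K n) (cntB cs css)))).
- exact: smooth0.
- by rewrite !smooth0// subrr scaler0.
Qed.

Lemma smooth_deriv (V : completeNormedModType K) n (f f' : R -> V) t :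
  cnt half f' -> der half f f' -> f 0 = 0 -> 0 <= t ->
  smooth n f' t = r2K n *: (f t - smooth n f t).
Proof.
move=> cf' df f0 t0; apply/esym; have cf := der_cnt df.
apply: (smooth_unique (h := fun t => r2K n *: (f t - smooth n f t)) cf'
  (derZ (r2K n) (derB df (der_smooth n cf)))) => //.
by rewrite f0 smooth0// subrr scaler0.
Qed.

Variables (X U Z : completeNormedModType K).
Variables (iZ Am : {linear Z -> X}) (G M : {linear Z -> U}).
Variable T : R -> {linear X -> X}.
Hypothesis bd : boundary_setting iZ Am G M T.
Let hT : c0_semigroup T := T_semigroup bd.
Local Notation A := (generator T).
Local Notation obs := (observe iZ M).
Variables (Xm1 : completeNormedModType K) (j : {linear X -> Xm1}).
Variables (Tm1 : R -> {linear Xm1 -> Xm1}) (Am1 : {linear X -> Xm1}).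
Variable B : {linear U -> Xm1}.
Hypothesis ex : extrapolation_setting iZ Am G T j Tm1 Am1.
Hypothesis ct : is_control_operator iZ Am G j Am1 B.
Let hT1 : c0_semigroup Tm1 := Tm1_semigroup ex.

Lemma main_range x y : A (x, y) -> range iZ x.
Proof. by move=> /(mainP bd)[z [_ <- _]]; exists z. Qed.

Lemma observe_along (f g : R -> X) n : cnt half f -> cnt half g ->
  (forall s, 0 <= s -> A (f s, g s)) ->
  cnt half (obs \o f) /\ forall t, 0 <= t -> obs (smooth n f t) = smooth n (obs \o f) t.
Proof.
move=> cf cg fg; have [c _ hc] := observe_graph_bound bd.
split=> [|t t0]; first exact: (observe_cnt bd main_range hc cf cg fg).
exact: (observe_smooth bd hT main_range hc n cf cg fg t0).
Qed.

Section BoundaryValue.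
Variables (b : K) (a : U).
Hypothesis hb : resolvent_set A b.
Local Notation dz := (dirichlet iZ Am G b a).
Local Notation d := (iZ dz).
Local Notation m := (M dz).
Let W (s : R) : X := prim (fun t => T t d) s.
Let c (s : R) : U := obs (W s).
Let cT : cnt half (fun t => T t d). Proof. exact: orbit_cnt hT d. Qed.
Let cW : cnt half W. Proof. exact: cnt_prim cT. Qed.
Let AW s : 0 <= s -> A (W s, T s d - d).
Proof. exact: (generator_prim_orbit hT d). Qed.
Let cTd : cnt half (fun s => T s d - d).
Proof. exact: (cntB cT (@cnt_cst R k half X d)). Qed.
Let cc : cnt half c. Proof. by case: (observe_along 0 cW cTd AW). Qed.
Let W0 : W 0 = 0. Proof. exact: prim0. Qed.
Let obs0 : obs 0 = 0.
Proof. by rewrite -(linear0 iZ) (observe_iZ bd) linear0. Qed.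

(** The step response in closed form: since [B a = b j d - Am1 d], the constant control [a] is
    steered by the stationary state [d] corrected by its own orbit. *)
Lemma boundary_strict : strict j Am1 B (fun s => d + b *: W s - T s d) (fun=> a).
Proof.
have Bd : B a = b *: j d - Am1 d by apply: ct.2; rewrite (mainE bd).
have AmW s : 0 <= s -> Am1 (W s) = j (T s d - d).
  by move=> s0; apply: (Am1_extends ex); rewrite (mainE bd); exact: AW.
have cd := @cnt_cst R k half.
have AmE s : 0 <= s -> Am1 (d + b *: W s - T s d) =
    Am1 d + b *: j (T s d - d) - Tm1 s (Am1 d).
  by move=> s0; rewrite linearB linearD linearZ/= AmW// (Am1_T ex)//.
split.
- exact: (cntB (cntD (cd _ d) (cntZ b cW)) cT).
- exact: cd.
- apply: (cnt_ext (f := fun s => Am1 d + b *: j (T s d - d) - Tm1 s (Am1 d))).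
    by move=> s s0; rewrite /= AmE.
  apply: (cntB (cntD (cd _ _) (cntZ b (cnt_j bd ex cTd)))).
  exact: (orbit_cnt hT1).
- by rewrite W0 scaler0 addr0 (c0_id hT) subrr.
have dT : der half (fun s => j (T s d)) (fun s => Tm1 s (Am1 d)).
  apply: (der_ext _ _ (generator_der hT1 (Tm1_gen ex (x := d)))) => s s0 //.
  exact: (Tm1_extends ex).
apply: (der_ext _ _ (derB (derD (@der_cst R k half Xm1 (j d))
  (derZ b (der_j bd ex (der_prim cT)))) dT)) => s s0.
  by rewrite /= linearB linearD linearZ.
by rewrite AmE// Bd /= add0r linearB/= scalerBr; zmod.
Qed.

(** The integrated output of the step response: the output itself is formally [m + b c - c'], where
    [c'] would be the observation of [T s d], which need not make sense. *)
Let H (s : R) : U := prim (fun r => m + b *: c r) s - c s.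
Let cmc : cnt half (fun r => m + b *: c r).
Proof. exact: (cntD (@cnt_cst R k half U m) (cntZ b cc)). Qed.
Let cH : cnt half H. Proof. exact: (cntB (cnt_prim cmc) cc). Qed.

Local Notation J2 n f := (iter 2 (smooth n) f).

(** In the doubly smoothed output the formal derivative [c'] is replaced by [n (J c - J2 c)], the
    smoothing of a derivative when [c 0 = 0]. *)
Let dH n (t : R) : U := r2K (ramp2 n t) *: m + b *: J2 n c t
  - r2K n *: (smooth n c t - J2 n c t).

Let der_J2H n : der half (J2 n H) (dH n).
Proof.
have cs := cnt_smooth n cc; have cs2 := cnt_smooth n cs.
have cms := cnt_smooth n (cnt_smooth n cmc).
have J2E t : 0 <= t -> prim (J2 n (fun r => m + b *: c r)) t - J2 n c t = J2 n H t.
  move=> t0; rewrite /= -(smooth_prim n (cnt_smooth n cmc) t0).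
  rewrite -(smoothB n (cnt_prim (cnt_smooth n cmc)) cs t0).
  apply: smooth_ext => s s0; rewrite -(smooth_prim n cmc s0).
  by rewrite -(smoothB n (cnt_prim cmc) cc s0).
apply: (der_ext J2E _ (derB (der_prim cms) (der_smooth n cs))) => t t0.
rewrite /dH; congr (_ - _); rewrite /= -(smooth2_cst n m t0).
rewrite -(smoothZ n b cs t0) -(smoothD n (cnt_smooth n (@cnt_cst R k half U m)) (cntZ b cs) t0).
apply: smooth_ext => s s0.
by rewrite -(smoothZ n b cc s0) -(smoothD n (@cnt_cst R k half U m) (cntZ b cc) s0).
Qed.

Let cdH n : cnt half (dH n).
Proof.
have cs := cnt_smooth n cc; have cs2 := cnt_smooth n cs.
have dn := derZ (r2K n) (der_smooth n cc).
apply: (cntB (cntD _ (cntZ b cs2)) (cntZ (r2K n) (cntB cs cs2))).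
apply: cnt_ext (cnt_smooth n (cnt_smooth n (@cnt_cst R k half U m))) => t t0.
by rewrite smooth2_cst.
Qed.

Lemma boundary_io n t : 0 <= t ->
  io_map iZ M j Tm1 B (J2 n (fun=> a)) t = dH n t.
Proof.
move=> t0; have hs := strict_smooth bd ex ct n (strict_smooth bd ex ct n boundary_strict).
have cs := cnt_smooth n cW; have cs2 := cnt_smooth n cs.
have A1 s : 0 <= s -> A (smooth n W s, smooth n (fun s => T s d - d) s).
  by move=> s0; exact: (smooth_generator (n := n) hT cW cTd s0 AW).
have A2 := smooth_generator (n := n) hT cs (cnt_smooth n cTd) t0 A1.
have [_ o1] := observe_along n cW cTd AW.
have [_ o2] := observe_along n cs (cnt_smooth n cTd) A1.
have {}o2 : obs (J2 n W t) = J2 n c t.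
  by rewrite /= o2//; apply: smooth_ext => s s0; exact: o1.
have /(mainP bd)[z1 [Gz1 iz1 _]] := A1 t t0.
have /(mainP bd)[z2 [Gz2 iz2 _]] := A2.
(* A representative in [Z] of the smoothed state. The orbit of [d] is the derivative of [W], so its
   double smoothing is [n (J W - J2 W)], represented by [n (z1 - z2)]. *)
pose z := r2K (ramp2 n t) *: dz + (b *: z2 - r2K n *: (z1 - z2)).
rewrite (io_map_strict bd ex ct (z := z) hs t0).
  rewrite /z linearD linearZ linearB !linearZ linearB/= -!(observe_iZ bd) iz1 iz2.
  by rewrite -[smooth n (smooth n W) t]/(J2 n W t) o2 o1// /dH -!(observe_iZ bd); zmod.
rewrite /z linearD linearZ linearB !linearZ linearB/= iz1 iz2.
have cd := @cnt_cst R k half.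
have step1 s : 0 <= s -> smooth n (fun s => d + b *: W s - T s d) s =
    smooth n (fun=> d) s + b *: smooth n W s - r2K n *: (W s - smooth n W s).
  move=> s0; rewrite (smoothB n (cntD (cd _ d) (cntZ b cW)) cT s0).
  rewrite (smoothD n (cd _ d) (cntZ b cW) s0) (smoothZ n b cW s0).
  by rewrite (smooth_deriv n cT (der_prim cT) W0 s0).
rewrite [RHS](smooth_ext n t step1).
rewrite (smoothB n (cntD (cnt_smooth n (cd _ d)) (cntZ b cs)) (cntZ (r2K n) (cntB cW cs)) t0).
rewrite (smoothD n (cnt_smooth n (cd _ d)) (cntZ b cs) t0) (smoothZ n b cs t0).
rewrite (smoothZ n (r2K n) (cntB cW cs) t0) (smoothB n cW cs t0) (smooth2_cst n d t0).
by zmod.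
Qed.

Variable F : (R -> U) -> R -> U.
Hypothesis io : is_extended_io p iZ M j Tm1 B F.

Let ramp_small t (e : R) : 0 < t -> 0 < e -> exists n0, forall n, (n0 <= n)%N ->
  (Lpnorm p t (fun s => (-1) *: J2 n.+1%:R (fun=> a) s + a)%R <= e%:E)%E.
Proof.
move=> t0 e0; have cJ n : cnt half (J2 n.+1%:R (fun=> a)).
  exact: (cnt_iter_smooth n.+1%:R 2 (@cnt_cst R k half U a)).
have cd n : cnt half (fun s => -1 *: J2 n.+1%:R (fun=> a) s + a).
  exact: (cntD (cntZ (-1) (cJ n)) (@cnt_cst R k half U a)).
have smd n := sm_cnt (ltW t0) (cnt_seg_half (ltW t0) (cd n)).
have sm0 : strongly_measurable `[0, t] (fun=> 0 : U).
  exact: (sm_cnt (ltW t0) (@cnt_cst R k (seg 0 t) U 0)).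
have bd' n s : 0 <= s <= t -> N (-1 *: J2 n.+1%:R (fun=> a) s + a) <= N a.
  move=> st; rewrite scaleN1r addrC rdistC.
  apply: (iter_smooth_bound (b := t) 2 _ (@cnt_cst R k half U a)) => // r _.
  by rewrite subrr rnorm0.
have cv s : 0 < s <= t -> -1 *: J2 n.+1%:R (fun=> a) s + a @[n --> \oo] --> (0 : U).
  move=> /andP[s0 _]; apply/cvgn_rnormP => e' e'0.
  have /cvgn_rnormP/(_ _ e'0)[n0 h] := iter_smooth_cvg 2 (@cnt_cst R k half U a) s0.
  by exists n0 => n /h; rewrite subr0 scaleN1r [- _ + a]addrC rdistC.
have := Ip_dominated p1 (ltW t0) sm0 smd bd' cv.
have -> : Ip p t (fun=> 0 : U) = 0%E.
  apply/eqP; rewrite eq_le Ip_ge0 andbT.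
  have := Ip_bounded p1 (ltW t0) sm0 (C := 0); rewrite powR0 ?gt_eqF// mul0r.
  by apply=> s _; rewrite rnorm0.
move=> /(ereal_cvg0P (fun n => Ip_ge0 p _ _)).
have ep : 0 < e `^ p by rewrite powR_gt0.
move=> /(_ _ ep)[n0 h]; exists n0 => n /h; apply: (Lpnorm_leP p1 _ _ _).2.
exact: ltW.
Qed.

(** A nonzero constant is not in [W2p0_loc], so its output is reached by approximation: doubly
    smoothed constants converge to it in L^p, and their outputs [dH] have the explicit primitives
    [J2 H], which converge to [H]. *)
Lemma boundary_bochner t : 0 < t -> bochner 0 t (F (fun=> a)) = H t.
Proof.
move=> t0; have t0' := ltW t0; apply: bochnerE.
have ca := @cnt_cst R k half U a.
have la := Lp_loc_cnt p1 ca.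
have [smF _] := io_Lp_loc io la t0.
have cJ n : cnt half (J2 n (fun=> a)) by exact: (cnt_iter_smooth n 2 ca).
have smD n := sm_cnt t0' (cnt_seg_half t0' (cdH n)).
have [kap hk] := io_bounded io t0.
pose kp := `|kap| + 1; have kp0 : 0 < kp by rewrite /kp ltr_wpDl.
apply: (is_bochner_lim (g := fun n => dH n.+1%:R) (w := fun n => J2 n.+1%:R H t)) => //.
- move=> n; have := is_bochner_ftc t0' (cnt_seg_half t0' (cdH n.+1%:R))
    (der_sub (seg_half (lexx 0)) (der_J2H n.+1%:R)).
  by rewrite (_ : J2 n.+1%:R H 0 = 0) ?subr0//; apply/smooth0/cnt_smooth.
- move=> e e0; have e1 : 0 < e / (t + 1) by rewrite divr_gt0// addr_gt0.
  have [n0 h] := ramp_small t0 (divr_gt0 e1 kp0); exists n0 => n /h {}h.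
  have -> : e = (t + 1) * (e / (t + 1)) by rewrite mulrC divfK// gt_eqF// addr_gt0.
  apply: (L1_le_Lp p1 t0' (sm_sub smF (smD _)) e1).
  set u := J2 n.+1%:R (fun=> a) in h *.
  have lu := Lp_loc_cnt p1 (cJ n.+1%:R).
  have ldu : Lp_loc p (fun s => -1 *: u s + a).
    by apply: (Lp_loc_cnt p1); exact: (cntD (cntZ (-1) (cJ _)) ca).
  have [smu _] := io_Lp_loc io ldu t0.
  have ae1 := io_linear io (-1) lu la.
  have ae2 := io_extends io (smooth_W2p0 n.+1%:R ca).
  have IE : Ip p t (fun s => F (fun=> a) s - dH n.+1%:R s) = Ip p t (F (fun s => -1 *: u s + a)).
    apply: (Ip_ae p (sm_sub smF (smD _)) smu).
    apply: ae_mono2 ae1 ae2 => s h1 h2 /andP[s0 st].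
    by rewrite (h1 s0) (h2 s0) -(boundary_io _ s0) scaleN1r addrC.
  rewrite LpnormE IE -LpnormE; apply: (le_trans (hk _ ldu)).
  have L0 : (0 <= Lpnorm p t (fun s => (-1) *: u s + a)%R)%E by rewrite LpnormE poweR_ge0.
  apply: (@le_trans _ _ (kp%:E * Lpnorm p t (fun s => (-1) *: u s + a)%R)%E).
    by apply: (lee_wpmul2r L0); rewrite lee_fin /kp (le_trans (ler_norm _)) ?lerDl.
  rewrite -[leRHS](_ : (kp%:E * (e / (t + 1) / kp)%:E)%E = _).
    by apply: lee_wpmul2l; rewrite ?lee_fin ?(ltW kp0).
  by rewrite -EFinM mulrC divfK ?gt_eqF.
- exact: (iter_smooth_cvg 2 cH t0).
Qed.

Hypothesis rg : forall v : U,
  r2K t^-1 *: bochner 0 t (F (fun=> v)) @[t --> 0^'+] --> (0 : U).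

(** From [boundary_bochner], [c t] is [t m] plus [b] times the integral of [c], minus [H t].
    Regularity makes [H t] an o(t), and the integral is an o(t) because [c 0 = 0]. *)
Lemma boundary_slope (e : R) : 0 < e -> exists2 r : R, 0 < r &
  forall t, 0 <= t < r -> N (c t - r2K t *: m) <= e * t.
Proof.
move=> e0; have e20 : 0 < e / 2 by rewrite divr_gt0.
have /cvg_at_right0_rnormP/(_ _ e20)[r1 r10 h1] := rg a.
have c0 : c 0 = 0 by rewrite /c W0 obs0.
have [r2 r20 h2] := der_prim cmc (lexx 0 : half 0) e20.
exists (Num.min r1 r2) => [|t]; first by rewrite lt_min r10.
rewrite lt_min => /andP[t0 /andP[tr1 tr2]].
have [->|tn0] := eqVneq t 0.
  by rewrite c0 of_real0 scale0r subrr rnorm0 mulr0.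
have {tn0}tp : 0 < t by rewrite lt_neqAle eq_sym tn0.
have := h2 t t0; rewrite subr0 ger0_norm// => /(_ tr2).
rewrite (prim0 cmc) subr0 c0 scaler0 addr0 => h3.
have := h1 t; rewrite tp tr1 => /(_ isT); rewrite subr0 (boundary_bochner tp).
rewrite rnormZr gtr0_norm ?invr_gt0// ltr_pdivrMl// [t * _]mulrC => h4.
have -> : c t - r2K t *: m = prim (fun r => m + b *: c r) t - r2K t *: m - H t.
  by rewrite /H; zmod.
apply: (le_trans (rnormB _ _)).
by rewrite [e]splitr mulrDl lerD// ltW.
Qed.

End BoundaryValue.
End Boundary.

(** * Yosida extension and feedback *)

Section Abel.
Context (R : realType) (k : scalar_kind).
Local Notation K := (scalars k R).
Local Notation r2K := (@of_real k R).
Local Notation N := rnorm.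

Lemma square_exp_small (t C e : R) : 0 < t -> 0 <= C -> 0 < e -> exists2 L : R, 0 < L &
  forall lam, L < lam -> C * (lam ^+ 2 * expR (- lam * t)) <= e.
Proof.
move=> t0 C0 e0; have t30 : 0 < t / 3 by rewrite divr_gt0.
have [L L0 hL] := expR_small (C * (t / 3)^-1 ^+ 2) e0.
exists (L / (t / 3)) => [|lam]; first by rewrite divr_gt0.
move=> llam; have l0 : 0 < lam by apply: lt_trans llam; rewrite divr_gt0.
move: llam; rewrite ltr_pdivrMr// => /ltW/hL; apply: le_trans.
set s := lam * (t / 3); rewrite -mulrA ler_wpM2l//.
(* The exponential is cut into three equal factors: two absorb the square of [lam] by
   [s * expR (- s) <= 1], the third is made small. *)
have -> : - lam * t = - s + (- s - s) by rewrite /s; field.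
have -> : lam = (t / 3)^-1 * s by rewrite /s mulrCA mulVf ?mulr1// gt_eqF.
have s0 : 0 <= s by rewrite ltW// mulr_gt0.
rewrite exprMn !expRD; set E := expR (- s); set a := _ ^+ 2.
have E0 : 0 <= E by exact: expR_ge0.
have sE : s * E <= 1.
  rewrite -(expRNx s) mulrC ler_wpM2l//.
  by rewrite (le_trans _ (expR_ge1Dx s))// lerDr.
have -> : a * s ^+ 2 * (E * (E * E)) = a * E * (s * E) ^+ 2 by ring.
have a0 : 0 <= a by exact: sqr_ge0.
by apply: ler_piMr; rewrite ?expr_le1//; exact: mulr_ge0.
Qed.

Lemma rderZ (D : set R) (a : R) (g g' : R -> R) : rder D g g' ->
  rder D (fun t => a * g t) (fun t => a * g' t).
Proof.
move=> dg t Dt e e0; have a1 : 0 < `|a| + 1 by rewrite ltr_wpDl.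
have [d d0 hd] := dg t Dt _ (divr_gt0 e0 a1); exists d => // s Ds sd.
rewrite (_ : _ - _ - _ = a * (g s - g t - (s - t) * g' t)); last by ring.
rewrite normrM (le_trans (ler_wpM2l (normr_ge0 a) (hd s Ds sd)))// mulrA ler_wpM2r//.
by rewrite mulrCA ler_piMr ?ltW// ltr_pdivrMr// mul1r ltrDl.
Qed.

Variables (X U Z : completeNormedModType K).
Variables (iZ Am : {linear Z -> X}) (G M : {linear Z -> U}).
Variable T : R -> {linear X -> X}.
Hypothesis bd : boundary_setting iZ Am G M T.
Let hT : c0_semigroup T := T_semigroup bd.
Local Notation A := (generator T).
Local Notation Res := (resolvent (generator T)).
Local Notation obs := (observe iZ M).

Lemma observe_res_uniform : exists L C : R, [/\ 1 <= L, 0 <= C & forall lam, L < lam ->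
  resolvent_set A (r2K lam) /\ forall x, N (obs (Res (r2K lam) x)) <= C * N x].
Proof.
have [L [c [L0 c0 hL]]] := resolvent_large hT; have [g g0 hg] := observe_graph_bound bd.
exists (Num.max 1 L), (g * (c + (c + 1))); split=> [||lam].
- by rewrite le_max lexx.
- by rewrite mulr_ge0// !addr_ge0.
rewrite gt_max => /andP[l1 /hL[hl hc]]; split=> // x.
have l0 : 0 < lam by exact: lt_trans l1.
rewrite (le_trans (hg _ _ (resolvent_gen hl)))// -mulrA ler_wpM2l// !mulrDl mul1r lerD//.
  apply: le_trans (hc x); rewrite rnormZr gtr0_norm// ler_peMl// ltW //.
by rewrite (le_trans (rnormB _ _))// lerD.
Qed.

(* The abelian half of the equivalence between the Lebesgue and the Yosida
   extensions of an observation operator; if [p s = C T(s) R(lam) x + c s], where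
   [c s] is the observation of the integrated orbit, then
   [(exp (- lam s) p s)' = - lam exp (- lam s) c s]. *)
Lemma yosida_of_slope x m :
  (forall e : R, 0 < e -> exists2 r : R, 0 < r & forall t, 0 <= t < r ->
     N (obs (prim (fun s => T s x) t) - r2K t *: m) <= e * t) ->
  forall e : R, 0 < e -> exists2 L : R, 0 < L & forall lam, L < lam ->
    N (obs (r2K lam *: Res (r2K lam) x) - m) <= e.
Proof.
move=> slope e e0; have e3 : 0 < e / 3 by rewrite divr_gt0.
have e12 : 0 < e / 12 by rewrite divr_gt0.
have [r r0 hr] := slope _ e12; pose t := r / 2.
have t0 : 0 < t by rewrite divr_gt0.
have tr : t < r by rewrite /t; lra.
have [L [C [L1 C0 hL]]] := observe_res_uniform.
set W := prim (fun s => T s x).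
(* [lam * D] will bound [P t], so that [lam] times the end value at [t] is controlled by
   [lam ^+ 2 * expR (- lam * t)] times constants. *)
pose D := C * N x + C * N (W t).
have D0 : 0 <= D by rewrite addr_ge0// mulr_ge0.
have [L2 L20 h2] := square_exp_small t0 D0 e3.
have D10 : 0 <= (1 + t) * N m by rewrite mulr_ge0// addr_ge0// ltW.
have [L3 L30 h3] := square_exp_small t0 D10 e3.
exists (Num.max L (Num.max L2 L3)) => [|lam].
  by rewrite lt_max (lt_le_trans ltr01 L1).
rewrite !gt_max => /and3P[lL l2 l3]; have [hl hC] := hL _ lL.
have {}h2 := h2 _ l2; have {}h3 := h3 _ l3.
have l1 : 1 <= lam by rewrite ltW// (le_lt_trans L1).
have l0 : 0 < lam by exact: lt_le_trans l1.
have ll : lam <= lam ^+ 2 by rewrite expr2 ler_peMl// ltW.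
pose cr y := obs (Res (r2K lam) y).
have crZ (a : K) y : cr (a *: y) = a *: cr y by exact: (observe_resZ bd hl).
have crD : {morph cr : y z / y + z} by exact: (observe_resD bd hl).
have crB : {morph cr : y z / y - z} by exact: (observe_resB bd hl).
have cT := orbit_cnt hT x.
pose P s := cr x + r2K lam *: cr (W s).
have PE s : 0 <= s -> r2K lam *: (cr (T s x) - P s) = - r2K lam *: obs (W s).
  move=> s0; rewrite scaleNr -scalerN; congr (_ *: _).
  have g := generator_prim_orbit hT x s0.
  have := resolvent_ofgen hl g; rewrite -/(W s) => rE.
  rewrite -[in RHS]rE -/(cr _) crB crZ crB /P; zmod.
have dP : der half P (fun s => r2K lam *: cr (T s x)).
  have := derD (@der_cst R k half U (cr x))
    (derZ (r2K lam) (der_lin crB (fun a => crZ (r2K a)) hC (der_prim cT))).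
  by apply: der_ext => s s0; rewrite ?add0r.
have dE := @rder_expR R half (- lam).
have dm : der half (fun s => r2K s *: m) (fun=> m).
  by move=> u u0 e' e'0; exists 1 => // v v0 _;
    rewrite -scalerBl -of_realB subrr rnorm0 mulr_ge0// ltW.
(* What is subtracted from [P] is its counterpart for the exact slope [c s = s m], namely
   [(s + 1 / lam) m]; only the deviation of [c] from this slope remains in the derivative. *)
pose f s := P s - r2K lam^-1 *: m - r2K s *: m.
have df := derB (derB dP (@der_cst R k half U (r2K lam^-1 *: m))) dm.
have {}df := der_scale (@rder_expR R half (- lam)) df.
have lV : r2K lam *: (r2K lam^-1 *: m) = m.
  by rewrite scalerA -of_realM divff ?gt_eqF// of_real1 scale1r.
pose E s := expR (- lam * s).
have {}df : der half (fun s => r2K (E s) *: f s)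
    (fun s => r2K (- lam * E s) *: (obs (W s) - r2K s *: m)).
  apply: der_ext df => s s0 //; rewrite -/(f s) -/(E s) subr0.
  rewrite mulrC of_realM of_realN -!scalerA -scalerDr; congr (_ *: _).
  rewrite [RHS]scalerBr -PE// /f !scaleNr !scalerBr lV; zmod.
(* With [h = lam * s / 2], [h * expR (- h) <= 1] bounds the integrand by [e / 12] times
   [2 * expR (- h)], whose integral is at most [e / 12 * (4 / lam) = e / (3 * lam)]. *)
have dg := rderZ (- (e / 12 * (4 / lam))) (@rder_expR R (seg 0 t) (- (lam / 2))).
have fg s : 0 <= s <= t -> N (r2K (- lam * E s) *: (obs (W s) - r2K s *: m)) <=
    - (e / 12 * (4 / lam)) * (- (lam / 2) * expR (- (lam / 2) * s)).
  move=> /andP[s0 st]; rewrite rnormZr normrM normrN !gtr0_norm ?expR_gt0//.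
  have sr : 0 <= s < r by rewrite s0 (le_lt_trans st tr).
  have E0 : 0 <= lam * E s by rewrite mulr_ge0 ?expR_ge0// ltW.
  rewrite (le_trans (ler_wpM2l E0 (hr s sr)))//.
  have -> : - (e / 12 * (4 / lam)) * (- (lam / 2) * expR (- (lam / 2) * s)) =
    e / 12 * (2 * expR (- (lam / 2 * s))) by rewrite (mulNr (lam / 2) s); field; rewrite gt_eqF.
  have -> : lam * E s * (e / 12 * s) = e / 12 * (2 * (lam / 2 * s * E s)) by field.
  rewrite ler_wpM2l ?(ltW e12)// ler_wpM2l//; set h := lam / 2 * s.
  have -> : E s = expR (- h) * expR (- h).
    by rewrite -expRD /E /h; congr expR; field.
  rewrite mulrCA ler_piMr ?expR_ge0// -(expRNx h) mulrC ler_wpM2l ?expR_ge0//.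
  by rewrite (le_trans _ (expR_ge1Dx h))// lerDr.
have := mean_value (ltW t0) (der_sub (seg_half (lexx 0)) df) dg fg.
have E00 : E 0 = 1 by rewrite /E mulr0 expR0.
have cr0 : cr 0 = 0 by rewrite -(scale0r (0 : X)) crZ scale0r.
have f0 : f 0 = cr x - r2K lam^-1 *: m.
  by rewrite /f /P /W prim0// cr0 scaler0 addr0 of_real0 scale0r subr0.
rewrite E00 of_real1 scale1r f0 mulr0 expR0 => mv.
have -> : obs (r2K lam *: Res (r2K lam) x) - m = r2K (lam * E t) *: f t -
    r2K lam *: (r2K (E t) *: f t - (cr x - r2K lam^-1 *: m)).
  rewrite of_realM -scalerA [r2K lam *: (_ - (_ - _))]scalerBr [r2K lam *: (_ - _)]scalerBr lV.
  have -> : obs (r2K lam *: Res (r2K lam) x) = r2K lam *: cr x.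
    by rewrite -(resolventZ _ _ hl) -/(cr _) crZ.
  by zmod.
rewrite (le_trans (rnormB _ _))// (_ : e = e / 3 + e / 3 + e / 3); last by field.
rewrite lerD//; last first.
  rewrite rnormZr gtr0_norm// -ler_pdivlMl//; apply: le_trans mv _.
  set y := expR _; have y0 : 0 <= y by exact: expR_ge0.
  rewrite -mulrBr mulNr -mulrN opprB (_ : lam^-1 * (e / 3) = e / 12 * (4 / lam)); last by field; rewrite gt_eqF.
  by rewrite ler_piMr ?gerBl// mulr_ge0 ?(ltW e12)// divr_ge0// ltW.
have EE : 0 <= E t by exact: expR_ge0.
have lE : 0 <= lam * E t by rewrite mulr_ge0// ltW.
have l2E : lam * E t <= lam ^+ 2 * E t by rewrite ler_wpM2r.
rewrite rnormZr ger0_norm// (le_trans (ler_wpM2l lE (rnormB _ _)))// mulrDr.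
have -> : lam * E t * N (r2K t *: m) = lam * E t * (t * N m) by rewrite rnormZr gtr0_norm.
apply: (@le_trans _ _ (lam * E t * (N (P t) + lam^-1 * N m) + lam * E t * (t * N m))).
  rewrite lerD2r ler_wpM2l// (le_trans (rnormB _ _))// lerD2l rnormZr.
  by rewrite gtr0_norm ?invr_gt0.
apply: le_trans (lerD h2 h3); rewrite -/(E t).
have NP : N (P t) <= lam * D.
  rewrite (le_trans (rnormD _ _))// rnormZr gtr0_norm// /D mulrDr lerD//.
    by rewrite (le_trans (hC x))// ler_peMl// mulr_ge0.
  by rewrite ler_wpM2l ?(ltW l0)// hC.
have h4 := ler_wpM2l lE NP.
have h5 : E t * N m <= lam ^+ 2 * E t * N m.
  by rewrite ler_wpM2r// ler_peMl// expr_ge1// ltW.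
have h6 := ler_wpM2r (mulr_ge0 (ltW t0) (rnorm_ge0 m)) l2E.
have -> : lam * E t * (N (P t) + lam^-1 * N m) = lam * E t * N (P t) + E t * N m.
  by field; rewrite gt_eqF.
rewrite (_ : D * _ + _ = lam * E t * (lam * D) + (lam ^+ 2 * E t * N m + lam ^+ 2 * E t * (t * N m))); last by ring.
by rewrite -addrA lerD// lerD.
Qed.
End Abel.

(** * The closed-loop generator as a boundary condition *)

Section ClosedLoop.
Context (R : realType) (k : scalar_kind) (p : R).
Local Notation K := (scalars k R).
Local Notation r2K := (@of_real k R).
Local Notation N := rnorm.
Hypothesis p1 : 1 < p.
Variables (X U Z : completeNormedModType K).
Variables (iZ Am : {linear Z -> X}) (G M : {linear Z -> U}).
Variable T : R -> {linear X -> X}.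
Hypothesis bd : boundary_setting iZ Am G M T.
Let hT : c0_semigroup T := T_semigroup bd.
Local Notation A := (generator T).
Local Notation Res := (resolvent (generator T)).
Local Notation obs := (observe iZ M).
Variables (Xm1 : completeNormedModType K) (j : {linear X -> Xm1}).
Variables (Tm1 : R -> {linear Xm1 -> Xm1}) (Am1 : {linear X -> Xm1}).
Variable B : {linear U -> Xm1}.
Hypothesis ex : extrapolation_setting iZ Am G T j Tm1 Am1.
Hypothesis ct : is_control_operator iZ Am G j Am1 B.
Variable F : (R -> U) -> R -> U.
Hypothesis io : is_extended_io p iZ M j Tm1 B F.
Hypothesis rg : forall v : U,
  r2K t^-1 *: bochner 0 t (F (fun=> v)) @[t --> 0^'+] --> (0 : U).

Lemma yosida_domain x y (e : R) : A (x, y) -> 0 < e -> exists2 L : R, 0 < L &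
  forall lam, L < lam -> N (obs (r2K lam *: Res (r2K lam) x) - obs x) <= e.
Proof.
move=> xy e0; have [c c0 hc] := observe_graph_bound bd.
have d0 : 0 < e / (2 * (c + 1)) by rewrite divr_gt0// mulr_gt0// ltr_wpDl.
have [L1 h1] := yosida_cvg hT x d0; have [L2 h2] := yosida_cvg hT y d0.
have [L3 [C [L31 _ h3]]] := observe_res_uniform bd.
exists (Num.max L3 (Num.max L1 L2)) => [|lam].
  by rewrite lt_max (lt_le_trans ltr01 L31).
rewrite !gt_max => /and3P[/h3[hl _] /h1 {}h1 /h2 {}h2].
have g1 := generatorZ (r2K lam) (resolvent_gen hl (x := x)).
have e1 : r2K lam *: Res (r2K lam) x - x = Res (r2K lam) y.
  have := resolvent_ofgen hl xy; rewrite resolventB// resolventZ// => h.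
  by rewrite -[X in _ - X]h; zmod.
rewrite e1 in g1.
have r1 := main_range bd g1; have r2 := main_range bd xy.
have -> : obs (r2K lam *: Res (r2K lam) x) - obs x =
    obs (r2K lam *: Res (r2K lam) x - x).
  by rewrite addrC -scaleN1r -(observe_range bd)// scaleN1r addrC.
rewrite (le_trans (hc _ _ (generatorB g1 xy)))//.
rewrite (le_trans (ler_wpM2l c0 (lerD h1 h2)))//.
rewrite [leRHS](_ : e = (c + 1) * (e / (2 * (c + 1)) + e / (2 * (c + 1)))).
  by rewrite ler_wpM2r ?lerDl// addr_ge0// ltW.
by field; rewrite gt_eqF// ltr_wpDl.
Qed.

(** The kernel part of [z] is handled by graph-norm convergence, its Dirichlet part by the slope of
    the integrated orbit. *)
Lemma yosida_trace z (e : R) : 0 < e -> exists2 L : R, 0 < L &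
  forall lam, L < lam -> N (obs (r2K lam *: Res (r2K lam) (iZ z)) - M z) <= e.
Proof.
move=> e0; have e20 : 0 < e / 2 by rewrite divr_gt0.
have [b hb _] := beta_exists bd ex.
have [z0 Gz0 zE] := boundary_decomposition bd z hb.
have Az0 : A (iZ z0, Am z0) by apply/(mainP bd); exists z0.
have [L1 L10 h1] := yosida_domain Az0 e20.
have [L2 L20 h2] := yosida_of_slope bd (boundary_slope p1 bd ex ct (G z) hb io rg) e20.
have [L3 [C [L31 _ h3]]] := observe_res_uniform bd.
exists (Num.max L3 (Num.max L1 L2)) => [|lam].
  by rewrite lt_max (lt_le_trans ltr01 L31).
rewrite !gt_max => /and3P[/h3[hl _] /h1 {}h1 /h2 {}h2].
rewrite zE [iZ (_ + _)]linearD [M (_ + _)]linearD -(resolventZ _ _ hl).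
rewrite scalerDr (observe_resD bd hl) -!(resolventZ _ _ hl) in h1 h2 *.
rewrite (observe_iZ bd) in h1.
rewrite opprD addrACA (le_trans (rnormD _ _))// [e]splitr lerD//.
Qed.

Lemma yosida_value z y : yosida_extension iZ Am G M (iZ z, y) -> y = M z.
Proof.
rewrite /yosida_extension /= (mainE bd) => /cvg_pinfty_rnormP h.
apply/eqP; rewrite -subr_eq0; apply/eqP; apply: rnorm_small => e e0.
have e20 : 0 < e / 2 by rewrite divr_gt0.
have [L1 h1] := h _ e20; have [L2 L20 h2] := yosida_trace z e20.
pose lam := Num.max L1 L2 + 1.
have l1 : L1 < lam by rewrite /lam ltr_pwDr// le_max lexx.
have l2 : L2 < lam by rewrite /lam ltr_pwDr// le_max lexx orbT.
rewrite (le_trans (rdistD (obs (r2K lam *: Res (r2K lam) (iZ z))) _ _))// [e]splitr.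
by rewrite lerD ?h2// rdistC ltW// h1.
Qed.

Variable Tcl : R -> {linear X -> X}.
Hypothesis hS : c0_semigroup Tcl.
Hypothesis clE : generator Tcl = closed_loop_operator iZ Am G M j Am1 B.

(** [boundary_representation] places [x] in [Z] with boundary value C_Lambda x, and [yosida_value]
    identifies that value with [M z]: the feedback becomes the boundary condition [G z = M z]. *)
Lemma closed_loop_domain x y : generator Tcl (x, y) ->
  exists z, [/\ iZ z = x, Am z = y & G z = M z].
Proof.
rewrite clE => -[/= u yu /(boundary_representation bd ex ct)[z [zx Gz Az]]].
exists z; split=> //; rewrite Gz; apply: yosida_value; by rewrite zx.
Qed.

Lemma closed_loop_range x y : generator Tcl (x, y) -> range iZ x.
Proof. by move=> /closed_loop_domain[z [<- _ _]]; exists z. Qed.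

Lemma closed_loop_eq x y : generator Tcl (x, y) -> Am1 x + B (obs x) = j y.
Proof.
move=> /closed_loop_domain[z [<- <- Gz]].
by rewrite (observe_iZ bd) -Gz (Am1_iZ bd ex ct).
Qed.

(** The Yosida approximations of the observation, composed with a closed-loop resolvent, are bounded
    operators converging pointwise to [M z]. [banach_steinhaus] makes their bounds uniform, and the
    bound passes to the limit. *)
Lemma closed_loop_bound : exists2 c : R, 0 <= c & forall x y, generator Tcl (x, y) ->
  N (obs x) <= c * (N x + N y).
Proof.
have [L [cL [L0 _ /(_ (L + 1))]]] := resolvent_large hS.
rewrite ltrDl => /(_ ltr01)[hm _]; set mu0 := r2K (L + 1) in hm.
pose Rc := resolvent (generator Tcl) mu0.
have [cr cr0 hcr] := resolvent_bounded hm.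
have [L3 [C [L31 C0 h3]]] := observe_res_uniform bd.
pose lam (n : nat) := L3 + n.+1%:R.
have hl n : resolvent_set A (r2K (lam n)).
  by apply: (h3 _ _).1; rewrite ltrDl ltr0n.
pose Q n x := obs (Res (r2K (lam n)) (r2K (lam n) *: Rc x)).
have [c c0 hc] : exists2 C0 : R, 0 <= C0 & forall n x, N (Q n x) <= C0 * N x.
  apply: banach_steinhaus => [n x y|n a x|n|x].
  - by rewrite /Q /Rc resolventD// scalerDr (observe_resD bd).
  - by rewrite /Q /Rc (resolventZ _ _ hm) scalerA mulrC -scalerA (observe_resZ bd).
  - have [b b0 hb] := observe_res_bound bd (hl n).
    exists (b * (`|lam n| * cr)) => [|x]; first by rewrite !mulr_ge0.
    by rewrite (le_trans (hb _))// -mulrA ler_wpM2l// rnormZr -mulrA ler_wpM2l.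
  - have [z [zx _ _]] := closed_loop_domain (resolvent_gen hm (x := x)).
    have [L1 L10 h1] := yosida_trace z ltr01.
    pose n0 := Num.truncn L1.
    exists (N (M z) + 1 + \sum_(i < n0.+1) N (Q i x)) => n.
    have [nn0|n0n] := ltnP n n0.+1.
      rewrite (bigD1 (Ordinal nn0))//= addrCA lerDl addr_ge0 ?sumr_ge0//.
      by rewrite addr_ge0.
    have ll : L1 < lam n.
      have := truncnS_gt L1; rewrite -/n0 => /lt_le_trans; apply.
      rewrite /lam ler_wpDl ?(le_trans ler01)// ler_nat; exact: leqW.
    have := h1 _ ll; rewrite -(resolventZ _ _ (hl n)) zx -/(Q n x) => h.
    have := rnorm_split (M z) (Q n x); rewrite addrC => /le_trans; apply.
    by rewrite -addrA lerD2l -[leLHS]addr0 lerD// sumr_ge0.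
exists (c * (absK mu0 + 1)) => [|x y xy]; first by rewrite mulr_ge0// addr_ge0// absK_ge0.
have xE : Rc (mu0 *: x - y) = x by exact: resolvent_ofgen.
have [z [zx _ _]] := closed_loop_domain xy.
apply: (@le_trans _ _ (c * N (mu0 *: x - y))).
  apply: le_epsilon => e e0; have [L1 L10 h1] := yosida_trace z e0.
  pose n := Num.truncn L1.
  have ll : L1 < lam n.
    have := truncnS_gt L1 => /lt_le_trans; apply; rewrite /lam -/n.
    by rewrite ler_wpDl// (le_trans ler01).
  have := h1 _ ll; rewrite -(resolventZ _ _ (hl n)) zx.
  have := hc n (mu0 *: x - y); rewrite /Q xE -[in obs x]zx (observe_iZ bd) => hq h.
  rewrite (le_trans (rnorm_split (obs (Res (r2K (lam n)) (r2K (lam n) *: x))) _))//.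
  by rewrite addrC lerD// rdistC.
rewrite -mulrA ler_wpM2l// (le_trans (rnormB _ _))// rnormZ mulrDl mul1r.
by rewrite mulrDr lerD// ?lerDl ?lerDr// mulr_ge0// absK_ge0.
Qed.

End ClosedLoop.

(** The derivative of the smoothed orbit is the generator value [g] plus a defect caused by starting
    at [x] rather than at 0. The defect depends on [x] alone and not on the semigroup. *)
Lemma smooth_orbit (R : realType) (k : scalar_kind) (V : completeNormedModType (scalars k R))
    (S : R -> {linear V -> V}) (n : R) (x : V) : c0_semigroup S ->
  let g s := of_real k n *: (S s x - x - smooth n (fun s => S s x - x) s) in
  [/\ cnt half g, forall s, 0 <= s -> generator S (smooth n (fun s => S s x) s, g s) &
    der half (smooth n (fun s => S s x)) (fun s => g s + of_real k n *: (x - smooth n (fun=> x) s))].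
Proof.
move=> hS g; have cS := orbit_cnt hS x; have cx := @cnt_cst R k half V x.
have cSx := cntB cS cx; have cP := cnt_prim cS.
have gP s : 0 <= s -> generator S (prim (fun s => S s x) s, S s x - x).
  exact: (generator_prim_orbit hS x).
split.
- exact: (cntZ (of_real k n) (cntB cSx (cnt_smooth n cSx))).
- move=> s s0; rewrite (smooth_deriv n cS (der_prim cS) (prim0 cS) s0).
  apply: generatorZ; apply: generatorB; first exact: gP.
  exact: (smooth_generator (n := n) hS cP cSx s0 gP).
- apply: (der_ext _ _ (der_smooth n cS)) => // s s0.
  by rewrite /g (smoothB n cS cx s0) -scalerDr; congr (_ *: _); zmod.
Qed.

Section FeedbackIdentity.
Context (R : realType) (k : scalar_kind) (p : R).
Local Notation K := (scalars k R).
Local Notation mu := (@lebesgue_measure R).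
Local Notation r2K := (@of_real k R).
Hypothesis p1 : 1 < p.
Variables (X U Z : completeNormedModType K).
Variables (iZ Am : {linear Z -> X}) (G M : {linear Z -> U}).
Variable T : R -> {linear X -> X}.
Hypothesis bd : boundary_setting iZ Am G M T.
Let hT : c0_semigroup T := T_semigroup bd.
Local Notation A := (generator T).
Local Notation obs := (observe iZ M).
Variables (Xm1 : completeNormedModType K) (j : {linear X -> Xm1}).
Variables (Tm1 : R -> {linear Xm1 -> Xm1}) (Am1 : {linear X -> Xm1}).
Variable B : {linear U -> Xm1}.
Hypothesis ex : extrapolation_setting iZ Am G T j Tm1 Am1.
Hypothesis ct : is_control_operator iZ Am G j Am1 B.
Variable F : (R -> U) -> R -> U.
Hypothesis io : is_extended_io p iZ M j Tm1 B F.
Hypothesis rg : forall v : U,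
  r2K t^-1 *: bochner 0 t (F (fun=> v)) @[t --> 0^'+] --> (0 : U).

Variable Tcl : R -> {linear X -> X}.
Hypothesis hS : c0_semigroup Tcl.
Hypothesis clE : generator Tcl = closed_loop_operator iZ Am G M j Am1 B.
Local Notation J3 n f := (iter 3 (smooth n) f).

(* [v] is the observation of the smoothed closed-loop orbit. *)
Lemma feedback_identity n x y : A (x, y) -> exists v : R -> U,
  [/\ cnt half (obs \o T^~ x), v 0 = 0, W2p0_loc p v,
    strict j Am1 B (fun s => J3 n (Tcl^~ x) s - J3 n (T^~ x) s) v &
    {ae mu, forall t, 0 <= t -> v t - F v t = J3 n (obs \o T^~ x) t}].
Proof.
move=> xy; have [c c0 hc] := closed_loop_bound p1 bd ex ct io rg hS clE.
have hr := closed_loop_range p1 bd ex ct io rg clE.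
have [cg gg dg] := smooth_orbit n x hS.
set f := smooth n (Tcl^~ x) in gg dg.
set g := fun s => _ in cg gg dg.
have [cg' gg' dg'] := smooth_orbit n x hT.
set f' := smooth n (T^~ x) in gg' dg'.
set g' := fun s => _ in cg' gg' dg'.
have cf : cnt half f := der_cnt dg; have cf' : cnt half f' := der_cnt dg'.
pose y1 := obs \o f.
have cy1 : cnt half y1 := observe_cnt bd hr hc cf cg gg.
have AmE s : 0 <= s -> Am1 (f s) = j (g s) - B (y1 s).
  by move=> s0; rewrite -(closed_loop_eq p1 bd ex ct io rg clE (gg s s0)); zmod.
have AmE' s : 0 <= s -> Am1 (f' s) = j (g' s).
  by move=> s0; apply: (Am1_extends ex); rewrite (mainE bd); exact: gg'.
have st : strict j Am1 B (fun s => f s - f' s) y1.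
  split.
  - exact: (cntB cf cf').
  - exact: cy1.
  - apply: (cnt_ext (f := fun s => j (g s) - B (y1 s) - j (g' s))).
      by move=> s s0; rewrite /= linearB AmE// AmE'.
    exact: (cntB (cntB (cnt_j bd ex cg) (cnt_B ct cy1)) (cnt_j bd ex cg')).
  - by rewrite /f /f' !smooth0 ?subrr//; exact: orbit_cnt.
  (* Both derivatives contain the same defect [w], which drops out of the difference and leaves
     exactly the controlled equation. *)
  apply: (der_ext _ _ (der_j bd ex (derB dg dg'))) => s s0 //.
  have jE w : j (g s + w - (g' s + w)) = j (g s) - j (g' s).
    by rewrite opprD addrACA subrr addr0 linearB.
  by rewrite [LHS]jE [Am1 _]linearB AmE// AmE'//; zmod.
have cJf := cnt_smooth n cf; have cJg := cnt_smooth n cg.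
have cJf' := cnt_smooth n cf'; have cJg' := cnt_smooth n cg'.
have s1 s : 0 <= s -> generator Tcl (smooth n f s, smooth n g s).
  by move=> s0; exact: (smooth_generator (n := n) hS cf cg s0 gg).
have s2 s : 0 <= s -> generator Tcl (smooth n (smooth n f) s, smooth n (smooth n g) s).
  by move=> s0; exact: (smooth_generator (n := n) hS cJf cJg s0 s1).
have s1' s : 0 <= s -> A (smooth n f' s, smooth n g' s).
  by move=> s0; exact: (smooth_generator (n := n) hT cf' cg' s0 gg').
have s2' s : 0 <= s -> A (smooth n (smooth n f') s, smooth n (smooth n g') s).
  by move=> s0; exact: (smooth_generator (n := n) hT cJf' cJg' s0 s1').
pose v := smooth n (smooth n y1).
have vE s : 0 <= s -> v s = obs (J3 n (Tcl^~ x) s).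
  move=> s0; rewrite /= (observe_smooth bd hS hr hc n cJf cJg s1 s0).
  apply: smooth_ext => r r0; exact/esym/(observe_smooth bd hS hr hc n cf cg gg r0).
have Txy s : 0 <= s -> A (T s x, T s y) by move=> s0; exact: generator_T.
have [cTx oTx] := observe_along bd n (orbit_cnt hT x) (orbit_cnt hT y) Txy.
have oE s : 0 <= s -> obs (J3 n (T^~ x) s) = J3 n (obs \o T^~ x) s.
  move=> s0; have [_ /(_ s s0) /= ->] := observe_along bd n cJf' cJg' s1'.
  apply: smooth_ext => r r0.
  have [_ /(_ r r0) /= ->] := observe_along bd n cf' cg' gg'.
  by apply: smooth_ext => u u0; exact: oTx.
have stv : strict j Am1 B (fun s => J3 n (Tcl^~ x) s - J3 n (T^~ x) s) v.
  have [h1 h2 h3 h4 h5] := strict_smooth bd ex ct n (strict_smooth bd ex ct n st).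
  have qE s : 0 <= s -> smooth n (smooth n (fun s => f s - f' s)) s =
      J3 n (Tcl^~ x) s - J3 n (T^~ x) s.
    move=> s0; rewrite /= -/f -/f' -(smoothB n cJf cJf' s0).
    by apply: smooth_ext => r r0; exact: smoothB.
  split=> //.
  - exact: cnt_ext qE h1.
  - by apply: cnt_ext h3 => s s0; rewrite /= -qE.
  - by rewrite -qE.
  - by apply: der_ext h5 => s s0; rewrite /= -qE.
have W2 := smooth_W2p0 p1 n cy1.
exists v; split=> //; first by rewrite /v smooth0//; exact: cnt_smooth.
apply: ae_mono (io_extends io W2) => t h t0; rewrite (h t0) -/v.
(* The output at [z - z'] is [M z - M z']: the first term is [v t] itself, the second the smoothed
   observation of the open-loop orbit. *)
have [z [zx _ Gz]] := closed_loop_domain p1 bd ex ct io rg clE (s2 t t0).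
have /(mainP bd)[z' [Gz' zx' _]] := s2' t t0.
rewrite (io_map_strict bd ex ct (z := z - z') stv t0); last first.
  by rewrite linearB/= zx zx'.
by rewrite vE// -oE// [M _]linearB/= -!(observe_iZ bd) zx zx' opprB addrC subrK.
Qed.

End FeedbackIdentity.

(** * Admissibility constants *)

Section RieszFischer.
Context (R : realType) (k : scalar_kind) (p : R).
Local Notation K := (scalars k R).
Local Notation mu := (@lebesgue_measure R).
Local Notation r2K := (@of_real k R).
Local Notation N := rnorm.
Hypothesis p1 : 1 < p.
Let p0 : 0 < p. Proof. exact: lt_trans p1. Qed.
Variable V : completeNormedModType K.

Lemma simple_sum (xi : nat -> R -> V) n : (forall i, simple_function (xi i)) ->
  simple_function (fun t => \sum_(i < n) xi i t).
Proof.
move=> hx; elim: n => [|n IH].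
  have -> : (fun t => \sum_(i < 0) xi i t) = (fun=> 0) by apply/funext => t; rewrite big_ord0.
  rewrite simple_fv; have := hx 0%N; rewrite simple_fv.
  exact: (finitely_valued_comp (fun=> 0)).
have -> : (fun t => \sum_(i < n.+1) xi i t) = (fun t => \sum_(i < n) xi i t + xi n t).
  by apply/funext => t; rewrite big_ord_recr.
exact: (simple_function2 (fun x y => x + y) IH (hx n)).
Qed.

(** The sum is delivered with simple functions converging to it at every point, as strong
    measurability demands, and approximating it in L1; this is the input that [is_bochner_op]
    expects. *)
Lemma Lp_series (xi : nat -> R -> V) b : 0 <= b -> (forall i, simple_function (xi i)) ->
  (forall i, Ip p b (xi i) <= ((3^-1 ^+ i) `^ p)%:E)%E ->
  exists (u : R -> V) (s : nat -> R -> V), [/\ forall n, simple_function (s n),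
    forall t, s n t @[n --> \oo] --> u t, (Ip p b u < +oo)%E,
    forall e : R, 0 < e -> exists n0, forall n, (n0 <= n)%N ->
      (L1 b (fun t => (u t - s n t)%R) <= e%:E)%E &
    forall n, L1 b (fun t => u t - \sum_(i < n) xi i t) = L1 b (fun t => u t - s n t)].
Proof.
move=> b0 hx hI.
(* The weights [2 ^+ i] leave the integrals summable, with ratio [2 / 3] and total at most 3, while
   finiteness of the weighted sum [h t] forces [xi i t] to decay like [2^-1 ^+ i]. *)
pose a i t := (N (r2K (2 ^+ i) *: xi i t) `^ p)%:E.
have a0 i t : (0 <= a i t)%E by rewrite lee_fin powR_ge0.
have ma (D : set R) i : measurable_fun D (a i).
  apply/measurable_EFinP; apply: (@fv_measurable R).
  have := hx i; rewrite simple_fv => hxi.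
  exact: (finitely_valued_comp (fun x => N (r2K (2 ^+ i) *: x) `^ p) hxi).
pose h t := (\sum_(i <oo) a i t)%E.
have h0 t : (0 <= h t)%E by apply: nneseries_ge0.
have mh (D : set R) : measurable_fun D h by apply: ge0_emeasurable_sum.
have mI : measurable (`[0, b]%classic : set R) by exact: measurable_itv.
have r23 : 0 <= (2 / 3 : R) < 1 by rewrite divr_ge0// ltr_pdivrMr// mul1r ltr_nat.
have Ia i : ((\int[mu]_(t in `[0%R, b]) a i t) <= ((2 / 3) ^+ i)%:E)%E.
  have := IpZ p (r2K (2 ^+ i)) (sm_simple `[0, b] (hx i)); rewrite /Ip => ->.
  have w0 : (0 <= ((absK (r2K (2 ^+ i))) `^ p)%:E)%E by rewrite lee_fin powR_ge0.
  apply: (le_trans (lee_wpmul2l w0 (hI i))).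
  rewrite -EFinM lee_fin absK_of_real ger0_norm ?exprn_ge0// -powRM ?exprn_ge0 ?invr_ge0//.
  rewrite -exprMn; apply: ge1r_powR; last exact: ltW.
  have /andP[r0 r1] := r23.
  by rewrite exprn_gt0 ?divr_gt0//= exprn_ile1// ltW.
have Ih : (\int[mu]_(t in `[0%R, b]) h t <= 3%:E)%E.
  rewrite (integral_nneseries mu mI (ma _) (fun i t _ => a0 i t)).
  apply: lime_le; first by apply: is_cvg_nneseries => n _ _; apply: integral_ge0.
  apply: nearW => n; apply: (@le_trans _ _ (\sum_(0 <= i < n) ((2 / 3) ^+ i)%:E)%E).
    by apply: lee_sum => i _; exact: Ia.
  rewrite sumEFin lee_fin big_mkord; have := geometric_tail 0 n r23.
  under eq_bigr do rewrite add0n; move=> /le_trans; apply.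
  by rewrite expr0 mulr1 (_ : (1 - 2 / 3)^-1 = 3)//; field.
pose E := [set t | (h t < +oo)%E].
have mE : measurable E.
  have := emeasurable_fun_infty_o measurableT (mh setT) +oo%E.
  by rewrite setTI.
have aeE : {ae mu, forall t, 0 <= t <= b -> E t}.
  have : mu.-integrable `[0, b] h.
    apply/integrableP; split; first exact: mh.
    under eq_integral do rewrite gee0_abs//.
    by rewrite (le_lt_trans Ih)// ltry.
  move=> ih; have := @integrable_ae _ _ R mu _ mI h ih; apply: ae_mono => t ht tb.
  have := ht; rewrite /= in_itv/= tb => /(_ isT) hf.
  by rewrite /E /= ltey_eq hf.
(* Setting the partial sums to 0 off the set [E] gives convergence everywhere; on [[0, b]] this
   alters only a negligible set. *)
pose s n t : V := if `[< E t >] then \sum_(i < n) xi i t else 0.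
have fs n : simple_function (s n).
  have hn := simple_sum n hx; rewrite simple_fv in hn; rewrite simple_fv.
  have hE : finitely_valued (fun t => `[< E t >]).
    split; first exact: finite_finset.
    move=> [].
      by rewrite (_ : _ @^-1` _ = E)//; apply/seteqP; split=> t /= /asboolP.
    rewrite (_ : _ @^-1` _ = ~` E); first exact: measurableC.
    by apply/seteqP; split=> t /=; case: asboolP.
  exact: (finitely_valued_comp (fun q : bool * V => if q.1 then q.2 else 0)
    (finitely_valued_pair hE hn)).
have key t : exists l : V, s n t @[n --> \oo] --> l /\ forall m,
    ((N (l - s m t) `^ p)%:E <= ((2 * 2^-1 ^+ m) `^ p)%:E * h t)%E.
  have [Et|nEt] := pselect (E t); last first.
    have sE m : s m t = 0 by rewrite /s; case: asboolP.
    exists 0; split; first by under eq_fun do rewrite sE; exact: cvg_cst.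
    by move=> m; rewrite sE subrr rnorm0 powR0 ?gt_eqF// mule_ge0// lee_fin powR_ge0.
  have sE m : s m t = \sum_(i < m) xi i t by rewrite /s; case: asboolP.
  have [H HE] : exists H : R, h t = H%:E.
    by move: Et (h0 t); rewrite /E/=; case: (h t) => // H; exists H.
  have H0 : 0 <= H by have := h0 t; rewrite HE lee_fin.
  have aH i : N (xi i t) <= H `^ p^-1 * 2^-1 ^+ i.
    have : (a i t <= h t)%E.
      apply: le_trans (nneseries_lim_ge (u_ := a^~ t) i.+1 _) => //.
      by rewrite big_nat_recr//= leeDr// sume_ge0.
    rewrite HE lee_fin rnormZr => hH.
    rewrite exprVn ler_pdivlMr ?exprn_gt0// mulrC.
    have q0 : 0 <= 2 ^+ i * N (xi i t) by rewrite mulr_ge0 ?exprn_ge0.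
    rewrite -(powRVK p1 q0); apply: ge0_ler_powR; rewrite ?nnegrE ?powR_ge0//.
      by rewrite invr_ge0 ltW.
    by move: hH; rewrite ger0_norm ?exprn_ge0.
  have r2 : 0 <= (2^-1 : R) < 1 by rewrite invr_ge0 ler0n invf_lt1 ?ltr1n ?ltr0n.
  have [l hl] := geometric_series_cvg r2 (powR_ge0 _ _) aH.
  have hl' m : N (l - s m t) <= H `^ p^-1 * (2 * 2^-1 ^+ m).
    by rewrite sE (le_trans (hl m))// (_ : (1 - 2^-1)^-1 = 2)//; field.
  exists l; split.
    apply/cvgn_rnormP => e e0; have c1 : 0 < H `^ p^-1 * 2 + 1.
      by rewrite ltr_wpDl// mulr_ge0 ?powR_ge0.
    have /cvgrPdist_lt/(_ _ (divr_gt0 e0 c1))[n0 _ hn] : (2^-1 : R) ^+ n @[n --> \oo] --> (0 : R).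
      by apply: cvg_expr; have /andP[] := r2; move=> /ger0_norm ->.
    exists n0 => n /hn /=; rewrite sub0r normrN ger0_norm ?exprn_ge0 ?invr_ge0//.
    rewrite ltr_pdivlMr// rdistC; apply: le_lt_trans; apply: (le_trans (hl' n)).
    by rewrite mulrA mulrC ler_wpM2l ?exprn_ge0 ?invr_ge0// lerDl.
  move=> m; rewrite HE -EFinM lee_fin -(powRKV p1 H0) mulrC -powRM ?powR_ge0//.
  exact: powR_lexp.
have [u hu] := choice key.
have smu : strongly_measurable `[0, b] u by exists s; split=> // t _; have [] := hu t.
have smn n := sm_sub smu (sm_simple `[0, b] (fs n)).
pose q n : R := 2 * 2^-1 ^+ n.
have bnd n : (Ip p b (fun t => (u t - s n t)%R) <= ((q n `^ p) * 3)%:E)%E.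
  have qp0 : (0 <= (q n `^ p)%:E)%E by rewrite lee_fin powR_ge0.
  apply: (@le_trans _ _ (\int[mu]_(t in `[0%R, b]) ((q n `^ p)%:E * h t))%E).
    apply: ge0_le_integral => //.
    - by move=> t _; rewrite lee_fin powR_ge0.
    - exact: (sm_Ip_measurable p (smn n)).
    - by apply: emeasurable_funM => //; exact: mh.
    - by move=> t _; have [_ /(_ n)] := hu t.
  rewrite ge0_integralZl_EFin ?powR_ge0//; last exact: mh.
  by apply: (le_trans (lee_wpmul2l qp0 Ih)); rewrite -EFinM.
exists u, s; split=> [//|t||e e0|n].
- by have [] := hu t.
- have -> : u = fun t => u t - s 0%N t.
    by apply/funext => t; rewrite /s big_ord0 if_same subr0.
  by rewrite (le_lt_trans (bnd 0%N))// ltry.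
- have eb : 0 < e / (b + 1) / 6 by rewrite !divr_gt0// ltr_wpDl.
  have /cvgrPdist_lt/(_ _ eb)[n0 _ hn] : (2^-1 : R) ^+ n @[n --> \oo] --> (0 : R).
    by apply: cvg_expr; rewrite ger0_norm ?invr_ge0// invf_lt1 ?ltr1n ?ltr0n.
  exists n0 => n /hn /=; rewrite sub0r normrN ger0_norm ?exprn_ge0 ?invr_ge0// => he.
  have e1 : 0 < e / (b + 1) by rewrite divr_gt0// ltr_wpDl.
  have -> : e = (b + 1) * (e / (b + 1)) by rewrite mulrC divfK// gt_eqF// ltr_wpDl.
  apply: (L1_le_Lp p1 b0 (smn n) e1); apply: (Lpnorm_leP p1 _ _ (ltW e1)).2.
  apply: le_trans (bnd n) _; rewrite lee_fin.
  have q0 : 0 <= q n by rewrite mulr_ge0// exprn_ge0// invr_ge0.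
  have p3 : 3 <= 3 `^ p by rewrite -[leLHS]powRr1// ler_powR ?ler1n// ltW.
  apply: (@le_trans _ _ (q n `^ p * 3 `^ p)); first by rewrite ler_wpM2l ?powR_ge0.
  rewrite -powRM//; apply: powR_lexp; rewrite ?mulr_ge0//.
  by move: he; rewrite /q; lra.
- apply: ge0_ae_eq_integral => //.
  + exact: (sm_norm_emeasurable (sm_sub smu (sm_simple _ (simple_sum n hx)))).
  + exact: (sm_norm_emeasurable (smn n)).
  + by move=> t _; rewrite lee_fin.
  + by move=> t _; rewrite lee_fin.
  + apply: ae_mono aeE => t h1; rewrite /= in_itv/= => /h1 Et.
    by rewrite /s; case: asboolP.
Qed.

End RieszFischer.

(** * Boundedness of the input map *)

Section ControlBound.
Context (R : realType) (k : scalar_kind) (p : R).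
Local Notation K := (scalars k R).
Local Notation r2K := (@of_real k R).
Local Notation N := rnorm.
Hypothesis p1 : 1 < p.
Let p0 : 0 < p. Proof. exact: lt_trans p1. Qed.
Variables (X U Z : completeNormedModType K).
Variables (iZ Am : {linear Z -> X}) (G M : {linear Z -> U}).
Variable T : R -> {linear X -> X}.
Hypothesis bd : boundary_setting iZ Am G M T.
Let hT : c0_semigroup T := T_semigroup bd.
Local Notation A := (generator T).
Local Notation Res := (resolvent (generator T)).
Variables (Xm1 : completeNormedModType K) (j : {linear X -> Xm1}).
Variables (Tm1 : R -> {linear Xm1 -> Xm1}) (Am1 : {linear X -> Xm1}).
Variable B : {linear U -> Xm1}.
Hypothesis ex : extrapolation_setting iZ Am G T j Tm1 Am1.
Hypothesis ct : is_control_operator iZ Am G j Am1 B.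
Let hT1 : c0_semigroup Tm1 := Tm1_semigroup ex.
Variable b : R.
Hypothesis b0 : 0 <= b.
Hypothesis adm : forall u, Lp p b u -> range j (input_map Tm1 B b u).

(** The reached state as a relation, which is linear and single-valued before any choice;
    admissibility only supplies its domain. *)
Let inp (u : R -> U) (x : X) := is_bochner 0 b (fun s => Tm1 (b - s) (B (u s))) (j x).

Let inp_exists (u : R -> U) (s : nat -> R -> U) : (forall n, simple_function (s n)) ->
  (forall t, s n t @[n --> \oo] --> u t) -> (Ip p b u < +oo)%E ->
  (forall e : R, 0 < e -> exists n0, forall n, (n0 <= n)%N ->
     (L1 b (fun t => (u t - s n t)%R) <= e%:E)%E) ->
  exists x, inp u x.
Proof.
move=> fs su Iu Lu; have [C C1 hC] := sg_bound hT1 b; have [c c0 hc] := B_bounded ct.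
have [v hv] : exists v, is_bochner 0 b (fun s => Tm1 (b - s) (B (u s))) v.
  apply: (is_bochner_op (c := C * c) (s := s) (L := fun t x => Tm1 (b - t) (B x))) => //.
  - by rewrite mulr_ge0// (le_trans ler01).
  - by move=> t x y; rewrite !linearB.
  - move=> t x /andP[t0 tb]; have tb' : 0 <= b - t <= b by rewrite subr_ge0 tb gerBl.
    by rewrite (le_trans (hC _ _ tb'))// -mulrA ler_wpM2l// (le_trans ler01).
  - by move=> x; exact: (cnt_rev (t := b) (orbit_cnt hT1 (B x))).
have [|x _ hx] := adm (u := u).
  split; first by exists s.
  rewrite LpnormE; move: Iu (Ip_ge0 p b u); case: (Ip p b u) => // r _ _.
  by rewrite poweR_EFin ltry.
by exists x; rewrite /inp hx /input_map (bochnerE hv).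
Qed.

Let inp_comb (a : K) u x u' x' : inp u x -> inp u' x' ->
  inp (fun t => a *: u t + u' t) (a *: x + x').
Proof.
move=> h h'; rewrite /inp linearD linearZ/=; apply: is_bochner_ext (is_bochner_comb a h h') => t _.
by rewrite !linearD !linearZ.
Qed.

Let inp_sub u x u' x' : inp u x -> inp u' x' -> inp (fun t => u t - u' t) (x - x').
Proof.
move=> h h'; have := inp_comb (-1) h' h; rewrite scaleN1r addrC.
suff -> : (fun t => -1 *: u' t + u t) = (fun t => u t - u' t) by [].
by apply/funext => t; rewrite scaleN1r addrC.
Qed.

Let inp_unique u x x' : inp u x -> inp u x' -> x = x'.
Proof. by move=> h h'; apply: (j_inj bd ex); exact: is_bochner_unique h h'. Qed.

Let inp_bound : exists2 c : R, 0 <= c & forall u x (e : R), strongly_measurable `[0, b] u ->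
  inp u x -> (L1 b u <= e%:E)%E -> N (j x) <= c * e.
Proof.
have [C C1 hC] := sg_bound hT1 b; have [c c0 hc] := B_bounded ct.
have Cc0 : 0 <= C * c by rewrite mulr_ge0// (le_trans ler01).
exists (C * c) => // u x e smu hx Lu.
rewrite -lee_fin; apply: (le_trans (is_bochner_norm hx)); rewrite EFinM.
apply: (@le_trans _ _ ((C * c)%:E * L1 b u)%E); last first.
  by apply: lee_wpmul2l; rewrite ?lee_fin.
apply: L1_le => //; first by case: hx.
move=> t /andP[t0 tb]; have tb' : 0 <= b - t <= b by rewrite subr_ge0 tb gerBl.
by rewrite (le_trans (hC _ _ tb'))// -mulrA ler_wpM2l// (le_trans ler01).
Qed.

(** The integral is bounded in [Xm1], whose norm on [X] is that of one resolvent; the resolvent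
    identity carries the bound to any other resolvent. *)
Let res_bound (lam : K) : resolvent_set A lam -> exists2 c : R, 0 <= c & forall u x (e : R),
  strongly_measurable `[0, b] u -> inp u x -> (L1 b u <= e%:E)%E ->
  N (lam *: Res lam x) <= c * e.
Proof.
move=> hl; have [c c0 hc] := inp_bound; have [bt hb jb] := beta_exists bd ex.
have [cl cl0 hcl] := resolvent_bounded hl.
have a0 := absK_ge0 lam; have a1 := absK_ge0 (lam - bt).
exists (absK lam * ((1 + cl * absK (lam - bt)) * c)).
  by rewrite !mulr_ge0// addr_ge0// mulr_ge0.
move=> u x e smu hx Lu; have jx := hc u x e smu hx Lu.
rewrite rnormZ -mulrA ler_wpM2l// -mulrA; rewrite jb in jx.
have := resolvent_identity x hb hl; rewrite resolventD// => rE.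
have -> : Res lam x = Res bt x - Res lam ((lam - bt) *: Res bt x) by rewrite {1}rE addrK.
rewrite (le_trans (rnormB _ _))// mulrDl mul1r lerD// (le_trans (hcl _))// -mulrA.
by rewrite ler_wpM2l// rnormZ ler_wpM2l.
Qed.

Let nrm (u : R -> U) : R := fine (Ip p b u) `^ p^-1.

Let simple_Ip (u : R -> U) : simple_function u -> (Ip p b u \is a fin_num)%E.
Proof.
move=> fu; have [smu] := Lp_simple p1 b0 fu; rewrite LpnormE.
move: (Ip_ge0 p b u); case: (Ip p b u) => //=.
by rewrite invr_eq0 gt_eqF// ltxx.
Qed.

Let nrmE (u : R -> U) : simple_function u -> (Ip p b u = (nrm u `^ p)%:E)%E.
Proof.
move=> fu; have hf := simple_Ip fu.
by rewrite /nrm powRKV ?fineK// fine_ge0// Ip_ge0.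
Qed.

Let L1_nrm (u : R -> U) (e : R) : simple_function u -> 0 < e -> (L1 b u <= ((b + 1) * (nrm u + e))%:E)%E.
Proof.
move=> fu e0; have n0 : 0 < nrm u + e by rewrite ltr_wpDl// powR_ge0.
apply: (L1_le_Lp p1 b0 (sm_simple _ fu) n0); apply: (Lpnorm_leP p1 _ _ (ltW n0)).2.
by rewrite nrmE// lee_fin; apply: (powR_lexp p1); rewrite ?powR_ge0// lerDl ltW.
Qed.

Let Psi (u : R -> U) : X := xget 0 [set x | inp u x].

Let PsiP u : simple_function u -> inp u (Psi u).
Proof.
move=> fu; have [||e e0|x hx] := @inp_exists u (fun=> u) (fun=> fu).
- by move=> t; exact: cvg_cst.
- by rewrite nrmE// ltry.
- exists 0%N => n _; rewrite /L1; under eq_integral do rewrite subrr rnorm0.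
  by rewrite integral0 lee_fin ltW.
by apply: (@xgetI _ 0 [set x | inp u x] x).
Qed.

Let simple0 : simple_function (0 : R -> U).
Proof.
have -> : (0 : R -> U) = (fun=> 0) \o @idx R 0 by apply/funext.
by rewrite simple_fv; apply: finitely_valued_comp; exact: finitely_valued_idx.
Qed.

Let simple_comb (a : K) (u v : R -> U) : simple_function u -> simple_function v ->
  simple_function (fun t => a *: u t + v t).
Proof. exact: (simple_function2 (fun x y => a *: x + y)). Qed.

Let simpleD (u v : R -> U) : simple_function u -> simple_function v -> simple_function (u + v).
Proof.
move=> fu fv; have -> : u + v = fun t => 1 *: u t + v t by apply/funext => t; rewrite scale1r.
exact: simple_comb.
Qed.

Let simpleZ (a : K) (u : R -> U) : simple_function u -> simple_function (a *: u).
Proof.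
move=> fu; have -> : a *: u = fun t => a *: u t + (0 : R -> U) t by apply/funext => t; rewrite addr0.
exact: simple_comb.
Qed.

Let PsiD u v : simple_function u -> simple_function v -> Psi (u + v) = Psi u + Psi v.
Proof.
move=> fu fv; apply: (inp_unique (PsiP (simpleD fu fv))).
have := inp_comb 1 (PsiP fu) (PsiP fv); rewrite scale1r; apply: is_bochner_ext => t _.
by rewrite scale1r.
Qed.

Let PsiZ (a : K) u : simple_function u -> Psi (a *: u) = a *: Psi u.
Proof.
move=> fu; apply: (inp_unique (PsiP (simpleZ a fu))).
have := inp_comb (a - 1) (PsiP fu) (PsiP fu); rewrite scalerBl scale1r subrK.
by apply: is_bochner_ext => t _; rewrite scalerBl scale1r subrK.
Qed.

(** A closed graph argument carried out on simple controls. The regularized states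
    [lam R(lam) Psi u] are bounded operators of [u], one for each [lam]; [uniform_bound] removes the
    dependence on [lam]. Step functions and large [lam] then give the bound for the continuous
    control of a strict trajectory. *)
Lemma control_bound : exists2 C : R, 0 <= C & forall (q : R -> X) v (c : R),
  strict j Am1 B q v -> 0 <= c -> (Ip p b v <= (c `^ p)%:E)%E -> N (q b) <= C * c.
Proof.
have [L [cL [L0 cL0 hL]]] := resolvent_large hT.
pose lam (i : nat) := L + i.+1%:R.
have hl i : resolvent_set A (r2K (lam i)) by apply: (hL _ _).1; rewrite ltrDl ltr0n.
have hcl i x : N (r2K (lam i) *: Res (r2K (lam i)) x) <= cL * N x.
  by apply: (hL _ _).2; rewrite ltrDl ltr0n.
pose rho i x := r2K (lam i) *: Res (r2K (lam i)) x.
have rhoD i x y : rho i (x + y) = rho i x + rho i y by rewrite /rho resolventD// scalerDr.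
have rhoZ i (a : K) x : rho i (a *: x) = a *: rho i x.
  by rewrite /rho resolventZ// !scalerA mulrC.
have rhoB i x y : rho i (x - y) = rho i x - rho i y.
  by rewrite -scaleN1r rhoD rhoZ scaleN1r.
pose tau i u := N (rho i (Psi u)).
have tauD i u v : simple_function u -> simple_function v -> tau i (u + v) <= tau i u + tau i v.
  by move=> fu fv; rewrite /tau PsiD// rhoD rnormD.
have tauZ i (a : R) u : simple_function u -> tau i (r2K a *: u) = `|a| * tau i u.
  by move=> fu; rewrite /tau PsiZ// rhoZ rnormZr.
have tau0 i : tau i 0 = 0.
  have := tauZ i 0 0 simple0; rewrite scaler0 normr0 mul0r; exact.
have nrm0 u : 0 <= nrm u by exact: powR_ge0.
have tau_sum i (w : nat -> R -> U) n : (forall m, simple_function (w m)) ->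
    simple_function (\sum_(l < n) w l) /\ tau i (\sum_(l < n) w l) <= \sum_(l < n) tau i (w l).
  move=> fw; elim: n => [|n [IH1 IH2]]; first by rewrite !big_ord0 tau0; split.
  rewrite !big_ord_recr/=; split; first exact: simpleD.
  by rewrite (le_trans (tauD _ _ _ IH1 (fw n)))// lerD2r.
have [C C0 hC] : exists2 C : R, 0 <= C & forall i u, simple_function u -> tau i u <= C * nrm u.
  apply: (@uniform_bound R k (R -> U) (@simple_function k R U) nrm nat tau) => //.
  - by move=> a u fu; exact: simpleZ.
  - move=> a u fu; rewrite /nrm (IpZ p (r2K a) (sm_simple _ fu)) absK_of_real.
    rewrite fineM//=; last exact: simple_Ip.
    by rewrite powRM ?powR_ge0 ?fine_ge0 ?Ip_ge0// powRVK.
  - by move=> i u; exact: rnorm_ge0.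
  - move=> i; have [c c0 hc] := res_bound (hl i).
    exists (c * (b + 1)) => [|u fu]; first by rewrite mulr_ge0// addr_ge0.
    apply: le_epsilon => e e0; have c1 : 0 < c * (b + 1) + 1.
      by rewrite ltr_wpDl// mulr_ge0// addr_ge0.
    have e1 := divr_gt0 e0 c1.
    rewrite (le_trans (hc _ _ _ (sm_simple _ fu) (PsiP fu) (L1_nrm fu e1)))//.
    rewrite mulrA mulrDr lerD2l mulrCA ler_piMr ?(ltW e0)//.
    by rewrite ler_pdivrMr// mul1r lerDl.
  (* Admissibility is applied to the sum [u] of the series, which need not be simple: its state [x]
     yields the bound [cL * N x], uniform in [i]. For a given [i], a long partial sum is close to
     [u] in L1, and the terms from [m] on add up geometrically. *)
  - move=> xi hxi; have fxi n := (hxi n).1; have nxi n := (hxi n).2.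
    have Ixi i : (Ip p b (xi i) <= ((3^-1 ^+ i) `^ p)%:E)%E.
      by rewrite nrmE// lee_fin; apply: (powR_lexp p1).
    have [u [s [fs su Iu Lu Lx]]] := Lp_series p1 b0 fxi Ixi.
    have smu : strongly_measurable `[0, b] u by exists s; split.
    have [x hx] := inp_exists fs su Iu Lu.
    exists (cL * N x) => i C m C0 hC; apply: le_epsilon => e e0.
    have [c c0 hc] := res_bound (hl i).
    have c1 : 0 < c + 1 by rewrite ltr_wpDl.
    have [n0 hn0] := Lu _ (divr_gt0 e0 c1).
    have fm n := tau_sum i xi n fxi.
    have nm : (m <= m + n0)%N by rewrite leq_addr.
    have [fn _] := fm (m + n0)%N.
    have hxn : inp (fun t => u t - (\sum_(l < m + n0) xi l) t) (x - Psi (\sum_(l < m + n0) xi l)).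
      exact: inp_sub hx (PsiP fn).
    have Ln : (L1 b (fun t => (u t - (\sum_(l < m + n0) xi l) t)%R) <= (e / (c + 1))%:E)%E.
      under eq_fun do rewrite fct_sumE.
      by rewrite Lx hn0// leq_addl.
    have smn := sm_sub smu (sm_simple `[0, b] fn).
    have yx : tau i (\sum_(l < m + n0) xi l) <= cL * N x + e.
      rewrite /tau (le_trans (rnorm_split (rho i x) _))// [leRHS]addrC lerD ?hcl//.
      rewrite rdistC -rhoB (le_trans (hc _ _ _ smn hxn Ln))//.
      by rewrite mulrCA ler_piMr ?(ltW e0)// ler_pdivrMr// mul1r lerDl.
    have [fm1 _] := fm m.
    pose w l := xi (m + l)%N; have fw l : simple_function (w l) by exact: fxi.
    have [fw1 tw] := tau_sum i w n0 fw.
    have yE : \sum_(l < m) xi l = \sum_(l < m + n0) xi l + r2K (-1) *: \sum_(l < n0) w l.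
      by rewrite big_split_ord/= of_realN of_real1 scaleN1r addrK.
    rewrite yE (le_trans (tauD _ _ _ fn (simpleZ _ fw1)))// addrAC lerD// tauZ// normrN1 mul1r.
    apply: (le_trans tw).
    apply: (@le_trans _ _ (\sum_(l < n0) C * 3^-1 ^+ (m + l))).
      by apply: ler_sum => l _; rewrite (le_trans (hC _ (fw l)))// ler_wpM2l//; exact: nxi.
    have r3 : 0 <= (3^-1 : R) < 1 by rewrite invr_ge0 invf_lt1 ?ltr0n ?ltr1n// ler0n.
    rewrite -mulr_sumr ler_wpM2l// (le_trans (geometric_tail m _ r3))//.
    by rewrite (_ : (1 - 3^-1)^-1 = 3 / 2)//; field.
exists C => // q v c st c0 Iv; apply: le_epsilon => e e0.
have hq : inp v (q b) by exact: (strict_input ex ct st b0).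
have [_ cv _ _ _] := st; have cv' := cnt_seg_half b0 cv.
have smv := sm_cnt b0 cv'.
(* Three errors add up: the Yosida approximation at [q b], the step approximation, each at most
   [e'], and [C * e'] from the norm of the step function. *)
pose e' := e / (C + 2); have e'0 : 0 < e' by rewrite divr_gt0// ltr_wpDl.
have [L1' hL1] := yosida_cvg hT (q b) e'0.
pose i := Num.truncn L1'.
have li : L1' < lam i.
  by have := truncnS_gt L1' => /lt_trans; apply; rewrite /lam -/i ltrDr.
have {}hL1 := hL1 _ li.
have [ci ci0 hci] := res_bound (hl i); have ci1 : 0 < ci + 1 by rewrite ltr_wpDl.
have [n1 hn1] := L1_step b0 cv' (divr_gt0 e'0 ci1).
have [n2 hn2] := step_close b0 cv' ltr01.
have [D D0 hD] := cnt_bounded b0 cv'.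
(* The offset [n2] makes all step functions differ from [v] by at most 1, hence uniformly bounded by
   [D + 1], as dominated convergence requires. *)
have Icv : Ip p b (step (n2 + n) v) @[n --> \oo] --> Ip p b v.
  apply: (Ip_dominated p1 (C := D + 1) b0 smv (fun n => sm_simple _ (simple_step (n2 + n) v))).
    move=> n t tb; rewrite (le_trans (rnorm_split (v t) _))// [leRHS]addrC lerD ?hD//.
    by rewrite rdistC hn2// leq_addr.
  move=> t /andP[t0 tb]; apply/cvgn_rnormP => d d0; have d20 : 0 < d / 2 by rewrite divr_gt0.
  have [n3 hn3] := step_close b0 cv' d20; exists n3 => n nn.
  rewrite rdistC (@le_lt_trans _ _ (d / 2))//; last by rewrite ltr_pdivrMr// ltr_pMr// ltr1n.
  by rewrite hn3 ?(ltW t0)// (leq_trans nn)// leq_addl.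
have [n4 hn4] : exists n4, forall n, (n4 <= n)%N -> (Ip p b (step (n2 + n) v) <= ((c + e') `^ p)%:E)%E.
  have lt1 : (Ip p b v < ((c + e') `^ p)%:E)%E.
    rewrite (le_lt_trans Iv)// lte_fin gt0_ltr_powR ?nnegrE ?addr_ge0 ?(ltW e'0)//.
    by rewrite ltrDl.
  have op : open [set y : \bar R | (y < ((c + e') `^ p)%:E)%E] by exact: open_ereal_lt_ereal.
  have [n4 _ h4] := Icv _ (open_nbhs_nbhs (conj op lt1)).
  by exists n4 => n /h4 /ltW.
pose n := (n1 + n4)%N; pose w := step (n2 + n) v.
have fw : simple_function w by exact: simple_step.
have {}hn4 : (Ip p b w <= ((c + e') `^ p)%:E)%E by apply: hn4; exact: leq_addl.
have nw : nrm w <= c + e'.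
  rewrite -(powRVK p1 (addr_ge0 c0 (ltW e'0))) /nrm; apply: ge0_ler_powR.
  - by rewrite invr_ge0 ltW.
  - by rewrite nnegrE fine_ge0// Ip_ge0.
  - by rewrite nnegrE powR_ge0.
  - by rewrite -lee_fin fineK//; exact: simple_Ip.
have d1 : N (rho i (q b - Psi w)) <= e'.
  have := hci _ _ _ (sm_sub smv (sm_simple _ fw)) (inp_sub hq (PsiP fw)) (hn1 (n2 + n)%N _).
  move=> /(_ _)/le_trans; apply; first by rewrite /n addnCA leq_addr.
  by rewrite mulrCA ler_piMr ?(ltW e'0)// ler_pdivrMr// mul1r lerDl.
have d2 : N (rho i (Psi w)) <= C * (c + e').
  by rewrite (le_trans (hC i w fw))// ler_wpM2l.
have -> : q b = q b - rho i (q b) + (rho i (q b - Psi w) + rho i (Psi w)).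
  by rewrite rhoB; zmod.
have -> : C * c + e = e' + (e' + C * (c + e')).
  have C2 : C + 2 != 0 by rewrite gt_eqF// ltr_wpDl.
  by rewrite /e'; field.
rewrite (le_trans (rnormD _ _))// lerD//; first by rewrite rdistC.
by rewrite (le_trans (rnormD _ _))// lerD.
Qed.
End ControlBound.

(** * Delayed trajectories *)

Section Delay.
Context (R : realType) (k : scalar_kind).
Local Notation K := (scalars k R).
Local Notation N := rnorm.

Definition delay (d s : R) : R := Num.max 0 (s - d).

Lemma delay_ge0 d s : 0 <= delay d s. Proof. by rewrite /delay le_max lexx. Qed.

Lemma delay_dist d s t : `|delay d s - delay d t| <= `|s - t|.
Proof.
rewrite /delay; have [h1|h1] := leP 0 (s - d); have [h2|h2] := leP 0 (t - d).
- by rewrite opprB addrA subrK.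
- by rewrite subr0 ger0_norm// ger0_norm; lra.
- by rewrite sub0r normrN ger0_norm// ler0_norm; lra.
- by rewrite subrr normr0.
Qed.

Lemma cnt_delay (V : completeNormedModType K) (f : R -> V) d : cnt half f ->
  cnt half (fun s => f (delay d s)).
Proof.
move=> cf t t0 e e0; have [r r0 h] := cf _ (delay_ge0 d t) e e0.
exists r => // s s0 st; apply: h; first exact: delay_ge0.
exact: le_lt_trans (delay_dist d s t) st.
Qed.

Lemma der_delay (V : completeNormedModType K) (f f' : R -> V) d : der half f f' ->
  f' 0 = 0 -> der half (fun s => f (delay d s)) (fun s => f' (delay d s)).
Proof.
move=> df f'0 t t0 e e0; have [r r0 h] := df _ (delay_ge0 d t) e e0.
have [td|dt] := leP t d.
  have tE : delay d t = 0 by rewrite /delay max_l// subr_le0.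
  rewrite tE f'0 in h *; exists r => // s s0 st.
  have := h _ (delay_ge0 d s); rewrite -{1}tE !scaler0 => /(_ (le_lt_trans (delay_dist _ _ _) st)).
  move=> /le_trans; apply; rewrite ler_wpM2l ?(ltW e0)//.
  by have := delay_dist d s t; rewrite tE.
exists (Num.min r (t - d)) => [|s s0]; first by rewrite lt_min r0 subr_gt0.
rewrite lt_min => /andP[sr std].
have sd : 0 < s - d by move: std; rewrite ltr_norml => /andP[]; lra.
have tE : delay d t = t - d by rewrite /delay max_r// subr_ge0 ltW.
have sE : delay d s = s - d by rewrite /delay max_r// ltW.
have ssE : delay d s - delay d t = s - t by rewrite tE sE; ring.
by have := h _ (delay_ge0 d s); rewrite ssE => /(_ sr).
Qed.

Section StrictDelay.
Variables (X U : completeNormedModType K).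
Variables (Xm1 : completeNormedModType K) (j Am1 : {linear X -> Xm1}) (B : {linear U -> Xm1}).

(** The state rests until [d] and then follows the old trajectory. With [v 0 = 0] the derivative
    starts at 0, so both pieces fit together at [d]. *)
Lemma strict_delay q v d : 0 <= d -> strict j Am1 B q v -> v 0 = 0 ->
  strict j Am1 B (fun s => q (delay d s)) (fun s => v (delay d s)).
Proof.
move=> d0 [cq cv ca q0 dq] v0; split.
- exact: cnt_delay.
- exact: cnt_delay.
- exact: (cnt_delay d ca).
- by rewrite /delay sub0r max_l ?oppr_le0.
- by apply: (der_delay d dq); rewrite q0 v0 !linear0 addr0.
Qed.

(** Delaying the control by [b - c1] moves the state at time [c1] to time [b], where the bound is
    known, without increasing the integral of the control. *)
Lemma control_bound_le (p b c1 C : R) q v (c : R) : 1 < p ->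
  (forall q' v' c', strict j Am1 B q' v' -> 0 <= c' -> (Ip p b v' <= (c' `^ p)%:E)%E ->
     N (q' b) <= C * c') ->
  0 < c1 -> c1 <= b -> strict j Am1 B q v -> v 0 = 0 -> 0 <= c ->
  (Ip p c1 v <= (c `^ p)%:E)%E -> N (q c1) <= C * c.
Proof.
move=> p1 hb c10 c1b st v0 c0 Iv; have p0 : 0 < p by exact: lt_trans p1.
have d0 : 0 <= b - c1 by rewrite subr_ge0.
have std := strict_delay d0 st v0.
have -> : q c1 = q (delay (b - c1) b) by rewrite /delay opprB addrC subrK max_r// ltW.
apply: hb std c0 _; have [_ cv _ _ _] := st.
have cd := cnt_delay (b - c1) cv.
have := Ip_shift p1 cd d0 c10; rewrite [c1 + _]addrC subrK => /le_trans; apply.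
have -> : Ip p (b - c1) (fun s => v (delay (b - c1) s)) = 0%E.
  apply/eqP; rewrite eq_le Ip_ge0 andbT.
  have := Ip_bounded p1 d0 (sm_cnt d0 (cnt_seg_half d0 cd)) (C := 0).
  rewrite powR0 ?gt_eqF// mul0r; apply=> s /andP[s0 sd].
  by rewrite /delay max_l ?subr_le0// v0 rnorm0.
rewrite add0e; apply: le_trans Iv; rewrite le_eqVlt; apply/orP; left; apply/eqP.
apply: eq_integral => s; rewrite inE/= in_itv/= => /andP[s0 _].
by rewrite /delay addrK max_r.
Qed.

End StrictDelay.
End Delay.

(** * Compactness *)

Section Compactness.
Context (R : realType) (k : scalar_kind).
Local Notation K := (scalars k R).
Local Notation N := rnorm.
Variable X : completeNormedModType K.
Local Notation S := ([set x : X | N x <= 1]).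

Lemma rnorm_ball_nbhs (x : X) (e : R) : 0 < e -> nbhs x [set y | N (y - x) < e].
Proof.
move=> e0; have h : (id : X -> X) @ nbhs x --> x by exact: cvg_id.
by move/cvg_rnormP: h => /(_ e e0).
Qed.

Lemma compact_ultra_image (P : X -> X) (F : set_system X) : compact_operator P ->
  UltraFilter F -> F S -> exists l, forall e : R, 0 < e -> F [set x | N (P x - l) < e].
Proof.
rewrite /compact_operator precompactE => cP uF FS; have pF : ProperFilter F by exact: ultra_proper.
have [|l [_ cl]] := cP (P @ F) _.
  suff : F (P @^-1` closure (P @` S)) by [].
  by apply: filterS FS => x Sx; apply: subset_closure; exists x.
exists l => e e0; have [//|nF] := in_ultra_setVsetC [set x | N (P x - l) < e] uF.
have [y [Py ly]] := cl (~` [set y | N (y - l) < e]) _ nF (rnorm_ball_nbhs l e0).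
by case: Py.
Qed.

(** The given filter lives on the closure of the image, where points may have no preimage. It is
    therefore lifted through approximations: [H] is generated by the unit vectors whose image is
    [e]-close to a point of [A]. *)
Lemma compact_of_ultra (L : X -> X) :
  (forall F : set_system X, UltraFilter F -> F S ->
     exists l, forall e : R, 0 < e -> F [set x | N (L x - l) < e]) -> compact_operator L.
Proof.
move=> hL; rewrite /compact_operator precompactE => F pF FD.
pose H : set_system X := [set Q | exists A, exists2 e : R, F A /\ 0 < e &
  [set x | S x /\ exists2 a, A a & N (L x - a) < e] `<=` Q].
have fH : Filter H.
  split.
  - by exists setT, 1 => //; split => //; exact: filterT.
  - move=> Q Q' [A [e [FA e0] AQ]] [A' [e' [FA' e'0] AQ']].
    exists (A `&` A'), (Num.min e e').
      by split; [exact: filterI|rewrite lt_min e0].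
    move=> x [Sx [a [Aa A'a]]]; rewrite lt_min => /andP[xe xe'].
    by split; [apply: AQ|apply: AQ']; split=> //; exists a.
  - move=> Q Q' QQ' [A [e Ae AQ]]; exists A, e => //.
    exact: subset_trans AQ QQ'.
have pH : ProperFilter H.
  apply: Build_ProperFilter => -[A [e [FA e0] AQ]].
  have [a [Aa Da]] := filter_ex (filterI FA FD).
  have [_ [[x Sx <-] xa]] := Da _ (rnorm_ball_nbhs a e0).
  by apply: (AQ x); split=> //; exists a.
have [W [uW HW]] := ultraFilterLemma pH; have pW : ProperFilter W by exact: ultra_proper.
have WS : W S by apply: HW; exists setT, 1; [split=> //; exact: filterT|move=> x []].
have [l hl] := hL W uW WS.
have cl : cluster F l.
  move=> A Q FA /(@nbhs_ballP _ _ l Q)[e /= e0 eQ].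
  have eE : of_real k (real_part e) = e by rewrite of_real_part// ltW.
  have e0' : 0 < real_part e / 2.
    by rewrite divr_gt0// -(ltr_of_real k) eE of_real0.
  have WA : W [set x | S x /\ exists2 a, A a & N (L x - a) < real_part e / 2].
    by apply: HW; exists A, (real_part e / 2).
  have [x [[Sx [a Aa xa]] xl]] := filter_ex (filterI WA (hl _ e0')).
  exists a; split=> //; apply: eQ; rewrite -ball_normE /ball_/= normr_rnorm -eE ltr_of_real.
  rewrite (le_lt_trans (rdistD (L x) _ _))// [ltRHS]splitr ltrD//.
  by rewrite rdistC.
exists l; split=> //.
by apply: closed_closure => Q nQ; exact: cl.
Qed.

Lemma compact_of_estimate (L P1 : {linear X -> X}) : compact_operator P1 ->
  (forall e : R, 0 < e -> exists P : {linear X -> X}, exists2 C : R, 0 <= C /\ compact_operator P &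
     forall x, N (L x - P1 x) <= e * N x + C * N (P x)) ->
  compact_operator L.
Proof.
move=> cP1 hL; apply: compact_of_ultra => F uF FS; have pF : ProperFilter F by exact: ultra_proper.
have cF (e : R) : 0 < e -> exists x, F [set y | N (L y - L x) < e].
  (* Three contributions of at most [e / 4] each: the difference under [P1], the term
     [e / 8 * N (y - x)] with [N (y - x) <= 2], and the term with [P]. The divisor uses [C + 1]
     because [C] may be 0. *)
  move=> e0; have e8 : 0 < e / 8 by rewrite divr_gt0.
  have [P [C [C0 cP] hP]] := hL _ e8.
  have d0 : 0 < e / (8 * (C + 1)) by rewrite divr_gt0// mulr_gt0// ltr_wpDl.
  have [l1 h1] := compact_ultra_image cP1 uF FS.
  have [l2 h2] := compact_ultra_image cP uF FS.
  have FA : F (S `&` ([set x | N (P1 x - l1) < e / 8] `&`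
      [set x | N (P x - l2) < e / (8 * (C + 1))])).
    by apply: filterI FS (filterI (h1 _ e8) (h2 _ d0)).
  have [x [/= Sx [x1 x2]]] := filter_ex FA; exists x.
  apply: filterS FA => y [/= Sy [y1 y2]].
  have -> : L y - L x = (L (y - x) - P1 (y - x)) + (P1 y - P1 x) by rewrite [L (y - x)]linearB [P1 (y - x)]linearB; zmod.
  have dP1 : N (P1 y - P1 x) < e / 8 + e / 8.
    by rewrite (le_lt_trans (rdistD l1 _ _))// ltrD// rdistC.
  have dP : N (P (y - x)) <= e / (8 * (C + 1)) + e / (8 * (C + 1)).
    by rewrite linearB (le_trans (rdistD l2 _ _))// lerD// ?ltW// rdistC.
  have dyx : N (y - x) <= 1 + 1 by rewrite (le_trans (rnormB _ _))// lerD.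
  have CP : C * N (P (y - x)) <= e / 8 + e / 8.
    have C1 : 0 < C + 1 by rewrite ltr_wpDl.
    have Ce : C * (e / (8 * (C + 1))) <= e / 8.
      rewrite (_ : C * _ = e / 8 * (C / (C + 1))); last by field; rewrite gt_eqF.
      by rewrite ler_piMr ?(ltW e8)// ler_pdivrMr// mul1r lerDl.
    by rewrite (le_trans (ler_wpM2l C0 dP))// mulrDr lerD.
  have ed : e / 8 * N (y - x) <= e / 8 * (1 + 1) by rewrite ler_wpM2l// ltW.
  rewrite (le_lt_trans (rnormD _ _))//; have := hP (y - x); lra.
have : cvg (L @ F).
  apply/cauchy_cvgP; apply: cauchy_exP => e e0.
  have eE : of_real k (real_part e) = e by rewrite of_real_part// ltW.
  have [|x Fx] := cF (real_part e); first by rewrite -(ltr_of_real k) eE of_real0.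
  exists (L x); suff : F (L @^-1` ball (L x) e) by [].
  apply: filterS Fx => y /= xy.
  by rewrite -ball_normE /ball_/= normr_rnorm -eE ltr_of_real rdistC.
by move=> /cvg_rnormP h; exists (lim (L @ F)).
Qed.

End Compactness.

(** * Observation integrals over short and long times *)

Section Estimate.
Context (R : realType) (k : scalar_kind) (p : R).
Local Notation K := (scalars k R).
Local Notation N := rnorm.
Hypothesis p1 : 1 < p.
Let p0 : 0 < p. Proof. exact: lt_trans p1. Qed.
Variables (X U Z : completeNormedModType K).
Variables (iZ Am : {linear Z -> X}) (G M : {linear Z -> U}).
Variable T : R -> {linear X -> X}.
Hypothesis bd : boundary_setting iZ Am G M T.
Let hT : c0_semigroup T := T_semigroup bd.
Local Notation A := (generator T).
Local Notation obs := (observe iZ M).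

Lemma Ip_mono (V : completeNormedModType K) a b (f : R -> V) : 0 <= a -> a <= b ->
  cnt half f -> (Ip p a f <= Ip p b f)%E.
Proof.
move=> a0 ab cf; apply: ge0_subset_integral => //.
- exact: (sm_Ip_measurable p (sm_cnt (le_trans a0 ab) (cnt_seg_half (le_trans a0 ab) cf))).
- by move=> t _; rewrite lee_fin powR_ge0.
- by move=> t; rewrite /= !in_itv/= => /andP[-> /le_trans]; apply.
Qed.

Hypothesis zc : zero_class_admissible p iZ G M T.

Lemma cnt_observe_orbit x y : A (x, y) -> cnt half (obs \o T^~ x).
Proof.
move=> xy; have Txy s : 0 <= s -> A (T s x, T s y) by move=> s0; exact: generator_T.
by have [] := observe_along bd 0 (orbit_cnt hT x) (orbit_cnt hT y) Txy.
Qed.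

Lemma zero_class_small (e : R) : 0 < e -> exists2 d : R, 0 < d & forall x y, A (x, y) ->
  (Ip p d (obs \o T^~ x) <= ((e * N x) `^ p)%:E)%E.
Proof.
move=> e0; have op : open [set y : \bar R | (y < e%:E)%E] by exact: open_ereal_lt_ereal.
have e0' : (0 < e%:E)%E by rewrite lte_fin.
have h : \forall d \near 0^'+, (observation_constant p iZ G M T d < e%:E)%E.
  exact: (zc (open_nbhs_nbhs (conj op e0'))).
have h0 : \forall d \near (0 : R)^'+, 0 < d by exact: nbhs_right_gt.
have [d [dh d0]] : exists d : R, (observation_constant p iZ G M T d < e%:E)%E /\ 0 < d.
  by apply: (@filter_ex _ (0 : R)^'+); exact: filterI h h0.
have /ereal_inf_lt[_ [g [g0 hg] <-] ge] := dh.
exists d => // x y /(mainP bd)[z [Gz <- _]]; apply: (le_trans (hg z Gz)).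
rewrite -powRM ?(ltW g0)// lee_fin; apply: (powR_lexp p1).
  by rewrite mulr_ge0// ltW.
by rewrite ler_wpM2r// ltW.
Qed.

(** The short-time estimate is iterated over steps of length [d], each step replacing [x] by
    [T d x]. The constant is carried for p-th powers, which add up over the steps, and its root is
    taken at the end. *)
Lemma observation_bound t : 0 <= t -> exists2 D : R, 0 <= D & forall x y, A (x, y) ->
  (Ip p t (obs \o T^~ x) <= ((D * N x) `^ p)%:E)%E.
Proof.
move=> t0; have [d d0 hd] := zero_class_small ltr01.
suff [D D0 hD] : exists2 D : R, 0 <= D & forall x y, A (x, y) ->
    (Ip p (d * (Num.truncn (t / d)).+1%:R) (obs \o T^~ x) <= (D * N x `^ p)%:E)%E.
  exists (D `^ p^-1) => [|x y xy]; first exact: powR_ge0.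
  rewrite powRM ?powR_ge0// powRKV//; apply: le_trans (hD x y xy).
  apply: Ip_mono => //; last exact: cnt_observe_orbit xy.
  by rewrite mulrC -ler_pdivrMr// ltW// truncnS_gt.
elim: _.+1 => [|n [D D0 IH]].
  exists 0 => // x y xy; rewrite mulr0 mul0r /Ip.
  by rewrite set_itv1 integral_set1.
have [C C1 hC] := sg_bound hT d.
have C0 : 0 <= C by rewrite (le_trans ler01).
exists (1 + D * C `^ p) => [|x y xy]; first by rewrite addr_ge0// mulr_ge0// powR_ge0.
have [->|n0] := eqVneq n 0%N.
  rewrite mulr1; apply: (le_trans (hd x y xy)); rewrite mul1r lee_fin mulrDl mul1r lerDl.
  by rewrite !mulr_ge0// powR_ge0.
have dn0 : 0 < d * n%:R by rewrite mulr_gt0// ltr0n lt0n.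
have := Ip_shift p1 (cnt_observe_orbit xy) (ltW d0) dn0.
rewrite (_ : d * n%:R + d = d * n.+1%:R); last by rewrite -natr1; ring.
move=> /le_trans; apply.
have -> : Ip p (d * n%:R) (fun s => (obs \o T^~ x) (s + d)) = Ip p (d * n%:R) (obs \o T^~ (T d x)).
  apply: eq_integral => s; rewrite inE/= in_itv/= => /andP[s0 _].
  by rewrite (c0_add hT)// ltW.
rewrite mulrDl EFinD; apply: leeD; first by have := hd x y xy; rewrite !mul1r.
apply: (le_trans (IH _ _ (generator_T hT (ltW d0) xy))).
rewrite lee_fin -mulrA ler_wpM2l// -powRM//; apply: (powR_lexp p1) => //.
by apply: hC; rewrite (ltW d0) lexx.
Qed.

Lemma observation_split t (e : R) : 0 <= t -> 0 < e -> exists2 d : R, 0 < d &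
  exists2 D : R, 0 <= D & forall x y, A (x, y) ->
    (Ip p t (obs \o T^~ x) <= ((e * N x + D * N (T d x)) `^ p)%:E)%E.
Proof.
move=> t0 e0; have e20 : 0 < e / 2 by rewrite divr_gt0.
have [d d0 hd] := zero_class_small e20; exists d => //.
have [t00|tn0] := eqVneq t 0.
  exists 0 => // x y xy; rewrite t00 /Ip set_itv1 integral_set1 lee_fin; exact: powR_ge0.
have tp : 0 < t by rewrite lt_neqAle eq_sym tn0.
have [D D0 hD] := observation_bound t0; exists (2 * D) => [|x y xy]; first by rewrite mulr_ge0.
have td0 : 0 <= t + d by rewrite addr_ge0// ltW.
apply: (@le_trans _ _ (Ip p (t + d) (obs \o T^~ x))).
  by apply: Ip_mono => //; [rewrite lerDl ltW|exact: cnt_observe_orbit xy].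
apply: (le_trans (Ip_shift p1 (cnt_observe_orbit xy) (ltW d0) tp)).
have -> : Ip p t (fun s => (obs \o T^~ x) (s + d)) = Ip p t (obs \o T^~ (T d x)).
  apply: eq_integral => s; rewrite inE/= in_itv/= => /andP[s0 _].
  by rewrite (c0_add hT)// ltW.
apply: (le_trans (leeD (hd x y xy) (hD _ _ (generator_T hT (ltW d0) xy)))).
rewrite -EFinD lee_fin; set a := e / 2 * N x; set b := D * N _.
have a0 : 0 <= a by rewrite mulr_ge0// ltW.
have b0 : 0 <= b by rewrite mulr_ge0.
have -> : e * N x + 2 * D * N (T d x) = 2 * (a + b) by rewrite /a /b; field.
rewrite powRM ?addr_ge0//.
have h2 : 2 <= 2 `^ p by rewrite -[leLHS]powRr1// ler_powR ?ler1n// ltW.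
apply: (@le_trans _ _ (2 * (a + b) `^ p)); last by rewrite ler_wpM2r ?powR_ge0.
rewrite mulr_natl mulr2n lerD//; apply: (powR_lexp p1) => //; first by rewrite lerDl.
by rewrite lerDr.
Qed.

End Estimate.

(** * Comparison of the open-loop and closed-loop semigroups *)

Section Perturbation.
Context (R : realType) (k : scalar_kind) (p : R).
Local Notation K := (scalars k R).
Local Notation N := rnorm.
Hypothesis p1 : 1 < p.
Let p0 : 0 < p. Proof. exact: lt_trans p1. Qed.
Variables (X U Z : completeNormedModType K).
Variables (iZ Am : {linear Z -> X}) (G M : {linear Z -> U}).
Variable T : R -> {linear X -> X}.
Hypothesis bd : boundary_setting iZ Am G M T.
Let hT : c0_semigroup T := T_semigroup bd.
Local Notation A := (generator T).
Local Notation obs := (observe iZ M).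
Variables (Xm1 : completeNormedModType K) (j : {linear X -> Xm1}).
Variables (Tm1 : R -> {linear Xm1 -> Xm1}) (Am1 : {linear X -> Xm1}).
Variable B : {linear U -> Xm1}.
Hypothesis ex : extrapolation_setting iZ Am G T j Tm1 Am1.
Hypothesis ct : is_control_operator iZ Am G j Am1 B.
Variable F : (R -> U) -> R -> U.
Hypothesis sr : regular p iZ G M T j Tm1 B F.
Hypothesis fb : identity_feedback_admissible p F.
Hypothesis zc : zero_class_admissible p iZ G M T.
Variable Tcl : R -> {linear X -> X}.
Hypothesis hS : c0_semigroup Tcl.
Hypothesis clE : generator Tcl = closed_loop_operator iZ Am G M j Am1 B.
Local Notation J3 n f := (iter 3 (smooth n) f).

(** The feedback bound lives on the fixed interval [[0, tau]] and the control bound at the fixed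
    time [b]. Restriction of the control to [[0, t]] and a delay by [b - t] bring both to the time
    [t]. *)
Lemma perturbation_domain : exists2 tau : R, 0 < tau & exists2 b : R, 0 < b & exists2 C : R, 0 <= C &
  forall t x y (nu : R), 0 < t -> t <= b -> t <= tau -> A (x, y) -> 0 <= nu ->
    (Ip p tau (obs \o T^~ x) <= (nu `^ p)%:E)%E -> N (Tcl t x - T t x) <= C * nu.
Proof.
have [[[b b0 adm] _ _] io rg] := sr; have [tau tau0 [_ [cF hF]]] := fb.
have [C C0 hC] := control_bound p1 bd ex ct (ltW b0) adm.
exists tau => //; exists b => //; exists (C * `|cF|) => [|t x y nu t0 tb ttau xy nu0 Inu].
  by rewrite mulr_ge0.
have [v hv] := choice (fun n : nat => feedback_identity p1 bd ex ct io rg hS clE n.+1%:R xy).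
have [cO _ _ _ _] := hv 0%N.
have tau0' := ltW tau0.
have [D D0 hD] := cnt_bounded tau0' (cnt_seg_half tau0' cO).
have cJ n : cnt half (J3 n (obs \o T^~ x)) by exact: (cnt_iter_smooth n 3 cO).
have smJ n := sm_cnt tau0' (cnt_seg_half tau0' (cJ n)).
have IJ := Ip_dominated p1 tau0' (sm_cnt tau0' (cnt_seg_half tau0' cO)) (fun n => smJ n.+1%:R)
  (C := D).
have {}IJ : Ip p tau (J3 n.+1%:R (obs \o T^~ x)) @[n --> \oo] --> Ip p tau (obs \o T^~ x).
  apply: IJ => [n s st|s /andP[s0 _]]; last exact: (iter_smooth_cvg 3 cO s0).
  rewrite -[J3 _ _ s]subr0; apply: (iter_smooth_bound (b := tau) 3 _ cO) st => //.
    by rewrite rnorm0.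
  by move=> r hr; rewrite subr0; exact: hD.
apply: le_epsilon => e e0; pose e' := e / (C * `|cF| + 1).
have c1 : 0 < C * `|cF| + 1 by rewrite ltr_wpDl// mulr_ge0.
have e'0 : 0 < e' by rewrite divr_gt0.
have [n0 hn0] : exists n0, forall n, (n0 <= n)%N ->
    (Ip p tau (J3 n.+1%:R (obs \o T^~ x)) <= ((nu + e') `^ p)%:E)%E.
  have lt1 : (Ip p tau (obs \o T^~ x) < ((nu + e') `^ p)%:E)%E.
    rewrite (le_lt_trans Inu)// lte_fin gt0_ltr_powR ?nnegrE ?addr_ge0 ?(ltW e'0)//.
    by rewrite ltrDl.
  have op : open [set y : \bar R | (y < ((nu + e') `^ p)%:E)%E] by exact: open_ereal_lt_ereal.
  have [n0 _ h] := IJ _ (open_nbhs_nbhs (conj op lt1)).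
  by exists n0 => n /h /ltW.
have key n : (n0 <= n)%N ->
    N (J3 n.+1%:R (Tcl^~ x) t - J3 n.+1%:R (T^~ x) t) <= C * (`|cF| * (nu + e')).
  move=> /hn0 In; have [_ v0 W2 st ae] := hv n; have [_ cv _ _ _] := st.
  have lv := Lp_loc_cnt p1 cv; have [smF _] := io_Lp_loc io lv tau0.
  have smv := sm_cnt tau0' (cnt_seg_half tau0' cv).
  have nue : 0 <= nu + e' by rewrite addr_ge0// ltW.
  have cn0 : 0 <= `|cF| * (nu + e') by rewrite mulr_ge0.
  have Lv : (Lpnorm p tau (fun s => v n s - F (v n) s)%R <= (nu + e')%:E)%E.
    apply: (Lpnorm_leP p1 _ _ nue).2; apply: le_trans In; rewrite le_eqVlt; apply/orP; left.
    apply/eqP; apply: (Ip_ae p (sm_sub smv smF) (smJ _)).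
    by apply: ae_mono ae => s hs /andP[s0 _]; exact: hs.
  have Lv' : (Lpnorm p tau (v n) <= (`|cF| * (nu + e'))%:E)%E.
    apply: (le_trans (hF _ lv)); rewrite EFinM.
    apply: (@le_trans _ _ (`|cF|%:E * Lpnorm p tau (fun s => v n s - F (v n) s)%R)%E).
      by apply: lee_wpmul2r; rewrite ?lee_fin ?ler_norm// LpnormE poweR_ge0.
    by apply: lee_wpmul2l; rewrite ?lee_fin.
  apply: (control_bound_le (p := p) (b := b) p1 hC t0 tb st v0 cn0).
  by apply: le_trans ((Lpnorm_leP p1 _ _ cn0).1 Lv'); exact: Ip_mono (ltW t0) ttau cv.
have cJS := iter_smooth_cvg 3 (orbit_cnt hS x) t0.
have cJT := iter_smooth_cvg 3 (orbit_cnt hT x) t0.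
have lim_le : N (Tcl t x - T t x) <= C * (`|cF| * (nu + e')).
  by apply: (rnorm_lim_le (cvgB cJS cJT)); exists n0.
apply: (le_trans lim_le); rewrite mulrA mulrDr lerD2l /e' mulrCA ler_piMr ?(ltW e0)//.
by rewrite ler_pdivrMr// mul1r lerDl.
Qed.

Lemma perturbation_estimate : exists2 b : R, 0 < b & forall t (e : R), 0 < t -> t <= b -> 0 < e ->
  exists d D : R, [/\ 0 < d, 0 <= D &
    forall x, N (Tcl t x - T t x) <= e * N x + D * N (T d x)].
Proof.
have [tau tau0 [b b0 [C C0 hC]]] := perturbation_domain.
exists (Num.min b tau) => [|t e t0]; first by rewrite lt_min b0.
rewrite le_min => /andP[tb ttau] e0.
have C1 : 0 < C + 1 by rewrite ltr_wpDl.
have [d d0 [D D0 hD]] := observation_split p1 bd zc (ltW tau0) (divr_gt0 e0 C1).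
exists d, ((C + 1) * D); split=> //; first by rewrite mulr_ge0// ltW.
have est x y : A (x, y) -> N (Tcl t x - T t x) <= e * N x + (C + 1) * D * N (T d x).
  move=> xy; have nu0 : 0 <= e / (C + 1) * N x + D * N (T d x).
    by rewrite addr_ge0// mulr_ge0// divr_ge0// ltW.
  rewrite (le_trans (hC t x y _ t0 tb ttau xy nu0 (hD x y xy)))//.
  rewrite (_ : e * N x + _ = (C + 1) * (e / (C + 1) * N x + D * N (T d x))).
    by rewrite ler_wpM2r// lerDl.
  by field; rewrite gt_eqF.
have [c1 c10 h1] := sg_bounded_at hS (ltW t0); have [c2 c20 h2] := sg_bounded_at hT (ltW t0).
have [c3 c30 h3] := sg_bounded_at hT (ltW d0).
move=> x; apply: le_epsilon => r r0.
(* The estimate extends from the domain by density; [q] collects the coefficients of the distance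
   [h] in all the error terms. *)
pose q := c1 + c2 + e + (C + 1) * D * c3 + 1.
have CD0 : 0 <= (C + 1) * D by rewrite mulr_ge0// ltW.
have q0 : 0 < q by rewrite ltr_wpDl// !addr_ge0 ?(ltW e0)// mulr_ge0.
have [[x' y'] /= xy' xx'] := generator_dense hT x (divr_gt0 r0 q0).
have -> : Tcl t x - T t x = (Tcl t x' - T t x') + (Tcl t (x - x') - T t (x - x')).
  by rewrite [Tcl t (x - x')]linearB [T t (x - x')]linearB; zmod.
set h := N (x - x') in xx'; have h0 : 0 <= h by exact: rnorm_ge0.
have e1 : N x' <= N x + h by rewrite (le_trans (rnorm_split x _))// addrC lerD2l /h rdistC.
have e2 : N (T d x') <= N (T d x) + c3 * h.
  rewrite (le_trans (rnorm_split (T d x) _))// addrC lerD2l -linearB (le_trans (h3 _))//.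
  by rewrite /h rdistC.
have e3 : N (Tcl t (x - x') - T t (x - x')) <= (c1 + c2) * h.
  by rewrite (le_trans (rnormB _ _))// mulrDl lerD// ?h1 ?h2.
rewrite (le_trans (rnormD _ _))//.
have := lerD (est _ _ xy') e3.
have := ler_wpM2l (ltW e0) e1; have := ler_wpM2l CD0 e2.
have : q * h <= r by rewrite mulrC -ler_pdivlMr.
rewrite /q; lra.
Qed.

End Perturbation.

Lemma compact_comp (R : realType) (k : scalar_kind) (X : completeNormedModType (scalars k R))
    (L P : {linear X -> X}) : continuous L -> compact_operator P -> compact_operator (L \o P).
Proof.
move=> cL; rewrite /compact_operator !precompactE => cP.
have cI : compact (L @` closure (P @` [set x | rnorm x <= 1])).
  by apply: continuous_compact => //; exact: continuous_subspaceT.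
apply: (subclosed_compact _ cI); first exact: closed_closure.
have cl : closed (L @` closure (P @` [set x | rnorm x <= 1])).
  by apply: compact_closed => //; exact: norm_hausdorff.
rewrite [X in _ `<=` X](closure_id _).1//; apply: closureS => _ [x Sx <-].
by exists (P x) => //; apply: subset_closure; exists x.
Qed.

Theorem theorem3p4 (R : realType) (k : scalar_kind) (p : R)
    (X U Z : completeNormedModType (scalars k R))
    (iZ Am : {linear Z -> X}) (G M : {linear Z -> U})
    (T : R -> {linear X -> X})
    (Xm1 : completeNormedModType (scalars k R)) (j : {linear X -> Xm1})
    (Tm1 : R -> {linear Xm1 -> Xm1}) (Am1 : {linear X -> Xm1})
    (B : {linear U -> Xm1}) (F : (R -> U) -> R -> U)
    (Tcl : R -> {linear X -> X})
    (p_gt1 : 1 < p)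
    (boundary : boundary_setting iZ Am G M T)
    (extrapolation : extrapolation_setting iZ Am G T j Tm1 Am1)
    (control : is_control_operator iZ Am G j Am1 B)
    (system_regular : regular p iZ G M T j Tm1 B F)
    (feedback : identity_feedback_admissible p F)
    (zero_class : zero_class_admissible p iZ G M T)
    (Tcl_semigroup : c0_semigroup Tcl)
    (Tcl_generator : generator Tcl = closed_loop_operator iZ Am G M j Am1 B) :
  immediately_compact T -> immediately_compact Tcl.
Proof.
move=> cT; have [b b0 hb] := perturbation_estimate p_gt1 boundary extrapolation control
  system_regular feedback zero_class Tcl_semigroup Tcl_generator.
have small t : 0 < t -> t <= b -> compact_operator (Tcl t).
  move=> t0 tb; apply: (compact_of_estimate (cT t t0)) => e e0.
  have [d [D [d0 D0 hD]]] := hb t e t0 tb e0.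
  by exists (T d), D => //; split=> //; exact: cT.
(* The estimate covers [t <= b]; beyond it, [Tcl t] factors through the compact operator [Tcl b]. *)
move=> t t0; have [tb|bt] := leP t b; first exact: small.
have tb0 : 0 <= t - b by rewrite subr_ge0 ltW.
have -> : (Tcl t : X -> X) = Tcl (t - b) \o Tcl b.
  by apply/funext => x; rewrite -[in LHS](subrK b t) (c0_add Tcl_semigroup)// ltW.
apply: compact_comp; last exact: small.
exact: (c0_bounded Tcl_semigroup).
Qed.
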